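(* Let $\mathbb{F}$ be an algebraically closed field of characteristic $p>3$, let $c\in\mathbb{F}$, and let $\sigma$ be the parity automorphism of the Neveu-Schwarz vertex superalgebra $V_{\mathcal{NS}}(c,0)$. Let $\mathbb{F}\langle x,y\rangle$ be the free associative algebra generated by $x,y$. Then $$A_\sigma(V_{\mathcal{NS}}(c,0))\cong\mathbb{F}\langle x,y\rangle\big/\big(xy-yx,\ y^2-x+\tfrac1{24}c\big),$$ where $x$ corresponds to $[\omega]$ and $y$ corresponds to $[\tau]$, with $\omega=L_{-2}\mathbf 1$ and $\tau=G_{-\frac32}\mathbf 1$.
   Context: Conventions. $\mathbb{N}=\{0,1,2,\dots\}$; rational numbers with denominator prime to $p$ (in particular $\binom\alpha i$ with $\alpha\in\frac12\mathbb{Z}$) are read in $\mathbb{F}$ via reduction mod $p$; $(1+z)^\alpha:=\sum_{i\ge0}\binom\alpha iz^i$; $\mathrm{Res}_z$ is the coefficient of $z^{-1}$. Neveu-Schwarz algebra $\mathcal{NS}$: Lie superalgebra with basis $L_n,G_{n+\frac12}$ ($n\in\mathbb{Z}$), $\mathbf c$; $L_n,\mathbf c$ even, $G_{n+\frac12}$ odd, $\mathbf c$ central, $[L_m,L_n]=(m-n)L_{m+n}+\frac12\binom{m+1}3\delta_{m+n,0}\mathbf c$, $[L_m,G_{n+\frac12}]=(\frac m2-n-\frac12)G_{m+n+\frac12}$, $[G_{m+\frac12},G_{n-\frac12}]=2L_{m+n}+\frac13m(m+1)\delta_{m+n,0}\mathbf c$. For $c\in\mathbb{F}$, $V_{\mathcal{NS}}(c,0)=U(\mathcal{NS})\otimes_{U(\mathcal{NS}_*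 )}\mathbb{F}_c$, where $\mathcal{NS}_*$ is spanned by $L_n$ ($n\ge-1$), $G_{n+\frac12}$ ($n\ge-1$) and $\mathbf c$, and on the one-dimensional module $\mathbb{F}_c$ all these $L_n,G_{n+\frac12}$ act as $0$ and $\mathbf c$ as $c$. It is a vertex superalgebra (vacuum, creation, truncation and super Jacobi identity axioms) $v\mapsto Y(v,z)=\sum_{n\in\mathbb{Z}}v_nz^{-n-1}$, uniquely determined by vacuum $\mathbf 1=1\otimes1$, $Y(\omega,z)=\sum_{m\in\mathbb{Z}}L_mz^{-m-2}$, $Y(\tau,z)=\sum_{n\in\mathbb{Z}}G_{n+\frac12}z^{-n-2}$. It is $\frac12\mathbb{Z}$-graded with $\deg\mathbf 1=0$, $L_{-m}$ of degree $m$ and $G_{-m-\frac12}$ of degree $m+\frac12$; the even (odd) part is the sum of the integral (half-integral) degree components. $\sigma(v)=(-1)^{|v|}v$. Twisted Zhu algebra for $g=\sigma$ (so $g\sigma=1$): for $V=V_{\mathcal{NS}}(c,0)$, homogeneous $u\in V$, $v\in V$, $n\in\mathbb{N}$, $u\circ_\sigma^nv=\mathrm{Res}_z\frac{(1+z)^{\deg u}}{z^{2+n}}Y(u,z)v$, $u*_\sigma v=\mathrm{Res}_z\frac{(1+z)^{\deg u}}zY(u,z)v$, extended bilinearly; $O_\sigma(V)$ is the span of all $u\circ_\sigma^nv$; $A_\sigma(V)=V/O_\sigma(V)$ is an associative algebra under $*_\sigma$ with identity $\mathbf 1+O_\sigma(V)$; $[v]=v+O_\sigma(V)$. *)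

(* Defs.v *)
From HB Require Import structures.
From mathcomp Require Import all_boot all_order all_algebra.
From mathcomp Require Import mathcomp_extra boolp classical_sets functions.
From mathcomp Require Import cardinality fsbigop.
From mathcomp Require Import finmap monalg.

Set Implicit Arguments.
Unset Strict Implicit.
Unset Printing Implicit Defensive.

Import GRing.Theory.

Local Open Scope classical_set_scope.
Local Open Scope ring_scope.
Local Open Scope quotient_scope.

Definition subspace (F : fieldType) (V : lmodType F) (W : set V) : Prop :=
  W 0 /\ forall (a : F) u v, W u -> W v -> W (a *: u + v).

Section Span.
Variables (F : fieldType) (V : lmodType F) (S : set V).

Definition span : set V := smallest (@subspace F V) S.

Lemma span_subspace : subspace span.
Proof.
split=> [|a u v us vs] W [sW SW]; first by case: sW.
by case: (sW) => _; apply; [apply: us|apply: vs].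
Qed.

Definition span_pred : {pred V} := fun v => `[< span v >].

Lemma span_pred_submod : submod_closed span_pred.
Proof.
have [s0 sl] := span_subspace; split=> [|a u v]; rewrite !unfold_in.
  exact/asboolP.
by move=> /asboolP us /asboolP vs; apply/asboolP; exact: sl us vs.
Qed.

HB.instance Definition _ := GRing.isSubmodClosed.Build F V span_pred
  span_pred_submod.

Definition lquot := Quotient.quot span_pred.
HB.instance Definition _ := EqQuotient.on lquot.
HB.instance Definition _ := Choice.on lquot.
HB.instance Definition _ := GRing.Zmodule.on lquot.

Definition lcls (v : V) : lquot := \pi_lquot v.

Lemma lclsP u v : lcls u = lcls v <-> span (u - v).
Proof.
rewrite /lcls; split=> [/eqP|uv].
  by rewrite -Quotient.idealrBE unfold_in => /asboolP.
by apply/eqP; rewrite -Quotient.idealrBE unfold_in; apply/asboolP.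
Qed.

Lemma lcls_surj (q : lquot) : exists v, q = lcls v.
Proof. by exists (repr q); rewrite /lcls reprK. Qed.

Lemma lclsB u v : lcls (u - v) = lcls u - lcls v.
Proof. exact: (raddfB (\pi_lquot)). Qed.

Lemma lclsD u v : lcls (u + v) = lcls u + lcls v.
Proof. exact: (raddfD (\pi_lquot)). Qed.

Definition lquot_scale (a : F) (q : lquot) : lquot := lcls (a *: repr q).

Lemma lquot_scaleE a v : lquot_scale a (lcls v) = lcls (a *: v).
Proof.
apply/lclsP; rewrite -scalerBr -[_ *: _]addr0.
have [s0 sl] := span_subspace; apply: sl => //; apply/lclsP.
by rewrite /lcls reprK.
Qed.

Fact lquot_scaleA a b q : lquot_scale a (lquot_scale b q) = lquot_scale (a * b) q.
Proof. by have [v ->] := lcls_surj q; rewrite !lquot_scaleE scalerA. Qed.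
Fact lquot_scale1 : left_id 1 lquot_scale.
Proof. by move=> q; have [v ->] := lcls_surj q; rewrite lquot_scaleE scale1r. Qed.
Fact lquot_scaleDr : right_distributive lquot_scale +%R.
Proof.
move=> a q r; have [u ->] := lcls_surj q; have [v ->] := lcls_surj r.
by rewrite -lclsD !lquot_scaleE scalerDr lclsD.
Qed.
Fact lquot_scaleDl q : {morph lquot_scale^~ q : a b / a + b}.
Proof.
by move=> a b; have [v ->] := lcls_surj q; rewrite !lquot_scaleE scalerDl lclsD.
Qed.

HB.instance Definition _ := GRing.Zmodule_isLmodule.Build F lquot
  lquot_scaleA lquot_scale1 lquot_scaleDr lquot_scaleDl.

Fact lcls_linear : linear lcls.
Proof. by move=> a u v; rewrite lclsD -lquot_scaleE. Qed.
HB.instance Definition _ := GRing.isLinear.Build F V lquot _ lcls lcls_linear.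

End Span.

Arguments lcls {F V} S v.

Section FreeAlgebra.
Variables (F : fieldType) (X : choiceType).

Definition free_alg := {malg F[{fmonom X}]}.
HB.instance Definition _ := GRing.Lalgebra.on free_alg.

Fact free_alg_scaleAr (a : F) (u v : free_alg) : a *: (u * v) = u * (a *: v).
Proof.
apply/malgP => k; rewrite mcoeffZ mcoeffMl.
rewrite (mcoeffMlw k (fsubset_refl (msupp u)) (msuppZ_le a v)).
rewrite mulr_sumr; apply: eq_bigr => i _; rewrite mulr_sumr.
by apply: eq_bigr => j _; rewrite mcoeffZ mulrnAr mulrCA.
Qed.

HB.instance Definition _ := GRing.Lalgebra_isAlgebra.Build F free_alg
  free_alg_scaleAr.

Definition gen (x : X) : free_alg := mkmalgU (fmu x) 1.

End FreeAlgebra.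

Arguments gen F {X} x.

Section AlgebraQuotient.
Variables (F : fieldType) (A : algType F) (R : set A).

Definition ideal_gens : set A :=
  [set x | exists a r b, R r /\ x = a * r * b].

(* A modulo the two-sided ideal generated by R; possibly the zero ring *)
Definition aquot := lquot ideal_gens.
HB.instance Definition _ := GRing.Lmodule.on aquot.

Definition acls (a : A) : aquot := lcls ideal_gens a.
HB.instance Definition _ := GRing.isLinear.Build F A aquot _ acls
  (@lcls_linear F A ideal_gens).

Lemma idealMl a x : span ideal_gens x -> span ideal_gens (a * x).
Proof.
apply: (@smallest_sub _ _ _ [set x | span ideal_gens (a * x)]) => /=; last first.
  move=> _ [b [r [d [Rr ->]]]]; apply: sub_gen_smallest.
  by exists (a * b), r, d; rewrite !mulrA.
have [s0 sl] := span_subspace ideal_gens; split=> [|k u v].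
  by rewrite /= mulr0.
move=> /= us vs.
by rewrite mulrDr -scalerAr; exact: sl.
Qed.

Lemma idealMr a x : span ideal_gens x -> span ideal_gens (x * a).
Proof.
apply: (@smallest_sub _ _ _ [set x | span ideal_gens (x * a)]) => /=; last first.
  move=> _ [b [r [d [Rr ->]]]]; apply: sub_gen_smallest.
  by exists b, r, (d * a); rewrite !mulrA.
have [s0 sl] := span_subspace ideal_gens; split=> [|k u v].
  by rewrite /= mul0r.
move=> /= us vs.
by rewrite mulrDl -scalerAl; exact: sl.
Qed.

Definition aquot_one : aquot := acls 1.
Definition aquot_mul (x y : aquot) : aquot :=
  acls ((repr x : A) * (repr y : A)).

Lemma aquot_mulE a b : aquot_mul (acls a) (acls b) = acls (a * b).
Proof.
have reprB u : span ideal_gens (repr (acls u) - u).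
  by apply/lclsP; rewrite /acls /lcls reprK.
apply/lclsP; set a' := repr _; set b' := repr _.
have -> : (a' : A) * b' - a * b = 1 *: (a' * (b' - b)) + (a' - a) * b.
  by rewrite scale1r mulrBr mulrBl addrA subrK.
have [_ sl] := span_subspace ideal_gens.
by apply: sl; [exact: idealMl (reprB b)|exact: idealMr (reprB a)].
Qed.

Lemma acls_surj (x : aquot) : exists a, x = acls a.
Proof. exact: lcls_surj. Qed.

Fact aquot_mulA : associative aquot_mul.
Proof.
move=> x y z; have [a ->] := acls_surj x; have [b ->] := acls_surj y.
by have [d ->] := acls_surj z; rewrite !aquot_mulE mulrA.
Qed.
Fact aquot_mul1 : left_id aquot_one aquot_mul.
Proof. by move=> x; have [a ->] := acls_surj x; rewrite aquot_mulE mul1r. Qed.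
Fact aquot_1mul : right_id aquot_one aquot_mul.
Proof. by move=> x; have [a ->] := acls_surj x; rewrite aquot_mulE mulr1. Qed.
Fact aquot_mulDl : left_distributive aquot_mul +%R.
Proof.
move=> x y z; have [a ->] := acls_surj x; have [b ->] := acls_surj y.
by have [d ->] := acls_surj z; rewrite -linearD !aquot_mulE mulrDl linearD.
Qed.
Fact aquot_mulDr : right_distributive aquot_mul +%R.
Proof.
move=> x y z; have [a ->] := acls_surj x; have [b ->] := acls_surj y.
by have [d ->] := acls_surj z; rewrite -linearD !aquot_mulE mulrDr linearD.
Qed.

HB.instance Definition _ := GRing.Zmodule_isPzRing.Build aquot
  aquot_mulA aquot_mul1 aquot_1mul aquot_mulDl aquot_mulDr.

Fact acls_monoid_morphism : monoid_morphism acls.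
Proof. by split=> // a b; rewrite -aquot_mulE. Qed.
HB.instance Definition _ := GRing.isMonoidMorphism.Build A aquot acls
  acls_monoid_morphism.

End AlgebraQuotient.

Arguments acls {F A} R a.

Section VertexSuperalgebra.
Variables (F : fieldType).

(* The generalized binomial coefficient binom(al, i) is computed in rat and
   then sent to F by ratr, i.e. numerator / denominator. *)
Definition binomF (al : rat) (i : nat) : F :=
  ratr ((\prod_(j < i) (al - j%:R)) / (i`!)%:R).

Variable V : lmodType F.

(* Y u n v is u_n v, the coefficient of z^(-n-1) in Y(u,z)v; Vp false and
   Vp true are the even and odd parts. Over nat, \sum_(i \in setT) is the sum
   over the (finite) support. The last axiom is the coefficient form of the
   super Jacobi identity
     z0^-1 delta((z1-z2)/z0) Y(u,z1) Y(v,z2) w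
     - (-1)^(|u||v|) z0^-1 delta((z2-z1)/(-z0)) Y(v,z2) Y(u,z1) w
     = z2^-1 delta((z1-z0)/z2) Y(Y(u,z0)v,z2) w. *)
Record vertex_superalgebra (Vp : bool -> set V) (vac : V)
    (Y : V -> int -> V -> V) : Prop := {
  vsa_linearl : forall n v, linear (fun u => Y u n v) ;
  vsa_linearr : forall u n, linear (Y u n) ;
  vsa_sub : forall a, subspace (Vp a) ;
  vsa_sum : forall v, exists v0 v1, [/\ Vp false v0, Vp true v1 & v = v0 + v1] ;
  vsa_direct : forall v, Vp false v -> Vp true v -> v = 0 ;
  vsa_parity : forall a b u v n, Vp a u -> Vp b v -> Vp (a (+) b) (Y u n v) ;
  vsa_vac_even : Vp false vac ;
  vsa_vacuum : forall n v, Y vac n v = if n == -1 then v else 0 ;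
  vsa_creation : forall v, Y v (-1) vac = v /\ (forall n : nat, Y v n%:Z vac = 0) ;
  vsa_truncation : forall u v, exists N : int, forall n, (N <= n)%R -> Y u n v = 0 ;
  vsa_jacobi : forall a b u v w (m n k : int), Vp a u -> Vp b v ->
    \sum_(i \in [set: nat])
       binomF m%:~R i *: Y (Y u (k + i%:Z) v) (m + n - i%:Z) w
    = \sum_(i \in [set: nat])
       ((-1) ^+ i * binomF k%:~R i) *:
         (Y u (m + k - i%:Z) (Y v (n + i%:Z) w)
          - ((-1) ^+ (a && b) * (-1) ^ k) *:
              Y v (n + k - i%:Z) (Y u (m + i%:Z) w)) }.

(* Vd d is the homogeneous component of degree d *)

Variables (Vd : rat -> set V) (Y : V -> int -> V -> V).

(* Res_z (1+z)^d z^(-k) Y(u,z)v *)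
Definition zhu_res (d : rat) (k : int) (u v : V) : V :=
  \sum_(i \in [set: nat]) binomF d i *: Y u (i%:Z - k) v.

(* hcomp u d is the component of degree d of u. The decomposition is unique
   as soon as V is the direct sum of the Vd d. *)
Definition hcomp (u : V) : rat -> V :=
  xget (fun=> 0) [set f : rat -> V |
    [/\ finite_set [set d | f d != 0], (forall d, Vd d (f d)) &
        u = \sum_(d \in [set: rat]) f d]].

Definition zhu_star (u v : V) : V :=
  \sum_(d \in [set: rat]) zhu_res d 1 (hcomp u d) v.

Definition zhu_circ : set V :=
  [set x | exists d (n : nat) u v, Vd d u /\ x = zhu_res d (2 + n%:Z) u v].

(* V / O_sigma(V) as a vector space: span zhu_circ is O_sigma(V). *)
Definition zhu_alg := lquot zhu_circ.
HB.instance Definition _ := GRing.Lmodule.on zhu_alg.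

Definition zhu_cls (v : V) : zhu_alg := lcls zhu_circ v.
HB.instance Definition _ := GRing.isLinear.Build F V zhu_alg _ zhu_cls
  (@lcls_linear F V zhu_circ).

End VertexSuperalgebra.

(* NS_G n stands for G_{n+1/2} *)
Inductive ns_basis := NS_L of int | NS_G of int | NS_c.

Definition ns_encode (x : ns_basis) : int + int + unit :=
  match x with NS_L n => inl (inl n) | NS_G n => inl (inr n) | NS_c => inr tt end.
Definition ns_decode (x : int + int + unit) : ns_basis :=
  match x with inl (inl n) => NS_L n | inl (inr n) => NS_G n | inr _ => NS_c end.
Lemma ns_encodeK : cancel ns_encode ns_decode. Proof. by case. Qed.
HB.instance Definition _ := Countable.copy ns_basis (can_type ns_encodeK).

Definition ns_odd (x : ns_basis) : bool := if x is NS_G _ then true else false.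

Definition ns_deg (x : ns_basis) : rat :=
  match x with
  | NS_L n => - n%:~R
  | NS_G n => - (n%:~R + 2%:R^-1)
  | NS_c => 0
  end.

Section NeveuSchwarz.
Variable F : fieldType.

Definition NS := {malg F[ns_basis]}.
HB.instance Definition _ := GRing.Lmodule.on NS.

Definition ns_elt (x : ns_basis) : NS := mkmalgU x 1.

Definition ns_brLG (m n : int) : NS :=
  (m%:~R / 2%:R - n%:~R - 2%:R^-1) *: ns_elt (NS_G (m + n)).

(* G_{n+1/2} = G_{(n+1)-1/2}, whence the shift by 1 in [G, G]. *)
Definition ns_bracket (x y : ns_basis) : NS :=
  match x, y with
  | NS_L m, NS_L n =>
      (m - n)%:~R *: ns_elt (NS_L (m + n))
      + (2%:R^-1 * binomF F (m + 1)%:~R 3 * (m + n == 0)%:R) *: ns_elt NS_c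
  | NS_L m, NS_G n => ns_brLG m n
  | NS_G n, NS_L m => - ns_brLG m n
  | NS_G m, NS_G n =>
      2%:R *: ns_elt (NS_L (m + (n + 1)))
      + (3%:R^-1 * (m * (m + 1))%:~R * (m + (n + 1) == 0)%:R) *: ns_elt NS_c
  | _, _ => 0
  end.

Definition ns_embed (f : NS) : free_alg F ns_basis :=
  \sum_(x <- msupp f) mcoeff x f *: gen F x.

Definition ns_rels : set (free_alg F ns_basis) :=
  [set r | exists x y,
     r = gen F x * gen F y - (-1) ^+ (ns_odd x && ns_odd y) * (gen F y * gen F x)
         - ns_embed (ns_bracket x y)].

Definition UNS := aquot ns_rels.
HB.instance Definition _ := GRing.Lmodule.on UNS.
HB.instance Definition _ := GRing.PzRing.on UNS.

Definition uns (x : ns_basis) : UNS := acls ns_rels (gen F x).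

Definition ns_sub : set ns_basis :=
  [set x | match x with NS_L n => (-1 <= n)%R | NS_G n => (-1 <= n)%R | NS_c => true end].

Variable c : F.

(* the character by which NS_* acts on F_c *)
Definition ns_char (x : ns_basis) : F := if x is NS_c then c else 0.

(* As F_c is one-dimensional, U(NS) \otimes_{U(NS_* )} F_c is the quotient of
   U(NS) by the balancing relations u x \otimes 1 = u \otimes (x 1). *)
Definition vac_gens : set UNS :=
  [set r | exists u x, ns_sub x /\ r = u * uns x - ns_char x *: u].

Definition VNS := lquot vac_gens.
HB.instance Definition _ := GRing.Lmodule.on VNS.

Definition ns_vac : VNS := lcls vac_gens 1.

Definition ns_act (x : ns_basis) (v : VNS) : VNS :=
  lcls vac_gens (uns x * (repr v : UNS)).

Lemma UNS_scaleAr (a : F) (x y : UNS) : a *: (x * y) = x * (a *: y).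
Proof.
have [u ->] := acls_surj x; have [v ->] := acls_surj y.
by rewrite -rmorphM -!linearZ -rmorphM -scalerAr.
Qed.

Lemma ns_actE x u : ns_act x (lcls vac_gens u) = lcls vac_gens (uns x * u).
Proof.
apply/lclsP; rewrite -mulrBr; set d := _ - u.
have : span vac_gens d by apply/lclsP; rewrite /lcls reprK.
apply: (@smallest_sub _ _ _ [set d | span vac_gens (uns x * d)]) => /=; last first.
  move=> _ [u' [y [sy ->]]]; apply: sub_gen_smallest.
  by exists (uns x * u'), y; rewrite mulrBr mulrA -UNS_scaleAr.
have [s0 sl] := span_subspace vac_gens; split=> [|k e e'].
  by rewrite /= mulr0.
move=> /= us vs.
by rewrite mulrDr -UNS_scaleAr; apply: sl.
Qed.

(* x_1 ... x_k 1 *)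
Definition ns_word (s : seq ns_basis) : VNS := foldr ns_act ns_vac s.

Definition ns_comp (d : rat) : set VNS :=
  span [set v | exists s, \sum_(x <- s) ns_deg x = d /\ v = ns_word s].

(* even part: integral degrees; odd part: degrees in 1/2 + Z *)
Definition ns_part (b : bool) : set VNS :=
  span [set v | exists (k : int), ns_comp (k%:~R + b%:R / 2%:R) v].

Definition ns_omega : VNS := ns_act (NS_L (-2)) ns_vac.
Definition ns_tau : VNS := ns_act (NS_G (-2)) ns_vac.

(* Y(omega,z) = sum L_m z^(-m-2) and Y(tau,z) = sum G_{n+1/2} z^(-n-2) *)
Definition ns_vertex_operator (Y : VNS -> int -> VNS -> VNS) : Prop :=
  [/\ vertex_superalgebra ns_part ns_vac Y,
      (forall m v, Y ns_omega (m + 1) v = ns_act (NS_L m) v) &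
      (forall n v, Y ns_tau (n + 1) v = ns_act (NS_G n) v)].

Definition zhu_NS (Y : VNS -> int -> VNS -> VNS) := zhu_alg ns_comp Y.
HB.instance Definition _ Y := GRing.Lmodule.on (zhu_NS Y).

Definition zhu_NS_rels : set (free_alg F 'I_2) :=
  let x := gen F (0 : 'I_2) in let y := gen F (1 : 'I_2) in
  [set x * y - y * x; y ^+ 2 - x + (24%:R^-1 * c)%:A].

Definition zhu_NS_pres := aquot zhu_NS_rels.
HB.instance Definition _ := GRing.Lmodule.on zhu_NS_pres.
HB.instance Definition _ := GRing.PzRing.on zhu_NS_pres.

End NeveuSchwarz.

(* Main.v *)
Require Import Defs.
From HB Require Import structures.
From mathcomp Require Import all_boot all_order all_algebra.
From mathcomp Require Import mathcomp_extra boolp classical_sets functions.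
From mathcomp Require Import cardinality fsbigop.
From mathcomp Require Import finmap monalg.
From mathcomp Require Import zify ring.
(* brought to the front again: span is also a notion of the vector space library *)
Import Defs.

(** Let [V = V_NS(c,0)] and let [M] be the presented algebra, in which
    [x = y^2 + c/24], so that [M] is commutative and spanned by powers of [y].

    Pairing the fields of [omega] and [tau] with Laurent series, instead of with
    powers of [z], makes a completed Neveu-Schwarz superalgebra [g] modelled
    on [F((z))] act on [V].  The modes [Res (1+z)^(deg u) z^(-k) Y(u,z)] with
    [k >= 1] and [u = omega, tau] span, after a correction of the even ones by a
    multiple of the central element, a subalgebra [n]; together with the
    subalgebra [b] of the power series, which acts on the vacuum by scalars, it
    gives [g = n + b] ([ser_br_nn], [neg_reg_part]).  In [n] the elements with
    [k >= 2] form an ideal, and modulo this ideal the square of the odd generator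
    is the even one.  Hence [n] acts on [M]: the modes with [k >= 2] act by [0],
    the modes with [k = 1] act by multiplication by [x] and by [y] (the
    correction accounts for [c/24]).

    As [V] is induced from the character of [b], there should be a linear map
    [Phi : V -> M] with [Phi 1 = 1] that commutes with [n].  No basis of [V] is
    needed to construct it: a representation of [n] on [M] extends to a
    functional on words in [g] by a recursion on the length of the word, and this
    functional respects all the relations of [g] and the character of [b]
    ([phi_swap], [phi_last]).  The universal property of [V] then gives [Phi]
    ([VNS_lift], [Phi_ex]).

    Conversely [V] is generated from the vacuum by [n] ([zhu_mode_ind]).  By
    induction along this generation, the iterate formula ([zhu_lin_iter]), a case
    of the Jacobi identity, shows for all [u] and [v] that [Phi] kills
    [u o^n v] and that [Phi (u * v) = Phi u Phi v] ([Phi_star]).  So [Phi]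
    factors through [A_sigma(V)].  In the other direction, words in the modes
    with [k = 1] define a linear map from the free algebra to [V]; it is onto
    modulo the image [zhu_deep] of the modes with [k >= 2], which lies in
    [O_sigma(V)], and it maps the ideal of relations into [zhu_deep].  The two
    maps so obtained between [A_sigma(V)] and [M] are inverse to each other
    ([zhu_presentation]).

    The characteristic enters only through [2] and [3] being invertible: they
    make the binomial coefficients of half-integers and the structure constants
    meaningful.  Equations between linear maps on [F((z))] are reduced to powers
    of [z] by [laurent_eq], as all the maps that occur vanish on high powers. *)

Set Implicit Arguments.
Unset Strict Implicit.
Unset Printing Implicit Defensive.
Import Order.TTheory GRing.Theory Num.Theory.
Local Open Scope ring_scope.

(** * Identities between linear combinations *)

Section LinearIdentities.
Variables (R : pzRingType) (V : lmodType R).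

(** Formal linear combinations: syntax, evaluation in an environment of atoms, and
    the coefficient of each atom. *)
Inductive lexp :=
  | LZero | LVar of nat | LAdd of lexp & lexp | LOpp of lexp | LScale of R & lexp.

Fixpoint leval (env : seq V) e : V :=
  match e with
  | LZero => 0
  | LVar i => nth 0 env i
  | LAdd a b => leval env a + leval env b
  | LOpp a => - leval env a
  | LScale k a => k *: leval env a
  end.

Fixpoint lco (i : nat) e : R :=
  match e with
  | LZero => 0
  | LVar j => if eqn i j then 1 else 0
  | LAdd a b => lco i a + lco i b
  | LOpp a => - lco i a
  | LScale k a => k * lco i a
  end.

Lemma levalE env e : leval env e = \sum_(i < size env) lco i e *: nth 0 env i.
Proof.
elim: e => [|j|a IHa b IHb|a IHa|k a IHa] /=.
- by rewrite big1 // => i _; rewrite scale0r.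
- have [jlt|jge] := ltnP j (size env).
    rewrite (bigD1 (Ordinal jlt)) //= -[eqn j j]/(j == j) eqxx scale1r.
    rewrite big1 ?addr0 // => i; rewrite -val_eqE /= -[eqn i j]/((i : nat) == j).
    by move=> /negPf ->; rewrite scale0r.
  rewrite nth_default // big1 // => i _; rewrite -[eqn i j]/((i : nat) == j).
  by rewrite (ltn_eqF (leq_trans (ltn_ord i) jge)) scale0r.
- by rewrite IHa IHb -big_split; apply: eq_bigr => i _; rewrite scalerDl.
- by rewrite IHa -sumrN; apply: eq_bigr => i _; rewrite scaleNr.
- by rewrite IHa scaler_sumr; apply: eq_bigr => i _; rewrite scalerA.
Qed.

(** Conjunction of [P i] for [i < n]; unfolded by computation when [n] is a
    numeral. *)
Fixpoint lall (P : nat -> Prop) (n : nat) : Prop :=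
  if n is n'.+1 then lall P n' /\ P n' else True.

(** Two linear combinations are equal as soon as each atom has the same
    coefficient in both. *)
Lemma leval_eq env e1 e2 :
  lall (fun i => lco i e1 = lco i e2) (size env) -> leval env e1 = leval env e2.
Proof.
move=> h; rewrite !levalE; apply: eq_bigr => i _; congr (_ *: _).
have P n k : lall (fun i => lco i e1 = lco i e2) n -> (k < n)%N -> lco k e1 = lco k e2.
  elim: n => // n IH [/IH h1 h2].
  by rewrite ltnS leq_eqVlt => /predU1P[->|/h1].
exact: P h (ltn_ord i).
Qed.
End LinearIdentities.

(* Atoms are compared up to conversion. *)
Ltac lmem x l :=
  match l with
  | nil => constr:(false)
  | cons ?y ?l' =>
      match constr:(Set) with
      | _ => let _ := constr:(erefl x : x = y) in constr:(true)
      | _ => lmem x l'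
      end
  end.
Ltac lidx x l :=
  match l with
  | cons ?y ?l' =>
      match constr:(Set) with
      | _ => let _ := constr:(erefl x : x = y) in constr:(0%N)
      | _ => let n := lidx x l' in constr:(S n)
      end
  end.
Ltac latoms l t :=
  match t with
  | @Algebra.add _ ?a ?b => let l1 := latoms l a in latoms l1 b
  | @Algebra.opp _ ?a => latoms l a
  | @GRing.scale _ _ ?k ?a => latoms l a
  | @Algebra.zero _ => l
  | _ => match lmem t l with
         | true => l
         | false => constr:(cons t l)
         end
  end.
Ltac lreify R l t :=
  match t with
  | @Algebra.add _ ?a ?b =>
      let e1 := lreify R l a in let e2 := lreify R l b in constr:(@LAdd R e1 e2)
  | @Algebra.opp _ ?a => let e := lreify R l a in constr:(@LOpp R e)
  | @GRing.scale _ _ ?k ?a => let e := lreify R l a in constr:(@LScale R k e)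
  | @Algebra.zero _ => constr:(@LZero R)
  | _ => let n := lidx t l in constr:(@LVar R n)
  end.
Ltac lmod_id_ tac R V :=
  match goal with
  | |- @eq _ ?a ?b =>
    let l1 := latoms (@nil V) a in
    let l := latoms l1 b in
    let e1 := lreify R l a in
    let e2 := lreify R l b in
    refine (@leval_eq R V l e1 e2 _); cbn [lall lco size eqn]; repeat split; tac
  end.
(** [lmod_id R V] proves an equation between linear combinations in the [R]-module
    [V]: it compares the coefficients of the atoms by [ring], and leaves the
    comparisons on which [ring] fails. *)
Tactic Notation "lmod_id" constr(R) constr(V) := lmod_id_ ltac:(try ring) R V.

(** * Binomial coefficients of half-integers in a field *)

(** The rational binomial coefficient; [binomF] is its image in the field. *)
Definition binQ (al : rat) (i : nat) : rat :=
  (\prod_(j < i) (al - j%:R)) / (i`!)%:R.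

Lemma factQ_neq0 i : (i`!)%:R != 0 :> rat.
Proof. by rewrite pnatr_eq0 -lt0n fact_gt0. Qed.

Lemma binQ0 al : binQ al 0 = 1.
Proof. by rewrite /binQ big_ord0 fact0 divr1. Qed.

Lemma binQS al i : (i.+1)%:R * binQ al i.+1 = (al - i%:R) * binQ al i.
Proof.
rewrite /binQ big_ord_recr /= factS natrM.
have h1 := factQ_neq0 i; have h2 : (i.+1)%:R != 0 :> rat by rewrite pnatr_eq0.
by field; rewrite h1 -[1 + _](natrD _ 1) add1n h2.
Qed.

Lemma binQ_inj i (x y : rat) : (i.+1)%:R * x = (i.+1)%:R * y -> x = y.
Proof. by apply: mulfI; rewrite pnatr_eq0. Qed.

Lemma binQ_pascal al i : binQ (al + 1) i.+1 = binQ al i.+1 + binQ al i.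
Proof.
elim: i => [|i IH].
  apply: (@binQ_inj 0); rewrite mulrDr !binQS !binQ0; ring.
apply: (@binQ_inj i.+1); rewrite mulrDr !binQS IH.
have h := binQS al i; rewrite mulrDr.
have -> : (al + 1 - i.+1%:R) = al - i%:R by rewrite -[i.+1%:R]natr1; ring.
rewrite -h -[in RHS](natr1 i.+1) -[in RHS](natr1 i); ring.
Qed.

Lemma binQ_vandermonde al be n :
  \sum_(i < n.+1) binQ al i * binQ be (n - i) = binQ (al + be) n.
Proof.
elim: n => [|n IH]; first by rewrite big_ord_recl big_ord0 !binQ0; ring.
apply: (@binQ_inj n); rewrite binQS -IH.
have -> : n.+1%:R * (\sum_(i < n.+2) binQ al i * binQ be (n.+1 - i)) =
  \sum_(i < n.+2) (i%:R * binQ al i) * binQ be (n.+1 - i) +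
  \sum_(i < n.+2) binQ al i * ((n.+1 - i)%:R * binQ be (n.+1 - i)).
  rewrite mulr_sumr -big_split; apply: eq_bigr => i _ /=.
  by rewrite natrB; [ring|rewrite -ltnS].
rewrite big_ord_recl mul0r mul0r add0r.
rewrite [X in _ + X]big_ord_recr /= subnn mul0r mulr0 addr0.
rewrite -big_split mulr_sumr; apply: eq_bigr => i _ /=.
rewrite /bump /= add1n binQS subSS.
have hi : (i <= n)%N by rewrite -ltnS.
rewrite subSn // binQS natrB //.
ring.
Qed.

Lemma binQ_nat m i : binQ m%:R i = 'C(m, i)%:R.
Proof.
elim: m i => [|m IH] [|i]; rewrite ?binQ0 ?bin0 //.
  by rewrite bin0n /binQ big_ord_recl subrr !mul0r.
by rewrite -natr1 binQ_pascal !IH binS natrD.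
Qed.

(** The identity [C(n+i, i) C(al, n+i) = C(al, i) C(al-i, n)]. *)
Lemma binQ_trinomial al i n :
  'C(n + i, i)%:R * binQ al (n + i) = binQ al i * binQ (al - i%:R) n.
Proof.
elim: n => [|n IH]; first by rewrite binQ0 mulr1 add0n binn mul1r.
apply: (@binQ_inj n).
rewrite [RHS]mulrCA binQS [RHS]mulrCA -IH addSn.
have h1 := binQS al (n + i).
have h2 := mul_bin_down (n + i).+1 i.
rewrite -addSn addnK addSn /= in h2.
rewrite mulrA -natrM -h2 natrM mulrAC h1 natrD; ring.
Qed.

(** ** integrality *)
Section Bin.
Variable F : fieldType.
Hypothesis two_neq0 : 2%:R != 0 :> F.

(** Rationals with a denominator that is invertible in [F]; [ratr] is additive and
    multiplicative on them ([ratr_pintD], [ratr_pintM]). *)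
Definition pint (r : rat) := exists (a : int) (b : nat),
  b%:R != 0 :> F /\ r * b%:R = a%:~R.

Lemma pint_ratr r (a : int) (b : nat) :
  b%:R != 0 :> F -> r * b%:R = a%:~R -> ratr r = a%:~R / b%:R :> F.
Proof.
move=> b0 E.
have E2 : numq r * b%:Z = a * denq r.
  apply: (@intr_inj rat); rewrite !rmorphM /= -E -{2}(divq_num_den r).
  have dn : (denq r)%:~R != 0 :> rat by rewrite intr_eq0 denq_neq0.
  by rewrite -pmulrn; field.
have dF : (denq r)%:~R != 0 :> F.
  have : (denq r %| numq r * b%:Z)%Z by rewrite E2 dvdz_mull.
  rewrite Gauss_dvdzr; last by rewrite coprimez_sym coprimezE coprime_num_den.
  case/dvdzP => t bt; apply: contra_neq b0 => d0.
  by rewrite pmulrn bt rmorphM /= d0 mulr0.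
have := congr1 (fun z : int => z%:~R : F) E2.
rewrite !rmorphM /= -pmulrn => E3.
by rewrite /ratr; apply/eqP; rewrite eqr_div // E3.
Qed.

Lemma pint_int (k : int) : pint k%:~R.
Proof. by exists k, 1%N; rewrite oner_neq0 mulr1. Qed.

Lemma pintD r s : pint r -> pint s -> pint (r + s).
Proof.
move=> [a [b [b0 E]]] [a' [b' [b0' E']]].
exists (a * b'%:Z + a' * b%:Z), (b * b')%N.
rewrite !natrM mulf_neq0 //; split=> //.
by rewrite rmorphD !rmorphM /= -E -E' -!pmulrn; ring.
Qed.

Lemma pintM r s : pint r -> pint s -> pint (r * s).
Proof.
move=> [a [b [b0 E]]] [a' [b' [b0' E']]].
exists (a * a'), (b * b')%N.
rewrite !natrM mulf_neq0 //; split=> //.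
by rewrite rmorphM /= -E -E'; ring.
Qed.

Lemma pintN r : pint r -> pint (- r).
Proof. by move=> hr; rewrite -mulN1r; apply: pintM => //; exact: (pint_int (-1)). Qed.

Lemma ratr_pintD r s : pint r -> pint s -> ratr (r + s) = ratr r + ratr s :> F.
Proof.
move=> [a [b [b0 E]]] [a' [b' [b0' E']]].
rewrite (pint_ratr b0 E) (pint_ratr b0' E').
rewrite (@pint_ratr _ (a * b'%:Z + a' * b%:Z) (b * b')%N) ?natrM ?mulf_neq0 //.
  by rewrite rmorphD !rmorphM /= -!pmulrn; field; rewrite ?b0 ?b0'.
by rewrite rmorphD !rmorphM /= -E -E' -!pmulrn; ring.
Qed.

Lemma ratr_pintM r s : pint r -> pint s -> ratr (r * s) = ratr r * ratr s :> F.
Proof.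
move=> [a [b [b0 E]]] [a' [b' [b0' E']]].
rewrite (pint_ratr b0 E) (pint_ratr b0' E').
rewrite (@pint_ratr _ (a * a') (b * b')%N) ?natrM ?mulf_neq0 //.
  by rewrite rmorphM /=; field; rewrite ?b0 ?b0'.
by rewrite rmorphM /= -E -E'; ring.
Qed.

Lemma pint_sum n (f : nat -> rat) : (forall i, pint (f i)) -> pint (\sum_(i < n) f i).
Proof.
move=> hf; elim: n => [|n IH]; first by rewrite big_ord0; exact: (pint_int 0).
by rewrite big_ord_recr; exact: pintD.
Qed.

Lemma ratr_pint_sum n (f : nat -> rat) : (forall i, pint (f i)) ->
  ratr (\sum_(i < n) f i) = \sum_(i < n) ratr (f i) :> F.
Proof.
move=> hf; elim: n => [|n IH]; first by rewrite !big_ord0 (ratr_int _ 0).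
by rewrite !big_ord_recr /= ratr_pintD ?IH //; exact: pint_sum.
Qed.

(** Elements of [1/2 Z]. *)
Definition half_int (al : rat) := exists k : int, al = k%:~R / 2.

Lemma half_intD al be : half_int al -> half_int be -> half_int (al + be).
Proof. by move=> [k ->] [l ->]; exists (k + l); rewrite rmorphD mulrDl. Qed.

Lemma half_int_int (k : int) : half_int k%:~R.
Proof. by exists (k * 2); rewrite rmorphM /=; field. Qed.

Lemma half_int_nat (n : nat) : half_int n%:R.
Proof. exact: (half_int_int n). Qed.

Lemma half_intN al : half_int al -> half_int (- al).
Proof. by move=> [k ->]; exists (- k); rewrite rmorphN mulNr. Qed.

Lemma half_intB al be : half_int al -> half_int be -> half_int (al - be).
Proof. by move=> ha hb; apply: half_intD => //; exact: half_intN. Qed.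

(** [C(-1/2, i) = (-1)^i C(2i, i) / 4^i]. *)
Lemma binQ_mhalf i : binQ (- 2^-1) i * (4 ^ i)%:R = (-1) ^+ i * 'C(i + i, i)%:R.
Proof.
elim: i => [|i IH]; first by rewrite binQ0 mul1r.
apply: (@binQ_inj i); rewrite mulrA binQS expnS natrM.
rewrite [LHS](_ : _ = (- 2^-1 - i%:R) * 4%:R * (binQ (- 2^-1) i * (4 ^ i)%:R)); last by ring.
rewrite IH.
have h1 := mul_bin_down (i + i).+1 i.
have h2 := mul_bin_diag (i + i).+2 i.
rewrite -addSn addnK addSn /= in h1.
have h3 : (i.+1 * 'C(i.+1 + i.+1, i.+1) = (2 * (2 * i + 1)) * 'C(i + i, i))%N.
  rewrite addSn addnS; apply/eqP.
  rewrite -(eqn_pmul2l (ltn0Sn i)); apply/eqP.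
  move: h1 h2; rewrite /=; set A := 'C(_, _); set B := 'C(_, _); set C := 'C(_, _).
  nia.
rewrite [RHS]mulrCA -natrM h3 exprS !natrM natrD natrM; by field.
Qed.

(** Binomial coefficients of half-integers only have powers of [2] in their
    denominators: Pascal's rule reduces to [0] and [-1/2]. *)
Lemma pint_binQ al i : half_int al -> pint (binQ al i).
Proof.
have up be j : (forall i, pint (binQ be i)) -> pint (binQ (be + 1) j).
  move=> h; case: j => [|j]; first by rewrite binQ0; exact: (pint_int 1).
  by rewrite binQ_pascal; exact: pintD.
have down be j : (forall i, pint (binQ be i)) -> pint (binQ (be - 1) j).
  move=> h; elim: j => [|j IH]; first by rewrite binQ0; exact: (pint_int 1).
  have := binQ_pascal (be - 1) j; rewrite subrK => E.
  by rewrite -[binQ _ _](addrK (binQ (be - 1) j)) -E; exact/pintD/pintN.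
have shift be (k : int) : (forall i, pint (binQ be i)) ->
    forall i, pint (binQ (be + k%:~R) i).
  move=> h; elim/int_rec: k => [|n IH|n IH] j; first by rewrite addr0.
    by rewrite intS rmorphD addrCA addrC; exact: up.
  by rewrite intS opprD rmorphD rmorphN addrCA addrC; exact: down.
have h0 j : pint (binQ 0 j).
  by rewrite (binQ_nat 0) ; exact: (pint_int 'C(0, j)).
have h1 j : pint (binQ (- 2^-1) j).
  exists ((-1) ^+ j * 'C(j + j, j)%:Z), (4 ^ j)%N.
  rewrite binQ_mhalf rmorphM /= -pmulrn rmorphXn rmorphN; split=> //.
  by rewrite natrX expf_neq0 // (natrM _ 2 2) mulf_neq0.
case=> k ->.
have [b kb] : exists b : bool, exists m : int, k = m * 2 - b%:Z.
  exists (intdiv.modz k 2 == 1), ((intdiv.divz k 2) + (intdiv.modz k 2 == 1)%:Z); lia.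
case: kb => m ->.
case: b.
  have -> : (m * 2 - true%:Z)%:~R / 2 = - 2^-1 + m%:~R :> rat.
    by rewrite rmorphB rmorphM /=; field.
  exact: shift.
have -> : (m * 2 - false%:Z)%:~R / 2 = 0 + m%:~R :> rat.
  by rewrite rmorphB rmorphM /=; field.
exact: shift.
Qed.

Local Notation binF := (binomF F).

Lemma binFE al i : binF al i = ratr (binQ al i). Proof. by []. Qed.

Lemma binF_vandermonde al be n : half_int al -> half_int be ->
  \sum_(i < n.+1) binF al i * binF be (n - i) = binF (al + be) n.
Proof.
move=> ha hb; rewrite !binFE -binQ_vandermonde.
rewrite (@ratr_pint_sum _ (fun i => binQ al i * binQ be (n - i))).
  by apply: eq_bigr => i _; rewrite !binFE ratr_pintM //; exact: pint_binQ.
by move=> i; apply: pintM; exact: pint_binQ.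
Qed.

Lemma binF_nat m i : binF m%:R i = 'C(m, i)%:R.
Proof. by rewrite !binFE binQ_nat ratr_nat. Qed.

Lemma binF0 al : binF al 0 = 1.
Proof. by rewrite !binFE binQ0 (ratr_nat _ 1). Qed.

Lemma binF1 al : binF al 1 = ratr al.
Proof. by rewrite /binomF big_ord1 subr0 divr1. Qed.

Lemma binF_trinomial al i n : half_int al ->
  'C(n + i, i)%:R * binF al (n + i) = binF al i * binF (al - i%:R) n.
Proof.
move=> ha; rewrite !binFE -(ratr_nat F).
have hb : half_int (al - i%:R) by apply: half_intB => //; exact: half_int_nat.
have hC : pint 'C(n + i, i)%:R by exact: (pint_int 'C(n+i, i)).
rewrite -!ratr_pintM ?binQ_trinomial //; exact: pint_binQ.
Qed.

End Bin.

(** * Laurent series *)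

Section Gsum.

(** Sum of a finitely supported family indexed by the integers ([0] if the support
    is infinite). *)
Definition zsum (V : zmodType) (h : int -> V) : V :=
  (\sum_(n \in [set: int]) h n)%classic.

(** The support of [h] lies in [A <= n < A + M]. *)
Definition supp_in (V : zmodType) (A : int) (M : nat) (h : int -> V) :=
  forall n, (n < A) || (A + M%:Z <= n) -> h n = 0.

Variable V : zmodType.
Implicit Types (h : int -> V).

Lemma zsumE A M h : supp_in A M h -> zsum h = \sum_(i < M) h (A + i%:Z).
Proof.
move=> w; rewrite /zsum (fsbigE [seq A + i%:Z | i <- iota 0 M]) //=.
- rewrite big_map -{1}(subn0 M) -/(index_iota 0 M) big_mkord.
  by apply: eq_bigl => i; rewrite in_setT.
- by rewrite map_inj_uniq ?iota_uniq // => i j; lia.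
- move=> n _ /mapP nin; apply: w; apply: contrapT => /negP nn; apply: nin.
  exists (absz (n - A)%R); first by rewrite mem_iota; lia.
  lia.
Qed.

Lemma eq_zsum h1 h2 : h1 =1 h2 -> zsum h1 = zsum h2.
Proof. by move=> /funext ->. Qed.

Lemma zsum_bij h (s t : int -> int) : cancel s t -> cancel t s ->
  zsum (fun n => h (s n)) = zsum h.
Proof.
move=> st ts; rewrite /zsum; apply/esym.
by apply: reindex_fsbigT; exists t.
Qed.

Lemma zsum_shift h m : zsum (fun n => h (n + m)) = zsum h.
Proof.
by apply: (@zsum_bij h (fun n => n + m) (fun n => n - m)) => n;
  rewrite ?addrK ?subrK.
Qed.

Lemma zsum_refl h m : zsum (fun n => h (m - n)) = zsum h.
Proof. by apply: (@zsum_bij h (fun n => m - n) (fun n => m - n)) => n; lia. Qed.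

Lemma zsum_single h m : (forall n, n != m -> h n = 0) -> zsum h = h m.
Proof.
move=> h0; rewrite (@zsumE m 1) ?big_ord1 ?addr0 // => n hn; apply: h0; lia.
Qed.

Lemma zsum0 h : (forall n, h n = 0) -> zsum h = 0.
Proof. by move=> h0; rewrite (zsum_single (m := 0)). Qed.

Lemma zsumD A M h1 h2 : supp_in A M h1 -> supp_in A M h2 ->
  zsum (fun n => h1 n + h2 n) = zsum h1 + zsum h2.
Proof.
move=> w1 w2; rewrite (zsumE w1) (zsumE w2) (@zsumE A M) ?big_split //.
by move=> n hn; rewrite w1 // w2 // addr0.
Qed.

Lemma zsum_exch (h : int -> int -> V) A M B N :
  (forall i j, (i < A) || (A + M%:Z <= i) || (j < B) || (B + N%:Z <= j) -> h i j = 0) ->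
  zsum (fun i => zsum (h i)) = zsum (fun j => zsum (h^~ j)).
Proof.
move=> w.
rewrite (@zsumE A M); last first.
  by move=> i hi; apply: zsum0 => j; apply: w; rewrite hi.
rewrite (@zsumE B N); last first.
  by move=> j hj; apply: zsum0 => i; apply: w; rewrite -orbA hj orbT.
transitivity (\sum_(i < M) \sum_(j < N) h (A + i%:Z) (B + j%:Z)).
  apply: eq_bigr => i _; apply: zsumE => j hj; apply: w.
  by rewrite -orbA hj orbT.
rewrite exchange_big; apply: eq_bigr => j _ /=; apply/esym/zsumE => i hi.
by apply: w; rewrite hi.
Qed.

End Gsum.

Lemma zsum_mull (R : pzRingType) (a : R) A M (h : int -> R) : supp_in A M h ->
  a * zsum h = zsum (fun n => a * h n).
Proof.
move=> w; rewrite (zsumE w) mulr_sumr (@zsumE _ A M) // => n hn.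
by rewrite w // mulr0.
Qed.

Section Laurent.
Variable F : fieldType.

(** Families of coefficients that vanish in low degree. *)
Definition lpred : {pred (int -> F^o)} :=
  fun f => `[< exists A : int, forall n, n < A -> f n = 0 >].

Lemma lpred_submod : submod_closed lpred.
Proof.
split=> [|a u v]; rewrite !unfold_in; first by apply/asboolP; exists 0.
move=> /asboolP[A hA] /asboolP[B hB]; apply/asboolP; exists (Num.min A B) => n.
by rewrite lt_min => /andP[nA nB]; rewrite !fctE /= hA // hB // scaler0 addr0.
Qed.
HB.instance Definition _ := GRing.isSubmodClosed.Build F (int -> F^o) lpred
  lpred_submod.

(** The field [F((z))] of Laurent series, used only as a commutative [F]-algebra. *)
Record laurent := Laurent { lcoef :> int -> F^o; _ : lcoef \in lpred }.
HB.instance Definition _ := [isSub for lcoef].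
HB.instance Definition _ := [Choice of laurent by <:].
HB.instance Definition _ := [SubChoice_isSubLmodule of laurent by <:].

Implicit Types (f g h : laurent).

Lemma laurentP f g : (forall n, f n = g n) -> f = g.
Proof. by move=> /funext fg; apply: val_inj. Qed.

Lemma lbound f : exists A : int, forall n, n < A -> f n = 0.
Proof. by case: f => f /= hf; apply/asboolP. Qed.

Lemma lcoefD f g n : (f + g) n = f n + g n. Proof. by []. Qed.
Lemma lcoefN f n : (- f) n = - f n. Proof. by []. Qed.
Lemma lcoefB f g n : (f - g) n = f n - g n. Proof. by []. Qed.
Lemma lcoefZ a f n : (a *: f) n = a * f n. Proof. by []. Qed.
Lemma lcoef0 n : (0 : laurent) n = 0. Proof. by []. Qed.

(** [Fil A f]: the series [f] lies in [z^A F[[z]]]. *)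
Definition Fil (A : int) f := forall n, n < A -> f n = 0.
(** [Up A f]: the series [f] lies in [z^A F[z^-1]]. *)
Definition Up (A : int) f := forall n, A < n -> f n = 0.

(** A Laurent series from a family of coefficients that vanish below [A]. *)
Definition mk_laurent (u : int -> F) A (hu : forall n, n < A -> u n = 0) : laurent :=
  @Laurent u (introT (asboolP _) (ex_intro _ A hu)).

Lemma mul_supp_in A B f g n : Fil A f -> Fil B g ->
  supp_in A (absz (n - B - A)%R).+1 (fun i => f i * g (n - i)).
Proof.
move=> fA gB i hi.
have [iA|iA] := ltP i A; first by rewrite fA // mul0r.
by rewrite [g _]gB ?mulr0 //; lia.
Qed.

Definition lmul_fun f g (n : int) : F := zsum (fun i => f i * g (n - i)).

Lemma lmul_bound A B f g : Fil A f -> Fil B g ->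
  forall n, n < A + B -> lmul_fun f g n = 0.
Proof.
move=> fA gB n nAB; apply: zsum0 => i.
have [iA|iA] := ltP i A; first by rewrite fA // mul0r.
by rewrite [g _]gB ?mulr0 //; lia.
Qed.

Lemma lmul_subproof f g : exists A, forall n, n < A -> lmul_fun f g n = 0.
Proof.
have [A fA] := lbound f; have [B gB] := lbound g.
by exists (A + B); exact: lmul_bound.
Qed.

Definition lmul f g : laurent :=
  @Laurent (lmul_fun f g) (introT (asboolP _) (lmul_subproof f g)).

Definition lzp_fun (m : int) (n : int) : F := (n == m)%:R.
Lemma lzp_bound m n : n < m -> lzp_fun m n = 0.
Proof. by rewrite /lzp_fun => /lt_eqF ->. Qed.
(** The monomial [z^m]. *)
Definition zp m : laurent := mk_laurent (@lzp_bound m).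

Lemma lmulE f g n : lmul f g n = zsum (fun i => f i * g (n - i)).
Proof. by []. Qed.

Lemma lmulC : commutative lmul.
Proof.
move=> f g; apply: laurentP => n; rewrite !lmulE -(zsum_refl _ n).
by apply: eq_zsum => i; rewrite mulrC subKr.
Qed.

Lemma lmulA : associative lmul.
Proof.
move=> f g h; apply: laurentP => n; rewrite !lmulE.
have [A fA] := lbound f; have [B gB] := lbound g; have [C hC] := lbound h.
transitivity (zsum (fun i => zsum (fun k => f i * (g (k - i) * h (n - k))))).
  apply: eq_zsum => i.
  rewrite lmulE (zsum_mull (f i) (mul_supp_in gB hC)).
  rewrite -(zsum_shift _ (- i)); apply: eq_zsum => k.
  by rewrite opprB addrA subrK.
rewrite (@zsum_exch _ _ A (absz (n - C - B - A)%R).+1 (A + B) (absz (n - C - A - B)%R).+1).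
  apply: eq_zsum => k; rewrite lmulE mulrC.
  rewrite (zsum_mull (h (n - k)) (mul_supp_in fA gB)).
  by apply: eq_zsum => i; rewrite mulrA mulrC.
move=> i j hij.
have [iA|iA] := ltP i A; first by rewrite fA // mul0r.
have [jB|jB] := ltP (j - i) B; first by rewrite (gB (j - i)) // mul0r mulr0.
by rewrite (hC (n - j)) ?mulr0 //; lia.
Qed.

Lemma zp_mulE m f n : lmul (zp m) f n = f (n - m).
Proof.
rewrite lmulE (zsum_single (m := m)) /= /lzp_fun ?eqxx ?mul1r // => i /negPf ->.
by rewrite mul0r.
Qed.

Lemma lmul1 : left_id (zp 0) lmul.
Proof. by move=> f; apply: laurentP => n; rewrite zp_mulE subr0. Qed.

Lemma lmulDl : left_distributive lmul +%R.
Proof.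
move=> f g h; apply: laurentP => n; rewrite lcoefD !lmulE.
have [A fA] := lbound f; have [B gB] := lbound g; have [C hC] := lbound h.
have fA' : Fil (Num.min A B) f by move=> i; rewrite lt_min => /andP[/fA].
have gA' : Fil (Num.min A B) g by move=> i; rewrite lt_min => /andP[_ /gB].
rewrite -(zsumD (mul_supp_in fA' hC) (mul_supp_in gA' hC)).
by apply: eq_zsum => i; rewrite lcoefD mulrDl.
Qed.

Lemma lone_neq0 : zp 0 != 0.
Proof.
apply/eqP => /(congr1 (fun f : laurent => f 0)) /=; rewrite /lzp_fun eqxx.
by apply/eqP; exact: oner_neq0.
Qed.

HB.instance Definition _ := GRing.Zmodule_isComNzRing.Build laurent
  lmulA lmulC lmul1 lmulDl lone_neq0.

Fact lscalerAl (a : F) f g : a *: (f * g) = (a *: f) * g.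
Proof.
apply: laurentP => n; rewrite lcoefZ !lmulE.
have [A fA] := lbound f; have [B gB] := lbound g.
rewrite (zsum_mull a (mul_supp_in fA gB)).
by apply: eq_zsum => i; rewrite lcoefZ mulrA.
Qed.
HB.instance Definition _ := GRing.Lmodule_isLalgebra.Build F laurent lscalerAl.
HB.instance Definition _ := GRing.Lalgebra_isComAlgebra.Build F laurent.

Lemma mulE f g n : (f * g) n = zsum (fun i => f i * g (n - i)).
Proof. by []. Qed.

Lemma zpE m n : zp m n = (n == m)%:R. Proof. by []. Qed.
Lemma zp_mul m f n : (zp m * f) n = f (n - m). Proof. exact: zp_mulE. Qed.
Lemma zp0 : zp 0 = 1. Proof. by []. Qed.

Lemma zpD m n : zp (m + n) = zp m * zp n.
Proof. by apply: laurentP => k; rewrite zp_mul !zpE; congr (_%:R); lia. Qed.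

Lemma Fil_zp m : Fil m (zp m). Proof. exact: lzp_bound. Qed.
Lemma Up_zp m : Up m (zp m). Proof. by move=> n; rewrite zpE => /gt_eqF ->. Qed.

Lemma Fil_le A B f : B <= A -> Fil A f -> Fil B f.
Proof. by move=> BA fA n nB; apply: fA; lia. Qed.
Lemma Up_le A B f : A <= B -> Up A f -> Up B f.
Proof. by move=> BA fA n nB; apply: fA; lia. Qed.

Lemma FilM A B f g : Fil A f -> Fil B g -> Fil (A + B) (f * g).
Proof. exact: lmul_bound. Qed.
Lemma UpM A B f g : Up A f -> Up B g -> Up (A + B) (f * g).
Proof.
move=> fA gB n nAB; apply: zsum0 => i.
have [iA|iA] := ltP A i; first by rewrite fA // mul0r.
by rewrite [g _]gB ?mulr0 //; lia.
Qed.
(** The top coefficient is multiplicative. *)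
Lemma Up_lead A B f g : Up A f -> Up B g -> (f * g) (A + B) = f A * g B.
Proof.
move=> fA gB; rewrite mulE (zsum_single (m := A)); first by rewrite addrC addKr.
move=> i iA; have [iA'|iA'] := ltP A i; first by rewrite fA // mul0r.
by rewrite [g _]gB ?mulr0 //; lia.
Qed.
Lemma FilD A f g : Fil A f -> Fil A g -> Fil A (f + g).
Proof. by move=> fA gA n nA; rewrite lcoefD fA // gA // addr0. Qed.
Lemma FilN A f : Fil A f -> Fil A (- f).
Proof. by move=> fA n nA; rewrite lcoefN fA // oppr0. Qed.
Lemma FilB A f g : Fil A f -> Fil A g -> Fil A (f - g).
Proof. by move=> fA gA; apply: FilD => //; exact: FilN. Qed.
Lemma FilZ A a f : Fil A f -> Fil A (a *: f).
Proof. by move=> fA n nA; rewrite lcoefZ fA // mulr0. Qed.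
Lemma UpD A f g : Up A f -> Up A g -> Up A (f + g).
Proof. by move=> fA gA n nA; rewrite lcoefD fA // gA // addr0. Qed.
Lemma UpN A f : Up A f -> Up A (- f).
Proof. by move=> fA n nA; rewrite lcoefN fA // oppr0. Qed.
Lemma UpB A f g : Up A f -> Up A g -> Up A (f - g).
Proof. by move=> fA gA; apply: UpD => //; exact: UpN. Qed.

(** Cutting off the terms of degree below [A + M]. *)
Lemma Fil_split A f (M : nat) : Fil A f ->
  Fil (A + M%:Z) (f - \sum_(i < M) f (A + i%:Z) *: zp (A + i%:Z)).
Proof.
move=> fA; elim: M => [|M IH]; first by rewrite big_ord0 !subr0.
rewrite big_ord_recr /= opprD addrA => n nM.
have [->|nM'] := eqVneq n (A + M%:Z); last first.
  by rewrite lcoefB IH ?lcoefZ ?zpE ?(negPf nM') ?mulr0 ?subr0 //; lia.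
rewrite !lcoefB lcoefZ zpE eqxx mulr1.
suff -> : (\sum_(i < M) f (A + i%:Z) *: zp (A + i%:Z) : laurent) (A + M%:Z) = 0.
  by rewrite subr0 subrr.
elim: M {IH n nM} => [|M _]; first by rewrite big_ord0.
have aux N (K : int) : A + N%:Z <= K ->
    (\sum_(i < N) f (A + i%:Z) *: zp (A + i%:Z) : laurent) K = 0.
  elim: N => [|N IH] hK; first by rewrite big_ord0.
  rewrite big_ord_recr lcoefD IH; last by lia.
  rewrite lcoefZ zpE add0r (_ : (K == _) = false) ?mulr0 //=; lia.
exact: aux.
Qed.

(** Density of the powers of [z]: a linear map that kills them and kills a
    neighbourhood of [0] is zero. *)
Lemma laurent_eq0 (V : lmodType F) (L : {linear laurent -> V}) A N f :
  (forall m, A <= m -> L (zp m) = 0) -> (forall g, Fil N g -> L g = 0) ->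
  Fil A f -> L f = 0.
Proof.
move=> Lz LN fA; have := Fil_split (M := absz (N - A)%R) fA.
move=> /(Fil_le (B := N)) hf.
rewrite -[f](subrK (\sum_(i < absz (N - A)) f (A + i%:Z) *: zp (A + i%:Z))).
rewrite linearD /= LN ?add0r; last by apply: hf; lia.
by rewrite linear_sum big1 //= => i _; rewrite linearZ /= Lz ?scaler0 //; lia.
Qed.

Lemma Up_sum N f : Up N f ->
  exists A M, A + M%:Z <= N + 1 /\ f = \sum_(i < M) f (A + i%:Z) *: zp (A + i%:Z).
Proof.
move=> fN; have [A fA] := lbound f.
have fA' : Fil (Num.min A N) f by move=> i; rewrite lt_min => /andP[/fA].
exists (Num.min A N), (absz (N - Num.min A N)%R).+1; split; first by lia.
apply/eqP; rewrite -subr_eq0; apply/eqP/laurentP => n; rewrite lcoef0.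
have h := Fil_split (M := (absz (N - Num.min A N)%R).+1) fA'.
have [hn|hn] := ltP n (Num.min A N + ((absz (N - Num.min A N)%R).+1)%:Z).
  exact: h.
rewrite lcoefB fN ?sub0r; last by lia.
move: hn; elim: (_.+1) => [|K IH] hK; first by rewrite big_ord0 oppr0.
rewrite big_ord_recr lcoefD opprD IH; last by lia.
rewrite lcoefZ zpE sub0r (_ : (n == _) = false) ?mulr0 ?oppr0 //=; lia.
Qed.

Lemma Up_ind (V : lmodType F) (L : {linear laurent -> V}) (W : set V) N f :
  subspace W -> (forall m, m <= N -> W (L (zp m))) -> Up N f -> W (L f).
Proof.
move=> [W0 Wl] Wz /Up_sum [A [M [AM ->]]]; rewrite linear_sum /=.
have hz (i : 'I_M) : W (L (zp (A + i%:Z))).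
  by apply: Wz; have := ltn_ord i; lia.
elim/big_rec: _ => // i x _ Wx; rewrite linearZ /=; exact: Wl.
Qed.

Lemma lD_bound A f : Fil A f -> forall n, n < A - 1 -> (n + 1)%:~R * f (n + 1) = 0.
Proof. by move=> fA n nA; rewrite fA ?mulr0 //; lia. Qed.

Lemma lD_subproof f : exists A, forall n, n < A -> (n + 1)%:~R * f (n + 1) = 0.
Proof. by have [A fA] := lbound f; exists (A - 1); exact: lD_bound. Qed.

(** The derivative [d/dz]. *)
Definition lD f : laurent :=
  @Laurent (fun n => (n + 1)%:~R * f (n + 1))
    (introT (asboolP _) (lD_subproof f)).

Lemma lDE f n : lD f n = (n + 1)%:~R * f (n + 1). Proof. by []. Qed.

Fact lD_linear : linear lD.
Proof.
move=> a f g; apply: laurentP => n.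
by rewrite lcoefD lcoefZ !lDE lcoefD lcoefZ mulrDr mulrCA.
Qed.
HB.instance Definition _ := GRing.isLinear.Build F laurent laurent _ lD lD_linear.

Lemma lDM f g : lD (f * g) = lD f * g + f * lD g.
Proof.
apply: laurentP => n; rewrite lcoefD lDE !mulE.
have [A fA] := lbound f; have [B gB] := lbound g.
have w := mul_supp_in fA gB (n := n + 1).
rewrite (zsum_mull (n + 1)%:~R w).
have E i : (n + 1)%:~R * (f i * g (n + 1 - i)) =
  i%:~R * f i * g (n + 1 - i) + f i * ((n + 1 - i)%:~R * g (n + 1 - i)).
  by rewrite rmorphB /=; ring.
rewrite (eq_zsum E) (@zsumD _ A (absz (n + 1 - B - A)%R).+1).
- congr (_ + _); last by apply: eq_zsum => i; rewrite lDE; congr (_ * (_ * g _)); ring.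
  rewrite -(zsum_shift _ 1); apply: eq_zsum => i; rewrite lDE.
  by congr (_ * g _); ring.
- by move=> i hi; have := w i hi; rewrite -mulrA => ->; rewrite mulr0.
- by move=> i hi; have := w i hi; rewrite mulrCA => ->; rewrite mulr0.
Qed.

Lemma lD_Fil A f : Fil A f -> Fil (A - 1) (lD f).
Proof. by move=> fA; exact: lD_bound. Qed.
Lemma lD_Fil0 f : Fil 0 f -> Fil 0 (lD f).
Proof.
move=> f0 n n0; rewrite lDE; have [->|n1] := eqVneq n (-1); first by rewrite mul0r.
by rewrite f0 ?mulr0 //; lia.
Qed.
Lemma lD_Up A f : Up A f -> Up (A - 1) (lD f).
Proof. by move=> fA n nA; rewrite lDE fA ?mulr0 //; lia. Qed.
Lemma lD_lead A f : lD f (A - 1) = A%:~R * f A.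
Proof. by rewrite lDE subrK. Qed.
Lemma lD_zp m : lD (zp m) = m%:~R *: zp (m - 1).
Proof.
apply: laurentP => n; rewrite lDE lcoefZ !zpE.
have [->|nm] := eqVneq n (m - 1); first by rewrite subrK eqxx.
by rewrite (_ : (n + 1 == m) = false) ?mulr0 //; lia.
Qed.
Lemma res_lD f : lD f (-1) = 0. Proof. by rewrite lDE mul0r. Qed.

Lemma hasse_subproof i f :
  exists A : int, forall n, n < A -> binomF F (n + i%:Z)%:~R i * f (n + i%:Z) = 0.
Proof.
by have [A fA] := lbound f; exists (A - i%:Z) => n nA; rewrite fA ?mulr0 //; lia.
Qed.

(** The divided derivative [(d/dz)^i / i!]. *)
Definition hasse i f : laurent :=
  @Laurent (fun n => binomF F (n + i%:Z)%:~R i * f (n + i%:Z))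
    (introT (asboolP _) (hasse_subproof i f)).

Lemma hasseE i f n : hasse i f n = binomF F (n + i%:Z)%:~R i * f (n + i%:Z).
Proof. by []. Qed.

Fact hasse_linear i : linear (hasse i).
Proof.
move=> a f g; apply: laurentP => n.
by rewrite lcoefD lcoefZ !hasseE lcoefD lcoefZ mulrDr mulrCA.
Qed.
HB.instance Definition _ i :=
  GRing.isLinear.Build F laurent laurent _ (hasse i) (hasse_linear i).

Lemma hasse_Fil i A f : Fil A f -> Fil (A - i%:Z) (hasse i f).
Proof. by move=> fA n nA; rewrite hasseE fA ?mulr0 //; lia. Qed.

Lemma hasse_zp i m : hasse i (zp m) = binomF F m%:~R i *: zp (m - i%:Z).
Proof.
apply: laurentP => n; rewrite hasseE lcoefZ !zpE.
have [->|nm] := eqVneq n (m - i%:Z); first by rewrite subrK eqxx.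
by rewrite (_ : (n + i%:Z == m) = false) ?mulr0 //; lia.
Qed.

Definition pw_fun (al : rat) (n : int) : F := if n is Posz i then binomF F al i else 0.
Lemma pw_bound al n : n < 0 -> pw_fun al n = 0. Proof. by case: n. Qed.
(** The binomial series [(1+z)^al]. *)
Definition pw al : laurent := mk_laurent (@pw_bound al).

Lemma pwE al (i : nat) : pw al i%:Z = binomF F al i. Proof. by []. Qed.
Lemma pw_Fil al : Fil 0 (pw al). Proof. exact: pw_bound. Qed.

Hypothesis two_neq0 : 2%:R != 0 :> F.

Lemma pwD al be : half_int al -> half_int be -> pw (al + be) = pw al * pw be.
Proof.
move=> ha hb; apply: laurentP => -[n|n]; last first.
  by rewrite pw_Fil // (FilM (pw_Fil al) (pw_Fil be)).
rewrite pwE -binF_vandermonde // mulE (@zsumE _ 0 n.+1).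
  apply: eq_bigr => i _; rewrite add0r pwE; congr (_ * _).
  by rewrite subzn ?pwE // -ltnS.
move=> i hi; have [i0|i0] := ltP i 0; first by rewrite pw_Fil // mul0r.
by rewrite [X in _ * X]pw_Fil ?mulr0 //; lia.
Qed.

Lemma pw0 : pw 0 = 1.
Proof.
apply: laurentP => -[n|n] //; rewrite pwE -zp0 zpE (binF_nat F 0) bin0n.
by case: n.
Qed.

Lemma hasse_pw i al : half_int al -> hasse i (pw al) = binomF F al i *: pw (al - i%:R).
Proof.
move=> ha; apply: laurentP => n; rewrite hasseE lcoefZ.
case: n => [n|n].
  by rewrite -PoszD !pwE -pmulrn binF_nat binF_trinomial.
rewrite [X in _ = _ * X]pw_Fil // mulr0.
have [h|h] := leqP i n.
  by rewrite pw_Fil ?mulr0 //; lia.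
rewrite (_ : Negz n + i%:Z = (i - n.+1)%N%:Z); last by lia.
rewrite -pmulrn binF_nat bin_small ?mul0r //; lia.
Qed.

Lemma lD_hasse f : lD f = hasse 1 f.
Proof. by apply: laurentP => n; rewrite lDE hasseE binF1 ratr_int. Qed.

Lemma lD_pw al : half_int al -> lD (pw al) = ratr al *: pw (al - 1).
Proof. by move=> ha; rewrite lD_hasse hasse_pw // binF1. Qed.

Lemma pw1 : pw 1 = 1 + zp 1.
Proof.
apply: laurentP => -[n|n] //; last by rewrite lcoefD -zp0 !zpE addr0.
by rewrite pwE lcoefD -zp0 !zpE (binF_nat F 1); case: n => [|[|n]]; rewrite ?addr0 ?add0r.
Qed.

Lemma pw_nat n : pw n%:R = (1 + zp 1) ^+ n.
Proof.
elim: n => [|n IH]; first exact: pw0.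
rewrite -natr1 pwD ?pw1 ?IH ?exprSr //; [exact: half_int_nat|exact: (half_int_nat 1)].
Qed.

Lemma pw_nat_Up n : Up n%:Z (pw n%:R).
Proof.
case=> i h; last by lia.
rewrite pwE binF_nat bin_small //; lia.
Qed.

End Laurent.
Arguments lmul : simpl never.
Arguments lD : simpl never.
Arguments hasse : simpl never.
Arguments zp : simpl never.
Arguments pw : simpl never.

(** * Extending a representation along a decomposition g = n + b *)

Section Coinduction.
Variables (F : fieldType) (G M : lmodType F).
Variable br : bool -> bool -> G -> G -> G.

(** The sign [(-1)^(|a||b|)] of the super rule. *)
Definition sg (a b : bool) : F := (-1) ^+ (a && b).

Local Notation T := (bool * G)%type.
Implicit Types (b x y z : T) (u v w r : seq T) (psi : seq T -> M).

(** The bracket on elements tagged by their parity. The parity is a tag because the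
    even and the odd part are both modelled on the same module [G]. *)
Definition brt b x : T := (b.1 (+) x.1, br b.1 x.1 b.2 x.2).
Local Notation sgt b x := (sg b.1 x.1).

Hypothesis br_lin_l : forall a c (y : G), linear (fun x : G => br a c x y).
Hypothesis br_lin_r : forall a c (x : G), linear (br a c x).
Hypothesis jacobi : forall a c d (x y z : G),
  br a (c (+) d) x (br c d y z) - sg a c *: br c (a (+) d) y (br a d x z)
  = br (a (+) c) d (br a c x y) z.
Hypothesis antisym : forall a c (x y : G), br a c x y = - (sg a c *: br c a y x).

Lemma sgC a c : sg a c = sg c a. Proof. by rewrite /sg andbC. Qed.
Lemma sgK a c : sg a c * sg a c = 1. Proof. by rewrite -expr2 sqrr_sign. Qed.
Lemma sgDr a c d : sg a (c (+) d) = sg a c * sg a d.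
Proof. by case: a; rewrite /sg /= ?mulr1 // signr_addb. Qed.
Lemma sgDl a c d : sg (a (+) c) d = sg a d * sg c d.
Proof. by rewrite sgC sgDr sgC (sgC d). Qed.

(** Multilinearity of a functional on words, in each letter of a given parity. *)
Definition mlin psi := forall u a (k : F) (x y : G) v,
  psi (u ++ (a, k *: x + y) :: v) = k *: psi (u ++ (a, x) :: v) + psi (u ++ (a, y) :: v).

(** The super derivation by [b] of a functional on words: the sum over the letters of
    the word of the values obtained by replacing that letter with its bracket
    with [b]. *)
Fixpoint ad b psi r : M :=
  if r is x :: r' then
    psi (brt b x :: r') + sgt b x *: ad b (fun w => psi (x :: w)) r'
  else 0.

Lemma mlin_cons x psi : mlin psi -> mlin (fun w => psi (x :: w)).
Proof. by move=> h u; exact: (h (x :: u)). Qed.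

Lemma ad_ext b psi1 psi2 r : (forall w, size w = size r -> psi1 w = psi2 w) ->
  ad b psi1 r = ad b psi2 r.
Proof.
elim: r psi1 psi2 => //= x r IH psi1 psi2 h; rewrite h //; congr (_ + _ *: _).
by apply: IH => w wr; apply: h; rewrite /= wr.
Qed.

Lemma ad_linf b (L : M -> M) (k : F) psi1 psi2 r : linear L ->
  ad b (fun w => L (psi1 w) + k *: psi2 w) r = L (ad b psi1 r) + k *: ad b psi2 r.
Proof.
move=> hL; elim: r psi1 psi2 => /= [|x r IH] psi1 psi2.
  have -> : L 0 = 0 by have := hL (-1) 0 0; rewrite scaler0 addr0 scaleN1r addNr.
  by rewrite scaler0 addr0.
rewrite IH; have -> : forall A B, L (A + sgt b x *: B) = L A + sgt b x *: L B.
  by move=> A B; rewrite addrC hL addrC.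
lmod_id F M.
Qed.

Lemma ad_lin_b a (k : F) (x y : G) psi r : mlin psi ->
  ad (a, k *: x + y) psi r = k *: ad (a, x) psi r + ad (a, y) psi r.
Proof.
elim: r psi => /= [|z r IH] psi h; first by rewrite scaler0 addr0.
rewrite /brt /= br_lin_l (h [::]) IH; last exact: mlin_cons.
by rewrite /=; lmod_id F M.
Qed.

Lemma ad_mlin b psi : mlin psi -> mlin (ad b psi).
Proof.
move=> h u; elim: u psi h => /= [|z u IH] psi h a k x y v.
  rewrite /brt /= br_lin_r (h [::]) /=.
  rewrite (@ad_ext _ _ (fun w => k *: psi ((a, x) :: w) + 1 *: psi ((a, y) :: w))); last first.
    by move=> w _; rewrite (h [::]) scale1r.
  rewrite (@ad_linf _ ( *:%R k)); first by lmod_id F M.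
  by move=> l p q; rewrite scalerDr !scalerA mulrC.
rewrite (h (brt b z :: u)) IH; first by rewrite /=; lmod_id F M.
exact: mlin_cons.
Qed.

(** The sign for moving [b] past a word. *)
Definition sgs b u : F := \prod_(x <- u) sgt b x.

Lemma ad_cat b psi u v :
  ad b psi (u ++ v) = ad b (fun w => psi (w ++ v)) u
                    + sgs b u *: ad b (fun w => psi (u ++ w)) v.
Proof.
elim: u psi => [|x u IH] psi /=; first by rewrite /sgs big_nil add0r scale1r.
rewrite IH /sgs big_cons; lmod_id F M.
Qed.

Lemma ad_comm b1 b2 psi r : mlin psi ->
  ad b2 (ad b1 psi) r - sgt b1 b2 *: ad b1 (ad b2 psi) r = ad (brt b1 b2) psi r.
Proof.
elim: r psi => /= [|x r IH] psi h; first by rewrite scaler0 subr0.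
have L1 b b' :
   ad b' (fun w => ad b psi (x :: w)) r =
   ad b' (fun w => psi (brt b x :: w)) r
   + sgt b x *: ad b' (ad b (fun w => psi (x :: w))) r.
  by rewrite -(@ad_linf _ id) //.
have E := IH _ (mlin_cons x h).
rewrite !L1 -E /=.
have -> : brt (brt b1 b2) x =
    (b1.1 (+) b2.1 (+) x.1, br b1.1 (b2.1 (+) x.1) b1.2 (br b2.1 x.1 b2.2 x.2)
      - sgt b1 b2 *: br b2.1 (b1.1 (+) x.1) b2.2 (br b1.1 x.1 b1.2 x.2)).
  by rewrite jacobi.
have -> X Y : psi ((b1.1 (+) b2.1 (+) x.1, X - sgt b1 b2 *: Y) :: r) =
   psi ((b1.1 (+) b2.1 (+) x.1, X) :: r)
   - sgt b1 b2 *: psi ((b1.1 (+) b2.1 (+) x.1, Y) :: r).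
  rewrite -scaleNr addrC (h [::]) /=; lmod_id F M.
rewrite /brt /= -addbA (addbCA b2.1) !sgDr !sgDl.
have e1 := sgK b1.1 b2.1; rewrite (sgC b2.1 b1.1).
set s12 := sg b1.1 b2.1 in e1 *; set s1 := sg b1.1 _; set s2 := sg b2.1 _.
lmod_id F M.
ring: e1.
Qed.

(* [pn] and [pb] are the projections to [n] and [b], and [Th] is defined on all of
   [g]: on [n] it is a representation, on [b] it is meant to be a character. *)
Variables (pn pb : bool -> G -> G) (Th : bool -> G -> M -> M) (m0 : M).
Hypothesis pb_lin : forall a, linear (pb a).
Hypothesis pnb : forall a (x : G), pn a x + pb a x = x.
Hypothesis pbb : forall a c (x y : G),
  pb (a (+) c) (br a c (pb a x) (pb c y)) = br a c (pb a x) (pb c y).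
Hypothesis pnn : forall a c (x y : G), pb (a (+) c) (br a c (pn a x) (pn c y)) = 0.
Hypothesis Th_lin_l : forall a m, linear (fun x : G => Th a x m).
Hypothesis Th_lin_r : forall a (x : G), linear (Th a x).
Hypothesis Th_rep : forall a c (x y : G) m,
  Th a x (Th c y m) - sg a c *: Th c y (Th a x m)
  = Th (a (+) c) (br a c (pn a x) (pn c y)) m.
Hypothesis Th_bb : forall a c (x y : G) m,
  Th (a (+) c) (br a c (pb a x) (pb c y)) m = 0.

(** The functional that extends a representation [Th] of [n] to words in [g], with
    [pb] the projection to [b]. The letter [x] acts by [Th x], and its part in [b]
    is moved to the right through the word, where it disappears: it contributes
    the derivation [ad]. As [ad] applies the functional to other words of the same
    length, [n] is a bound on the length that makes the recursion structural. *)
Fixpoint phi_ (n : nat) r : M :=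
  if r is x :: r' then
    if n is n'.+1 then
      Th x.1 x.2 (phi_ n' r') + ad (x.1, pb x.1 x.2) (phi_ n') r'
    else 0
  else m0.

Lemma phi_mlin n : mlin (phi_ n).
Proof.
elim: n => [|n IH] u a k x y v.
  by case: u => [|z u] /=; rewrite scaler0 addr0.
case: u => [|z u] /=.
  by rewrite Th_lin_l pb_lin ad_lin_b //; lmod_id F M.
by rewrite IH Th_lin_r (ad_mlin _ IH); lmod_id F M.
Qed.

Lemma phi_stable n p r : (size r <= n)%N -> (size r <= p)%N -> phi_ n r = phi_ p r.
Proof.
elim: n p r => [|n IH] [|p] [|x r] //= rn rp; rewrite (IH p) //; congr (_ + _).
by apply: ad_ext => w wr; apply: IH; rewrite wr.
Qed.

(** The functional itself; [phi_cons] is its defining recursion. *)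
Definition phi r := phi_ (size r) r.

Lemma phi_cons x r : phi (x :: r) = Th x.1 x.2 (phi r) + ad (x.1, pb x.1 x.2) phi r.
Proof.
rewrite {1}/phi /=; congr (_ + _); apply: ad_ext => w wr.
by rewrite /phi wr.
Qed.

Lemma phiE n r : (size r <= n)%N -> phi r = phi_ n r.
Proof. by move=> rn; apply: phi_stable. Qed.

Lemma phi_lin : mlin phi.
Proof.
move=> u a k x y v; rewrite !(@phiE (size u + (size v).+1)) ?size_cat //.
exact: phi_mlin.
Qed.

Lemma phiD u a (x y : G) v :
  phi (u ++ (a, x + y) :: v) = phi (u ++ (a, x) :: v) + phi (u ++ (a, y) :: v).
Proof. by rewrite -[x]scale1r phi_lin !scale1r. Qed.

Lemma phi0 u a v : phi (u ++ (a, 0) :: v) = 0.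
Proof.
have := phi_lin u a (-1) 0 0 v.
by rewrite scaler0 addr0 scaleN1r addNr.
Qed.

Lemma phiZ u a k (x : G) v : phi (u ++ (a, k *: x) :: v) = k *: phi (u ++ (a, x) :: v).
Proof. by rewrite -[k *: x]addr0 phi_lin phi0 addr0. Qed.

Lemma Th0 a (x : G) : Th a x 0 = 0.
Proof. by have := Th_lin_r a x (-1) 0 0; rewrite scaler0 addr0 scaleN1r addNr. Qed.

Lemma ThD a (x : G) p q : Th a x (p + q) = Th a x p + Th a x q.
Proof. by have := Th_lin_r a x 1 p q; rewrite !scale1r. Qed.

Lemma ThZ a (x : G) k p : Th a x (k *: p) = k *: Th a x p.
Proof. by have := Th_lin_r a x k p 0; rewrite addr0 Th0 addr0. Qed.

(** The relations of [g] hold at the front of a word. Splitting both letters along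
    [g = n + b], the parts in [n] are handled by [Th_rep], the parts in [b] by
    [ad_comm], and the mixed parts by the recursion. *)
Lemma phi_front x y r :
  phi (x :: y :: r) - sgt x y *: phi (y :: x :: r) = phi (brt x y :: r).
Proof.
case: x => a x; case: y => c y; rewrite /brt /=.
set nx := pn a x; set bx := pb a x; set ny := pn c y; set b' := pb c y.
have E1 (a1 a2 : bool) (x1 x2 : G) : phi ((a1, x1) :: (a2, x2) :: r) =
   Th a1 x1 (Th a2 x2 (phi r)) + Th a1 x1 (ad (a2, pb a2 x2) phi r)
   + phi ((a1 (+) a2, br a1 a2 (pb a1 x1) x2) :: r)
   + sg a1 a2 *: Th a2 x2 (ad (a1, pb a1 x1) phi r)
   + sg a1 a2 *: ad (a1, pb a1 x1) (ad (a2, pb a2 x2) phi) r.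
  rewrite phi_cons /= phi_cons /= ThD.
  rewrite (@ad_ext _ (fun w => phi ((a2, x2) :: w))
    (fun w => Th a2 x2 (phi w) + 1 *: ad (a2, pb a2 x2) phi w)); last first.
    by move=> w _; rewrite phi_cons scale1r.
  rewrite (ad_linf _ _ _ _ _ (Th_lin_r a2 x2)) /brt /=.
  by lmod_id F M.
have E2 : ad (c, b') (ad (a, bx) phi) r - sg a c *: ad (a, bx) (ad (c, b') phi) r
   = phi ((a (+) c, br a c bx b') :: r).
  by rewrite phi_cons /= Th_bb add0r pbb (ad_comm (a, bx) (c, b') r phi_lin).
have E3 : phi ((a (+) c, br a c nx ny) :: r) =
   Th a x (Th c y (phi r)) - sg a c *: Th c y (Th a x (phi r)).
  rewrite phi_cons /= pnn Th_rep -[RHS]addr0; congr (_ + _).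
  have := @ad_lin_b (a (+) c) (-1) 0 0 phi r phi_lin.
  by rewrite scaler0 addr0 scaleN1r addNr.
have E4 : br a c x y = br a c nx ny + br a c bx y
     - sg a c *: br c a b' x - br a c bx b'.
  have ex : x = nx + bx by rewrite pnb.
  have ey : y = ny + b' by rewrite pnb.
  have Dl (p q s : G) : br a c (p + q) s = br a c p s + br a c q s.
    by rewrite -[p]scale1r br_lin_l !scale1r.
  have Dr (p q s : G) : br a c s (p + q) = br a c s p + br a c s q.
    by rewrite -[p]scale1r br_lin_r !scale1r.
  have -> : - (sg a c *: br c a b' x) = br a c x b' by exact/esym/antisym.
  have X1 s : br a c x s = br a c nx s + br a c bx s by rewrite -Dl -ex.
  have Y1 s : br a c s y = br a c s ny + br a c s b' by rewrite -Dr -ey.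
  by rewrite !X1 !Y1; lmod_id F G.
rewrite !E1 E4.
have -> X Y Z W : phi ((a (+) c, X + Y - sg a c *: Z - W) :: r) =
   phi ((a (+) c, X) :: r) + phi ((a (+) c, Y) :: r)
   - sg a c *: phi ((a (+) c, Z) :: r) - phi ((a (+) c, W) :: r).
  have D (p q : G) : phi ((a (+) c, p + q) :: r) =
    phi ((a (+) c, p) :: r) + phi ((a (+) c, q) :: r) := phiD [::] _ p q r.
  have Z' k (q : G) : phi ((a (+) c, k *: q) :: r) =
    k *: phi ((a (+) c, q) :: r) := phiZ [::] _ k q r.
  by rewrite !D -scaleNr Z' -[- W]scaleN1r Z' scaleNr scaleN1r.
rewrite E3 -E2 (addbC c a) (sgC c a).
have e1 := sgK a c.
lmod_id F M; ring: e1.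
Qed.

(** The relations of [g] hold inside words whose two outer parts have lengths [n] and
    [p]. *)
Definition phi_swaps n p := forall u x y v, size u = n -> size v = p ->
  phi (u ++ x :: y :: v) - sgt x y *: phi (u ++ y :: x :: v) = phi (u ++ brt x y :: v).

Lemma ad_swap b u x y v : phi_swaps (size u) (size v) ->
  ad b phi (u ++ x :: y :: v) - sgt x y *: ad b phi (u ++ y :: x :: v)
  = ad b phi (u ++ brt x y :: v).
Proof.
move=> h; rewrite !ad_cat /=.
have P1 : ad b (fun w => phi (w ++ brt x y :: v)) u =
   ad b (fun w => phi (w ++ x :: y :: v)) u
   - sgt x y *: ad b (fun w => phi (w ++ y :: x :: v)) u.
  rewrite -scaleNr -(@ad_linf _ id) //; apply: ad_ext => w wu.
  by rewrite -h // scaleNr.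
have P3 : ad b (fun w => phi (u ++ brt x y :: w)) v =
   ad b (fun w => phi (u ++ x :: y :: w)) v
   - sgt x y *: ad b (fun w => phi (u ++ y :: x :: w)) v.
  rewrite -scaleNr -(@ad_linf _ id) //; apply: ad_ext => w wu.
  by rewrite -h // scaleNr.
have P2a := h u (brt b x) y v erefl erefl.
have P2b := h u x (brt b y) v erefl erefl.
have J : phi (u ++ brt b (brt x y) :: v) =
   phi (u ++ brt (brt b x) y :: v) + sgt b x *: phi (u ++ brt x (brt b y) :: v).
  rewrite /brt /= !addbA [x.1 (+) b.1]addbC -phiZ -phiD; congr (phi (_ ++ (_, _) :: _)).
  by rewrite -(jacobi b.1 x.1 y.1 b.2 x.2 y.2) subrK.
rewrite J P1 P3 -P2a -P2b /= !sgDr !sgDl.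
rewrite (sgC x.1 b.1).
have e1 := sgK b.1 x.1; have e2 := sgK b.1 y.1.
set s1 := sg b.1 x.1 in e1 *; set s2 := sg b.1 y.1 in e2 *.
lmod_id F M; ring: e1.
Qed.

(** The functional respects the relations of [g] at every place of a word. *)
Lemma phi_swap u x y v :
  phi (u ++ x :: y :: v) - sgt x y *: phi (u ++ y :: x :: v) = phi (u ++ brt x y :: v).
Proof.
move: {2}(size u) (erefl (size u)) => n; elim: n u x y v => [|n IH] [|z u] x y v //=.
  by move=> _; exact: phi_front.
case=> un; rewrite !phi_cons -(@ad_swap (z.1, pb z.1 z.2) u x y v); last first.
  by move=> u' x' y' v' u'n _; apply: IH; rewrite u'n.
by rewrite -(IH u x y v un) -[- (_ *: phi _)]scaleNr ThD ThZ; lmod_id F M.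
Qed.

(** A letter of [b] at the end of a word acts by the scalar through which [Th] extends
    to it. *)
Lemma phi_last u a (y : G) (c : F) : pb a y = y -> (forall m, Th a y m = c *: m) ->
  phi (rcons u (a, y)) = c *: phi u.
Proof.
rewrite -cats1.
move: {2}(size u) (erefl (size u)) => n; elim: n u a y c => [|n IH] [|z u] a y c //=.
  by move=> _ yb hc; rewrite phi_cons /= addr0 hc.
case=> un yb hc; rewrite !phi_cons ad_cat /=.
rewrite (@ad_ext _ _ (fun w => 0 + c *: phi w)); last first.
  by move=> w wu; rewrite (IH w a y c) ?add0r // wu.
rewrite (@ad_linf _ (fun=> 0) c phi phi); last by move=> k p q; rewrite scaler0 addr0.
rewrite (IH u a y c) // scaler0 addr0 /brt /=.
rewrite (IH u _ _ 0) //.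
- by rewrite ThZ; lmod_id F M.
- by rewrite -yb pbb.
- by move=> m; rewrite -yb Th_bb scale0r.
Qed.

End Coinduction.

(** * The completed Neveu-Schwarz superalgebra *)

Section SuperVir.
Variable F : fieldType.
Local Notation K := (laurent F).
(** The completed Neveu-Schwarz superalgebra. A pair [(f, t)] stands for the even
    element [2 sum_n f_n L_(n-1) + (t/3) c] or for the odd element
    [sum_n f_n G_(n-1/2)], according to a parity tag kept apart; in the odd case
    [t] is irrelevant. The factors [2] and [1/3] make the bracket integral. *)
Definition cns := (K * F^o)%type.
HB.instance Definition _ := GRing.Lmodule.on cns.
Implicit Types (f g h P Q : K) (x y z : cns).

(** The residue, i.e. the coefficient of [z^-1]. *)
Definition res f : F := f (-1).
Arguments res : simpl never.
Lemma resD f g : res (f + g) = res f + res g. Proof. by []. Qed.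
Lemma resB f g : res (f - g) = res f - res g. Proof. by []. Qed.
Lemma resN f : res (- f) = - res f. Proof. by []. Qed.
Lemma res_D f : res (lD f) = 0. Proof. exact: res_lD. Qed.
Lemma res_eq f g h : f - g = lD h -> res f = res g.
Proof. by move=> E; apply/eqP; rewrite -subr_eq0 -resB E res_D. Qed.

(** The bracket, by the parities [a] and [b] of its arguments. The second components
    are the two cocycles. *)
Definition ser_br (a b : bool) (x y : cns) : cns :=
  match a, b with
  | false, false => ((lD x.1 * y.1 - x.1 * lD y.1) *+ 2, res (lD (lD (lD x.1)) * y.1))
  | false, true => (lD x.1 * y.1 - (x.1 * lD y.1) *+ 2, 0)
  | true, false => ((y.1 * lD x.1) *+ 2 - lD y.1 * x.1, 0)
  | true, true => (x.1 * y.1, res (lD (lD x.1) * y.1))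
  end.

Lemma cnsP x y : x.1 = y.1 -> x.2 = y.2 -> x = y.
Proof. by case: x y => ? ? [? ?] /= -> ->. Qed.

Lemma cns1 (k : F) x y : (k *: x + y).1 = k *: x.1 + y.1. Proof. by []. Qed.
Lemma cns2 (k : F) x y : (k *: x + y).2 = k * x.2 + y.2. Proof. by []. Qed.

Fact lD_D f g : lD (f + g) = lD f + lD g. Proof. exact: linearD. Qed.
Fact lD_N f : lD (- f) = - lD f. Proof. exact: linearN. Qed.
Fact lD_Mn f n : lD (f *+ n) = lD f *+ n. Proof. exact: linearMn. Qed.
Fact lD_M f g : lD (f * g) = lD f * g + f * lD g. Proof. exact: lDM. Qed.
Definition lDE_ := (lD_D, lD_N, lD_Mn, lD_M).

Lemma ser_br_antisym a c x y : ser_br a c x y = - (sg F a c *: ser_br c a y x).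
Proof.
case: x y => [f s] [g t]; case: a; case: c; rewrite /sg /= ?expr1 ?expr0 ?scale1r ?scaleN1r ?opprK;
  apply: cnsP => //=; rewrite ?opprK ?oppr0 //; try by ring.
- by apply: (res_eq (h := lD f * g - f * lD g)); rewrite !lDE_; ring.
- rewrite -resN; apply: (res_eq (h := lD (lD f) * g - lD f * lD g + f * lD (lD g))).
  by rewrite !lDE_; ring.
Qed.

Fact lD_Z k f : lD (k *: f) = k *: lD f. Proof. exact: linearZ. Qed.
Lemma resZ k f : res (k *: f) = k * res f. Proof. by []. Qed.

Lemma ser_br_lin_l a b y : linear (fun x : cns => ser_br a b x y).
Proof.
move=> k x x'.
have [kA E] : exists kA : K, forall h, k *: h = kA * h by exists k%:A => h; rewrite mulr_algl.
case: x => [f s]; case: x' => [g t].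
case: a; case: b; apply: cnsP; rewrite ?cns1 ?cns2 /= ?mulr0 ?addr0 //.
- by rewrite mulrDl -scalerAl.
- by rewrite !(lD_D, lD_Z) mulrDl resD -scalerAl resZ.
- by rewrite !(lD_D, lD_Z) !E; ring.
- by rewrite !(lD_D, lD_Z) !E; ring.
- by rewrite !(lD_D, lD_Z) !E; ring.
- by rewrite !(lD_D, lD_Z) mulrDl resD -scalerAl resZ.
Qed.

Lemma ser_br_lin_r a b x : linear (ser_br a b x).
Proof.
move=> k y y'; rewrite !(ser_br_antisym a b x) ser_br_lin_l.
by lmod_id F cns.
Qed.

(** In the cocycle components the two sides differ by the residue of a derivative. *)
Lemma ser_br_jacobi a c d x y z :
  ser_br a (c (+) d) x (ser_br c d y z) - sg F a c *: ser_br c (a (+) d) y (ser_br a d x z)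
  = ser_br (a (+) c) d (ser_br a c x y) z.
Proof.
case: x y z => [f r] [g s] [h t]; case: a; case: c; case: d;
 rewrite /sg /= ?expr1 ?expr0 ?scale1r ?scaleN1r ?opprK;
  apply: cnsP; rewrite /= ?oppr0 ?addr0 // ?opprK; try by rewrite !lDE_; ring.
- rewrite -resD; apply: (res_eq (h := - (h * lD (lD f) * g + h * f * lD (lD g)))).
  by rewrite !lDE_; ring.
- rewrite -resB; apply: (res_eq (h := - (g * lD (lD f) * h) *+ 2)).
  by rewrite !lDE_; ring.
- rewrite -resB; apply: (res_eq (h := (f * lD (lD g) * h) *+ 2)).
  by rewrite !lDE_; ring.
- rewrite -resB.
  apply: (res_eq (h := (f * lD (lD (lD g)) * h - lD (lD (lD f)) * g * h) *+ 2)).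
  by rewrite !lDE_; ring.
Qed.

Hypothesis two_neq0 : 2%:R != 0 :> F.

Lemma half_int_3 : half_int (3%:R / 2). Proof. by exists 3. Qed.
Lemma half_int_1 : half_int (1 / 2). Proof. by exists 1. Qed.

(** The degree of [omega] (tag [false]) and of [tau] (tag [true]). *)
Definition gen_deg (a : bool) : rat := if a then 3%:R / 2 else 2%:R.
(** The factor [(1+z)^(deg u)] of the Zhu products, for [u = omega, tau]. *)
Definition gen_wt (a : bool) : K := pw F (gen_deg a).
(** The inverse of [gen_wt]. *)
Definition gen_wtV (a : bool) : K := pw F (- gen_deg a).
(** The series [1 + z]. *)
Definition w1 : K := pw F 1.

Lemma half_gen_deg a : half_int (gen_deg a).
Proof. by case: a; [exact: half_int_3|exact: (half_int_nat 2)]. Qed.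

Lemma FilM0 f g : Fil 0 f -> Fil 0 g -> Fil 0 (f * g).
Proof. exact: FilM. Qed.

Lemma gen_wtK a f : gen_wtV a * (gen_wt a * f) = f.
Proof.
rewrite mulrA -pwD //; [|exact/half_intN/half_gen_deg|exact: half_gen_deg].
by rewrite addNr pw0 // mul1r.
Qed.
Lemma gen_wtVK a f : gen_wt a * (gen_wtV a * f) = f.
Proof. by rewrite mulrCA gen_wtK. Qed.

Lemma gen_wt_Fil a : Fil 0 (gen_wt a). Proof. exact: pw_Fil. Qed.
Lemma gen_wtV_Fil a : Fil 0 (gen_wtV a). Proof. exact: pw_Fil. Qed.

Lemma polar_subproof f : exists A : int, forall n, n < A -> (if n < 0 then f n else 0) = 0.
Proof. by have [A fA] := lbound f; exists A => n nA; rewrite fA // if_same. Qed.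
(** The part of a series with negative exponents. *)
Definition polar f : K :=
  @Laurent F (fun n => if n < 0 then f n else 0)
    (introT (asboolP _) (polar_subproof f)).
Lemma polarE f n : polar f n = if n < 0 then f n else 0. Proof. by []. Qed.
Fact polar_linear : linear polar.
Proof.
move=> k f g; apply: laurentP => n.
by rewrite lcoefD lcoefZ !polarE; case: ifP => // _; rewrite mulr0 addr0.
Qed.
HB.instance Definition _ := GRing.isLinear.Build F K K _ polar polar_linear.

Lemma polar_Up f : Up (-1) (polar f).
Proof. by move=> n n1; rewrite polarE ltNge (_ : 0 <= n) //; lia. Qed.
Lemma polar_id f : Up (-1) f -> polar f = f.
Proof.
move=> fU; apply: laurentP => n; rewrite polarE; case: ltP => // n0.
by rewrite fU //; lia.
Qed.
Lemma polar_Fil0 f : Fil 0 f -> polar f = 0.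
Proof. by move=> fF; apply: laurentP => n; rewrite polarE; case: ltP => // /fF. Qed.

(** The elements of the subalgebra [n], parametrized by [P] in [z^-1 F[z^-1]]. The
    central term is the one for which they are closed under the bracket
    ([ser_br_nn]); it produces the constant [c/24]. *)
Definition neg_elt (a : bool) P : cns :=
  (gen_wt a * P, if a then 0 else - (4%:R^-1) * P (-1)).
(** The parameter of the component in [n] of an element of [g]. *)
Definition polar_part (a : bool) x : K := polar (gen_wtV a * x.1).
(** The projection to [n] along the power series. *)
Definition neg_part (a : bool) x : cns := neg_elt a (polar_part a x).
(** The projection to the power series along [n]; it keeps the central component, so
    [b] also contains the central element. *)
Definition reg_part (a : bool) x : cns := x - neg_part a x.

Fact polar_part_linear a : linear (polar_part a).
Proof. by move=> k x y; rewrite /polar_part mulrDr -scalerAr linearP. Qed.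
Fact neg_elt_linear a : linear (neg_elt a).
Proof.
move=> k P Q; apply: cnsP; rewrite ?cns1 ?cns2 /=; first by rewrite mulrDr -scalerAr.
case: a; first by rewrite mulr0 addr0.
by rewrite mulrDr [k * _]mulrCA.
Qed.
Lemma neg_part_lin a : linear (neg_part a).
Proof. by move=> k x y; rewrite /neg_part polar_part_linear neg_elt_linear. Qed.
Lemma reg_part_lin a : linear (reg_part a).
Proof. by move=> k x y; rewrite /reg_part neg_part_lin; lmod_id F cns. Qed.
Lemma neg_reg_part a x : neg_part a x + reg_part a x = x.
Proof. by rewrite addrC subrK. Qed.

Lemma polar_part_neg_elt a P : Up (-1) P -> polar_part a (neg_elt a P) = P.
Proof. by move=> PU; rewrite /polar_part /= gen_wtK polar_id. Qed.
Lemma reg_part_neg_elt a P : Up (-1) P -> reg_part a (neg_elt a P) = 0.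
Proof. by move=> PU; rewrite /reg_part /neg_part polar_part_neg_elt // subrr. Qed.

Lemma reg_part_Fil a x : Fil 0 (reg_part a x).1.
Proof.
rewrite /reg_part /= -[x.1](gen_wtVK a) -mulrBr.
apply: FilM0; first exact: gen_wt_Fil.
move=> n n0; rewrite lcoefB /polar_part polarE ?gen_wtK n0 subrr //.
Qed.

Lemma reg_part_id a x : Fil 0 x.1 -> reg_part a x = x.
Proof.
move=> xF; rewrite /reg_part /neg_part /polar_part polar_Fil0; last first.
  by apply: FilM0 => //; exact: gen_wtV_Fil.
suff -> : neg_elt a 0 = 0 by rewrite subr0.
by apply: cnsP; rewrite /= ?mulr0 //; case: a; rewrite ?mulr0.
Qed.

Lemma ser_br_Fil a c x y : Fil 0 x.1 -> Fil 0 y.1 ->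
  Fil 0 (ser_br a c x y).1 /\ (ser_br a c x y).2 = 0.
Proof.
have FM f g : Fil 0 f -> Fil 0 g -> Fil 0 (f * g) by exact: FilM0.
have R0 f : Fil 0 f -> res f = 0 by move=> fF; exact: fF.
have FD f : Fil 0 f -> Fil 0 (lD f) by exact: lD_Fil0.
move=> xF yF.
case: a; case: c => /=; split=> //.
- exact: FM.
- by apply: R0; apply: (FM) => //; apply: (FD); apply: FD.
- rewrite mulr2n; apply: FilB; last by apply: (FM) => //; exact: FD.
  by apply: FilD; apply: (FM) => //; exact: FD.
- rewrite mulr2n; apply: FilB; first by apply: (FM) => //; exact: FD.
  by apply: FilD; apply: (FM) => //; exact: FD.
- by rewrite mulr2n; apply: FilD; apply: FilB; apply: (FM) => //; exact: FD.
- by apply: R0; apply: (FM) => //; apply: (FD); apply: (FD); apply: FD.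
Qed.

Lemma reg_part_bb a c x y :
  reg_part (a (+) c) (ser_br a c (reg_part a x) (reg_part c y))
  = ser_br a c (reg_part a x) (reg_part c y).
Proof. by apply: reg_part_id; apply: (ser_br_Fil _ _ _ _).1; exact: reg_part_Fil. Qed.

(** The bracket of [n] in terms of the parameters. *)
Definition neg_br (a c : bool) P Q : K :=
  match a, c with
  | false, false => (w1 ^+ 2 * (lD P * Q - P * lD Q)) *+ 2
  | false, true => w1 ^+ 2 * (lD P * Q - (P * lD Q) *+ 2) - w1 * P * Q
  | true, false => w1 * P * Q - w1 ^+ 2 * (lD Q * P - (Q * lD P) *+ 2)
  | true, true => w1 * P * Q
  end.

Lemma w1E : w1 = 1 + zp F 1. Proof. exact: pw1. Qed.
Lemma lD1 : lD (1 : K) = 0.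
Proof. by rewrite -zp0 lD_zp scale0r. Qed.
Lemma lD_w1 : lD w1 = 1.
Proof. by rewrite w1E lD_D lD1 add0r lD_zp scale1r subrr. Qed.
Lemma w1_Up : Up 1 w1. Proof. exact: (pw_nat_Up two_neq0 (n := 1)). Qed.
Lemma w1_lead : w1 1 = 1.
Proof. by rewrite w1E lcoefD -zp0 !zpE add0r. Qed.

Lemma gen_wt_false : gen_wt false = w1 ^+ 2.
Proof. by rewrite /gen_wt /= pw_nat // w1E. Qed.
Lemma gen_wt_true2 : gen_wt true * gen_wt true = w1 ^+ 3.
Proof.
rewrite /gen_wt /= -pwD; [|by []|exact: half_int_3|exact: half_int_3].
by rewrite -(splitr (3%:R : rat)) pw_nat // w1E.
Qed.
Lemma ratr_half (k : int) : ratr (k%:~R / 2) = k%:~R / 2%:R :> F.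
Proof. by apply: (pint_ratr two_neq0); rewrite divfK. Qed.

Lemma lD_gen_wt_true : lD (gen_wt true) *+ 2 = pw F (1 / 2) *+ 3.
Proof.
rewrite /gen_wt /= lD_pw //; last exact: half_int_3.
rewrite (ratr_half 3) (_ : 3%:R / 2 - 1 = 1 / 2 :> rat); last by field.
rewrite -[LHS]scaler_nat -[RHS]scaler_nat scalerA; congr (_ *: _).
by rewrite mulrC divfK.
Qed.
Lemma w1_sqrt : w1 * pw F (1 / 2) = gen_wt true.
Proof.
rewrite -pwD //; [exact: (half_int_int 1)|exact: half_int_1].
Qed.
Lemma sqrt2 : pw F (1 / 2) * pw F (1 / 2) = w1.
Proof.
by rewrite -pwD //; exact: half_int_1.
Qed.

Lemma lead_mul A B C f g : C = A + B -> Up A f -> Up B g -> (f * g) C = f A * g B.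
Proof. by move=> ->; exact: Up_lead. Qed.

Lemma w1_Up2 : Up 2 (w1 ^+ 2).
Proof. by rewrite expr2; exact: (UpM w1_Up w1_Up). Qed.
Lemma w1_Up3 : Up 3 (w1 ^+ 3).
Proof. by rewrite exprS; exact: (UpM w1_Up w1_Up2). Qed.
Lemma w1_lead2 : (w1 ^+ 2) 2 = 1.
Proof. by rewrite expr2 (lead_mul (C := 2) _ w1_Up w1_Up) // w1_lead mulr1. Qed.
Lemma w1_lead3 : (w1 ^+ 3) 3 = 1.
Proof. by rewrite exprS (lead_mul (C := 3) _ w1_Up w1_Up2) // w1_lead w1_lead2 mulr1. Qed.

(** The elements of [n] with parameter in [z^-2 F[z^-1]] form an ideal of [n]. *)
Lemma neg_br_Up a c m n P Q : Up m P -> Up n Q -> Up (m + n + 1) (neg_br a c P Q).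
Proof.
have W2 m' n' P' Q' : Up m' P' -> Up n' Q' -> Up (m' + n' + 1) (w1 ^+ 2 * (lD P' * Q')).
  move=> PU QU.
  by apply: (Up_le _ (UpM w1_Up2 (UpM (lD_Up PU) QU))); lia.
have W1 m' n' P' Q' : Up m' P' -> Up n' Q' -> Up (m' + n' + 1) (w1 * P' * Q').
  move=> PU QU.
  by apply: (Up_le _ (UpM (UpM w1_Up PU) QU)); lia.
move=> PU QU.
have WQP : Up (m + n + 1) (w1 ^+ 2 * (P * lD Q)).
  by rewrite [P * _]mulrC [m + n]addrC; exact: W2.
case: a; case: c; rewrite /neg_br.
- exact: W1.
- apply: UpB; first exact: W1.
  rewrite mulrBr mulrnAr mulr2n; apply: UpB.
    by rewrite [lD Q * P]mulrC.
  by apply: UpD; rewrite [Q * _]mulrC; exact: W2.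
- apply: UpB; last exact: W1.
  rewrite mulrBr mulrnAr mulr2n; apply: UpB; first exact: W2.
  by apply: UpD.
- by rewrite mulrBr mulr2n; apply: UpD; apply: UpB => //; exact: W2.
Qed.

Section Leading.
Variables P Q : K.
Hypotheses (PU : Up (-1) P) (QU : Up (-1) Q).

Lemma lead_w1 : (w1 * P * Q) (-1) = P (-1) * Q (-1).
Proof.
by rewrite (lead_mul (C := -1) _ (UpM w1_Up PU) QU) // (lead_mul (C := 1 - 1) _ w1_Up PU) //
  w1_lead mul1r.
Qed.
Lemma lead_w2 : (w1 ^+ 2 * (lD P * Q)) (-1) = - (P (-1) * Q (-1)).
Proof.
rewrite (lead_mul (C := -1) _ w1_Up2 (UpM (lD_Up PU) QU)) // w1_lead2 mul1r.
by rewrite (lead_mul (C := -1 - 1 + -1) _ (lD_Up PU) QU) // lD_lead mulN1r mulNr.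
Qed.
Lemma lead_w3 : (w1 ^+ 3 * (lD (lD P) * Q)) (-1) = P (-1) * Q (-1) *+ 2.
Proof.
rewrite (lead_mul (C := -1) _ w1_Up3 (UpM (lD_Up (lD_Up PU)) QU)) // w1_lead3 mul1r.
rewrite (lead_mul (C := -1 - 1 - 1 + -1) _ (lD_Up (lD_Up PU)) QU) // lD_lead lD_lead.
by rewrite -mulrA mulN1r; ring.
Qed.
End Leading.

(** Modulo this ideal, the only nonzero bracket in [n] is that of two odd elements. *)
Lemma neg_br_lead a c P Q : Up (-1) P -> Up (-1) Q ->
  (neg_br a c P Q) (-1) = if a && c then P (-1) * Q (-1) else 0.
Proof.
move=> PU QU; have E1 := lead_w1 PU QU; have E2 := lead_w2 PU QU.
have E3 : (w1 ^+ 2 * (P * lD Q)) (-1) = - (P (-1) * Q (-1)).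
  by rewrite [P * _]mulrC lead_w2 // mulrC.
case: a; case: c; rewrite /neg_br [RHS]/= ?E1 //.
- rewrite lcoefB E1 mulrBr mulrnAr mulr2n [lD Q * P]mulrC [Q * lD P]mulrC.
  by rewrite lcoefB lcoefD E2 E3; ring.
- rewrite lcoefB E1 mulrBr mulrnAr mulr2n.
  by rewrite lcoefB lcoefD E2 E3; ring.
- by rewrite mulr2n lcoefD mulrBr lcoefB E2 E3; ring.
Qed.

(** [n] is a subalgebra. In the odd-odd case the coefficient [-1/4] of the central term
    is forced by the cocycle [Res g'' h]; in the even-even case the cocycle vanishes
    because a derivative has no residue. *)
Lemma ser_br_nn a c P Q : Up (-1) P -> Up (-1) Q ->
  ser_br a c (neg_elt a P) (neg_elt c Q) = neg_elt (a (+) c) (neg_br a c P Q).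
Proof.
move=> PU QU.
have e1 : lD (gen_wt true) * w1 *+ 2 = gen_wt true *+ 3.
  by rewrite -mulrnAl lD_gen_wt_true mulrnAl mulrC w1_sqrt.
have four : 4%:R != 0 :> F by rewrite (natrM _ 2 2) mulf_neq0.
apply: cnsP.
  case: a; case: c; rewrite /= ?gen_wt_false ?lD_M ?lD_w1.
  - by rewrite mulrACA gen_wt_true2; ring.
  - apply/eqP; rewrite -subr_eq0.
    rewrite [X in X == 0](_ : _ = (lD (gen_wt true) * w1 *+ 2 - gen_wt true *+ 3) * (w1 * P * Q)).
      by rewrite e1 subrr mul0r.
    ring.
  - apply/eqP; rewrite -subr_eq0.
    rewrite [X in X == 0](_ : _ = (gen_wt true *+ 3 - lD (gen_wt true) * w1 *+ 2) * (w1 * P * Q)).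
      by rewrite e1 subrr mul0r.
    ring.
  - ring.
rewrite [RHS](_ : _ = if a (+) c then 0 else - (4%:R^-1) * neg_br a c P Q (-1)) //.
rewrite neg_br_lead //; case: a; case: c => //=; rewrite ?mulr0 //.
- set u := gen_wt true; set v : K := pw F (1 / 2).
  have vv : lD v * v *+ 2 = 1.
    have := congr1 (@lD F) sqrt2; rewrite -/v lD_M lD_w1 => <-; ring.
  have u1 : lD u *+ 2 = v *+ 3 by exact: lD_gen_wt_true.
  have u2 : lD (lD u) *+ 2 = lD v *+ 3 by rewrite -lD_Mn u1 lD_Mn.
  have uv : u = w1 * v by rewrite w1_sqrt.
  have vv1 : v * v = w1 by exact: sqrt2.
  apply: (mulfI four); rewrite [RHS]mulrA mulrN divff // mulN1r.
  have -> : 4%:R * res (lD (lD (u * P)) * (u * Q)) =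
     res (lD (lD (u * P)) * (u * Q) *+ 4) by rewrite mulr_natl.
  have -> : lD (lD (u * P)) * (u * Q) *+ 4 =
     (w1 * P * Q) *+ 3 + (w1 ^+ 2 * (lD P * Q)) *+ 12 + (w1 ^+ 3 * (lD (lD P) * Q)) *+ 4.
    rewrite !lDE_.
    have E1 : (lD (lD u) *+ 2) * u *+ 2 = w1 *+ 3.
      rewrite u2 uv; transitivity (lD v * v *+ 2 * w1 *+ 3); first ring.
      by rewrite vv mul1r.
    have E2 : (lD u *+ 2) * u = w1 ^+ 2 *+ 3.
      by rewrite u1 uv; transitivity (w1 * (v * v) *+ 3); [ring|rewrite vv1 expr2].
    have E3 : u * u = w1 ^+ 3 by exact: gen_wt_true2.
    transitivity ((lD (lD u) *+ 2) * u *+ 2 * P * Q + (lD u *+ 2) * u * (lD P * Q) *+ 4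
      + (u * u) * (lD (lD P) * Q) *+ 4); first ring.
    by rewrite E1 E2 E3; ring.
  rewrite (resD (_ + _)) (resD (_ *+ 3)).
  have resMn f n : res (f *+ n) = res f *+ n by elim: n => // n IH; rewrite !mulrS resD IH.
  by rewrite !resMn /res lead_w1 // lead_w2 // lead_w3 //; ring.
- rewrite gen_wt_false.
  have A1 : Up 1 (w1 ^+ 2 * P) := UpM w1_Up2 PU.
  have A2 : Up 1 (w1 ^+ 2 * Q) := UpM w1_Up2 QU.
  have A3 := lD_Up (lD_Up (lD_Up A1)).
  rewrite /res (lead_mul (C := -1) _ A3 A2) // lD_lead.
  by rewrite [lD _ (1 - 1 - 1)](res_lD (lD (w1 ^+ 2 * P))) mulr0 mul0r.
Qed.

End SuperVir.
Arguments res : simpl never.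
Arguments polar : simpl never.

(** * Linear maps on presented algebras and on the vacuum module *)

Lemma subspace_eq0 (F : fieldType) (V : lmodType F) : subspace (fun v : V => v = 0).
Proof. by split=> // a u v -> ->; rewrite scaler0 addr0. Qed.

Section Span.
Variables (F : fieldType) (V M : lmodType F).

Lemma subspaceB (W : set V) u v : subspace W -> W u -> W v -> W (u - v).
Proof. by move=> [_ Wl] Wu Wv; rewrite addrC -scaleN1r; exact: Wl. Qed.
Lemma subspaceD (W : set V) u v : subspace W -> W u -> W v -> W (u + v).
Proof. by move=> [_ Wl] Wu Wv; rewrite -[u]scale1r; exact: Wl. Qed.
Lemma subspaceZ (W : set V) a v : subspace W -> W v -> W (a *: v).
Proof. by move=> [W0 Wl] Wv; rewrite -[_ *: _]addr0; exact: Wl. Qed.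
Lemma subspace_sum (W : set V) I (r : seq I) (h : I -> V) : subspace W ->
  (forall i, W (h i)) -> W (\sum_(i <- r) h i).
Proof.
move=> sW Wh; elim/big_rec: _ => [|i x _]; first by case: sW.
by move=> Wx; exact: subspaceD.
Qed.

Lemma span_min (S W : set V) : subspace W -> (forall v, S v -> W v) ->
  forall v, span S v -> W v.
Proof. by move=> sW SW v sv; apply: sv; split. Qed.
Lemma span_gen (S : set V) v : S v -> span S v.
Proof. by move=> Sv W [_]; exact. Qed.

(** The preimage of a subspace. *)
Lemma subspace_pre (W : set M) (L : V -> M) : linear L -> subspace W ->
  subspace (fun v => W (L v)).
Proof.
move=> hL [W0 Wl]; split=> [|a u v Wu Wv]; last by rewrite hL; exact: Wl.
by have := hL (-1) 0 0; rewrite scaler0 addr0 scaleN1r addNr => ->.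
Qed.

Lemma subspace_eq (L1 L2 : V -> M) : linear L1 -> linear L2 ->
  subspace (fun v => L1 v = L2 v).
Proof.
move=> h1 h2; split=> [|a u v E1 E2]; last by rewrite h1 h2 E1 E2.
have Z (L : V -> M) : linear L -> L 0 = 0.
  by move=> hL; have := hL (-1) 0 0; rewrite scaler0 addr0 scaleN1r addNr.
by rewrite !Z.
Qed.

Section LinearFun.
Variable L : V -> M.
Hypothesis hL : linear L.
Lemma lin0 : L 0 = 0.
Proof. by have := hL (-1) 0 0; rewrite scaler0 addr0 scaleN1r addNr. Qed.
Lemma linD u v : L (u + v) = L u + L v.
Proof. by have := hL 1 u v; rewrite !scale1r. Qed.
Lemma linZ a v : L (a *: v) = a *: L v.
Proof. by have := hL a v 0; rewrite !addr0 lin0 addr0. Qed.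
Lemma linN v : L (- v) = - L v.
Proof. by rewrite -scaleN1r linZ scaleN1r. Qed.
Lemma linB u v : L (u - v) = L u - L v.
Proof. by rewrite linD linN. Qed.
Lemma lin_sum I (r : seq I) (h : I -> V) :
  L (\sum_(i <- r) h i) = \sum_(i <- r) L (h i).
Proof.
elim: r => [|i r IH]; first by rewrite !big_nil lin0.
by rewrite !big_cons linD IH.
Qed.
End LinearFun.

(** A linear map that vanishes on the generators factors through the quotient. *)
Lemma lquot_factor (S : set V) (L : V -> M) : linear L ->
  (forall v, S v -> L v = 0) ->
  exists L' : lquot S -> M, linear L' /\ forall v, L' (lcls S v) = L v.
Proof.
move=> hL LS; pose L' (q : lquot S) := L (repr q).
have E v : L' (lcls S v) = L v.
  have : span S (repr (lcls S v) - v) by apply/lclsP; rewrite /lcls reprK.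
  move=> /(span_min (subspace_pre hL (subspace_eq0 M)) LS).
  have -> : repr (lcls S v) - v = -1 *: v + repr (lcls S v).
    by rewrite scaleN1r addrC.
  by rewrite hL scaleN1r addrC => /eqP; rewrite subr_eq0 => /eqP.
exists L'; split=> // a p q.
have [u ->] := lcls_surj p; have [v ->] := lcls_surj q.
by rewrite -linearZ -linearD !E hL.
Qed.
End Span.

Section MalgLinear.
Variables (F : fieldType) (K : choiceType) (M : lmodType F).
Implicit Types (h : K -> M) (a b : {malg F[K]}).

(** The linear extension of a function on the basis [K] of [{malg F[K]}]. *)
Definition mlext h a : M := \sum_(k <- msupp a) mcoeff k a *: h k.

Lemma mlextEw h (d : {fset K}) a : (msupp a `<=` d)%fset ->
  mlext h a = \sum_(k <- d) mcoeff k a *: h k.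
Proof.
move=> le; apply: big_fset_incl => // m _ /mcoeff_outdom ->.
by rewrite scale0r.
Qed.

Lemma mlext_linear h : linear (mlext h).
Proof.
move=> k a b; set d := (msupp a `|` msupp b)%fset.
have da : (msupp a `<=` d)%fset by exact: fsubsetUl.
have db : (msupp b `<=` d)%fset by exact: fsubsetUr.
have dab : (msupp (k *: a + b)%R `<=` d)%fset.
  apply: fsubset_trans (msuppD_le _ _) _; apply: fsetSU; exact: msuppZ_le.
rewrite (mlextEw _ da) (mlextEw _ db) (mlextEw _ dab) scaler_sumr -big_split.
by apply: eq_bigr => m _ /=; rewrite mcoeffD mcoeffZ scalerDl scalerA.
Qed.
HB.instance Definition _ h :=
  GRing.isLinear.Build F {malg F[K]} M _ (mlext h) (mlext_linear h).

Lemma mlextU h k x : mlext h (mkmalgU k x) = x *: h k.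
Proof. by rewrite (mlextEw _ msuppU_le) big_seq_fset1 mcoeffUU. Qed.
End MalgLinear.

Section FreeAlg.
Variables (F : fieldType) (X : choiceType) (M : lmodType F).
Implicit Types (psi : seq X -> M) (s : seq X) (a b : free_alg F X).

(** The word in the generators of the free algebra. *)
Definition fword s : free_alg F X := \prod_(x <- s) gen F x.

Lemma fwordE s : fword s = mkmalgU (FMonom s) 1.
Proof.
elim: s => [|x s IH]; rewrite /fword ?big_nil ?big_cons.
  by rewrite -fmoneE.
rewrite -/(fword s) IH /gen malgM_def fgmulUU mulr1; congr mkmalgU.
by apply/eqP; rewrite fmP fmM fmU.
Qed.

Lemma fword_cat s t : fword (s ++ t) = fword s * fword t.
Proof. by rewrite /fword big_cat. Qed.
Lemma fword_cons x s : fword (x :: s) = gen F x * fword s.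
Proof. by rewrite /fword big_cons. Qed.
Lemma fword1 x : fword [:: x] = gen F x.
Proof. by rewrite /fword big_seq1. Qed.

(** The linear map on the free algebra with given values on the words. *)
Definition flin psi a : M := mlext (fun m : {fmonom X} => psi m) a.

Lemma flin_linear psi : linear (flin psi).
Proof. exact: mlext_linear. Qed.

Lemma flin_word psi s : flin psi (fword s) = psi s.
Proof. by rewrite /flin fwordE mlextU scale1r. Qed.

(** The words span the free algebra. *)
Lemma fword_span (W : set (free_alg F X)) : subspace W ->
  (forall s, W (fword s)) -> forall a, W a.
Proof.
move=> sW Ws a; rewrite [a]monalgE; apply: subspace_sum => // m.
suff -> : mkmalgU m (mcoeff m a) = mcoeff m a *: fword m by exact: subspaceZ.
apply/malgP => k; rewrite mcoeffZ fwordE fmK !mcoeffU.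
by rewrite mulr_natr.
Qed.

(** Vanishing on an ideal need only be tested on words times relations times words. *)
Lemma flin_gens psi (R : set (free_alg F X)) :
  (forall u r v, R r -> flin psi (fword u * r * fword v) = 0) ->
  forall x, ideal_gens R x -> flin psi x = 0.
Proof.
move=> h _ [a [r [b [Rr ->]]]].
have lin0 := subspace_pre (flin_linear psi) (subspace_eq0 M).
have linl c d : linear (fun a => a * c * d : free_alg F X).
  by move=> k p q; rewrite !mulrDl -!scalerAl.
have linr (c : free_alg F X) : linear (fun b => c * b : free_alg F X).
  by move=> k p q; rewrite mulrDr -scalerAr.
apply: (fword_span (subspace_pre (linl r b) lin0)) => s /=.
apply: (fword_span (subspace_pre (linr (fword s * r)) lin0)) => t /=.
exact: h.
Qed.

End FreeAlg.

Lemma alg_relE (F : fieldType) (A : algType F) (u x y e v : A) (s : F) :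
  u * (x * y - s%:A * (y * x) - e) * v
  = u * (x * (y * v)) - s *: (u * (y * (x * v))) - u * e * v.
Proof.
by rewrite !mulrBr !mulrBl mulr_algl -scalerAr -scalerAl -!mulrA.
Qed.

Lemma alg_mulP (F : fieldType) (A : algType F) (x p q : A) (a : F) :
  x * (a *: p + q) = a *: (x * p) + x * q.
Proof. by rewrite mulrDr scalerAr. Qed.

Lemma alg_charP (F : fieldType) (A : algType F) (x p q : A) (s k : F) :
  s *: (k *: p + q) + (k *: p + q) * x = k *: (s *: p + p * x) + (s *: q + q * x).
Proof. by rewrite mulrDl -scalerAl; lmod_id F A. Qed.

Section Presented.
Variables (F : fieldType) (A : algType F) (V : lmodType F).
Variables (g : ns_basis -> A) (cl : A -> V) (act : ns_basis -> V -> V).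
Hypothesis cl_linear : linear cl.
Hypothesis cl_surj : forall v, exists a, v = cl a.
Hypothesis act_cl : forall x a, act x (cl a) = cl (g x * a).

Lemma presented_act_linear x : linear (act x).
Proof.
move=> a u v; have [p ->] := cl_surj u; have [q ->] := cl_surj v.
rewrite -(cl_linear a p q) !act_cl -(cl_linear a (g x * p)).
by rewrite alg_mulP.
Qed.

Lemma presented_act_vac x k : cl (g x - k%:A) = 0 -> act x (cl 1) = k *: cl 1.
Proof.
rewrite act_cl mulr1 => h.
have -> : cl (g x) = cl (k%:A).
  have := cl_linear 1 (g x - k%:A) k%:A.
  by rewrite !scale1r subrK h add0r.
have c0 : cl 0 = 0 by have := cl_linear (-1) 0 0; rewrite scaler0 addr0 scaleN1r addNr.
by rewrite -[k%:A]addr0 cl_linear c0 addr0.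
Qed.

Lemma presented_act_comm (s : F) x y (b : {malg F[ns_basis]}) :
  (forall a, cl ((g x * g y - s%:A * (g y * g x) - mlext g b) * a) = 0) ->
  forall v, act x (act y v) - s *: act y (act x v) = mlext (fun z => act z v) b.
Proof.
move=> h v; have [a ->] := cl_surj v.
have := h a; rewrite -[X in X * _]mul1r alg_relE !mul1r.
have clB p q : cl (p - q) = cl p - cl q.
  by have := cl_linear (-1) q p; rewrite !scaleN1r [- q + p]addrC [_ + cl p]addrC.
have cl0 : cl 0 = 0 by rewrite -(subrr 0) clB subrr.
have clZ k p : cl (k *: p) = k *: cl p.
  by rewrite -[k *: p]addr0 cl_linear cl0 addr0.
rewrite !clB clZ !act_cl => /eqP; rewrite subr_eq0 => /eqP ->.
rewrite /mlext mulr_suml.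
elim: (enum_fset _) => [|z r IH]; first by rewrite !big_nil cl0.
by rewrite !big_cons -scalerAl cl_linear IH act_cl.
Qed.
End Presented.

Section NSModule.
Variables (F : fieldType) (c : F).
Local Notation V := (VNS c).

(** The projection of the free algebra on the Neveu-Schwarz basis onto the vacuum
    module. *)
Definition vns_cls (a : free_alg F ns_basis) : V :=
  lcls (vac_gens c) (acls (@ns_rels F) a).

Fact vns_cls_linear : linear vns_cls.
Proof.
move=> k a b; rewrite /vns_cls (linearP (acls (@ns_rels F))).
exact: (linearP (lcls (vac_gens c))).
Qed.

Lemma vns_cls_surj v : exists a, v = vns_cls a.
Proof.
by have [u ->] := lcls_surj v; have [a ->] := acls_surj u; exists a.
Qed.

Lemma ns_act_vns_cls x a : ns_act x (vns_cls a) = vns_cls (gen F x * a).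
Proof. by rewrite /vns_cls ns_actE rmorphM. Qed.

Lemma ns_vacE : ns_vac c = vns_cls 1.
Proof. by rewrite /vns_cls rmorph1. Qed.

Lemma ns_wordE s : ns_word c s = vns_cls (fword F s).
Proof.
elim: s => [|x s IH] /=; first by rewrite /fword big_nil -ns_vacE.
by rewrite IH ns_act_vns_cls fword_cons.
Qed.

Lemma ns_word_span (W : set V) : subspace W -> (forall s, W (ns_word c s)) ->
  forall v, W v.
Proof.
move=> sW Ww v; have [a ->] := vns_cls_surj v.
apply: (fword_span (subspace_pre vns_cls_linear sW)) => s.
by have := Ww s; rewrite ns_wordE.
Qed.

Fact ns_act_linear x : linear (@ns_act F c x).
Proof. exact: (presented_act_linear vns_cls_linear vns_cls_surj ns_act_vns_cls). Qed.

Lemma vns_cls_eq0 a : span (vac_gens c) (acls (@ns_rels F) a) -> vns_cls a = 0.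
Proof.
move=> h; have <- : lcls (vac_gens c) 0 = 0 by exact: linear0.
by apply/lclsP; rewrite (subr0 (acls (@ns_rels F) a)).
Qed.

Lemma ns_act_vac x : ns_sub x -> ns_act x (ns_vac c) = ns_char c x *: ns_vac c.
Proof.
move=> sx; rewrite ns_vacE.
apply: (presented_act_vac vns_cls_linear ns_act_vns_cls).
apply: vns_cls_eq0; apply: span_gen; exists 1, x; split=> //.
have al : linear (acls (@ns_rels F)) by exact: linearP.
rewrite (linB al) (linZ al) (rmorph1 (acls (@ns_rels F))); congr (_ - _).
exact: esym (mul1r (uns F x)).
Qed.

Lemma ns_sign x y : (-1 : free_alg F ns_basis) ^+ (ns_odd x && ns_odd y) =
  ((-1) ^+ (ns_odd x && ns_odd y) : F)%:A.
Proof.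
by case: (_ && _); rewrite ?expr1 ?expr0 ?scaleN1r ?scale1r.
Qed.

Lemma ns_act_comm x y (v : V) :
  ns_act x (ns_act y v) - (-1) ^+ (ns_odd x && ns_odd y) *: ns_act y (ns_act x v)
  = mlext (fun z => ns_act z v) (ns_bracket F x y).
Proof.
apply: (presented_act_comm vns_cls_linear vns_cls_surj ns_act_vns_cls) => a.
apply: vns_cls_eq0; have -> : acls (@ns_rels F) ((gen F x * gen F y -
   ((-1) ^+ (ns_odd x && ns_odd y) : F)%:A * (gen F y * gen F x) -
   mlext (gen F) (ns_bracket F x y)) * a) = 0.
  rewrite -ns_sign; have <- : acls (@ns_rels F) 0 = 0 by exact: linear0.
  apply/lclsP; rewrite (subr0 (_ * a)); apply: span_gen.
  exists 1, (gen F x * gen F y - (-1) ^+ (ns_odd x && ns_odd y) * (gen F y * gen F x)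
         - ns_embed (ns_bracket F x y)), a; split; first by exists x, y.
  by congr (_ * _); exact: esym (mul1r _).
by case: (span_subspace (vac_gens c)).
Qed.

Variable M : lmodType F.

(** The universal property of the vacuum module: a function on words that respects the
    brackets inside words and the character at their ends is induced by a linear
    map. *)
Lemma VNS_lift (psi : seq ns_basis -> M) :
  (forall u x y v, psi (u ++ x :: y :: v)
     - (-1) ^+ (ns_odd x && ns_odd y) *: psi (u ++ y :: x :: v)
     = mlext (fun z => psi (u ++ z :: v)) (ns_bracket F x y)) ->
  (forall u x, ns_sub x -> psi (rcons u x) = ns_char c x *: psi u) ->
  exists Phi : {linear V -> M}, forall s, Phi (ns_word c s) = psi s.
Proof.
move=> H1 H2.
have K1 : forall a, ideal_gens (@ns_rels F) a -> flin psi a = 0.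
  apply: flin_gens => u _ v [x [y ->]].
  have -> : fword F u * (gen F x * gen F y -
     (-1) ^+ (ns_odd x && ns_odd y) * (gen F y * gen F x) -
     ns_embed (ns_bracket F x y)) * fword F v
   = fword F (u ++ x :: y :: v) - (-1) ^+ (ns_odd x && ns_odd y) *: fword F (u ++ y :: x :: v)
     - \sum_(z <- msupp (ns_bracket F x y)) mcoeff z (ns_bracket F x y) *: fword F (u ++ z :: v).
    rewrite ns_sign alg_relE !fword_cat !fword_cons; congr (_ - _).
    rewrite mulr_sumr mulr_suml; apply: eq_bigr => z _.
    by rewrite -scalerAr -scalerAl fword_cat fword_cons mulrA.
  have fl := flin_linear psi.
  rewrite (linB fl) (linB fl) (linZ fl) (lin_sum fl) !flin_word H1.
  apply/eqP; rewrite subr_eq0; apply/eqP; apply: eq_bigr => z _.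
  by rewrite (linZ fl) flin_word.
have [L1 [L1l L1E]] := lquot_factor (flin_linear psi) K1.
have K2 : forall u, vac_gens c u -> L1 u = 0.
  move=> _ [u [x [sx ->]]]; have [a ->] := acls_surj u.
  have -> : acls (@ns_rels F) a * uns F x - ns_char c x *: acls (@ns_rels F) a =
      acls (@ns_rels F) (- ns_char c x *: a + a * gen F x).
    have al : linear (acls (@ns_rels F)) by exact: linearP.
    by rewrite (linD al) (linZ al) scaleNr addrC rmorphM.
  rewrite L1E.
  pose L a := flin psi (- ns_char c x *: a + a * gen F x).
  have Ll : linear L.
    move=> k p q; rewrite /L -(flin_linear psi); congr (flin psi).
    exact: alg_charP.
  apply: (fword_span (subspace_pre Ll (subspace_eq0 M))) => s /=.
  rewrite /L flin_linear -fword1 -fword_cat cats1 !flin_word.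
  by rewrite H2 //= scaleNr addNr.
have [L2 [L2l L2E]] := lquot_factor L1l K2.
pose L2L := GRing.isLinear.Build F V M _ L2 L2l.
exists (HB.pack_for {linear V -> M} L2 L2L) => s.
by rewrite /= ns_wordE /vns_cls L2E L1E flin_word.
Qed.

End NSModule.

(** * Words in two generators *)

Section FreeTwo.
Variables (F : fieldType) (V : lmodType F) (op : bool -> V -> V) (v0 : V).
Hypothesis op_linear : forall a, linear (op a).
Local Notation FA := (free_alg F 'I_2).

(** The linear map that sends a word in two generators to the corresponding composite
    of [op false] and [op true], applied to [v0]. *)
Definition fapp (a : FA) : V := flin (fun s => foldr (fun i : 'I_2 => op (i == 1)) v0 s) a.

Lemma fapp_linear : linear fapp. Proof. exact: flin_linear. Qed.

Lemma fapp1 : fapp 1 = v0.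
Proof.
have -> : (1 : FA) = fword F [::] by rewrite /fword big_nil.
by rewrite /fapp flin_word.
Qed.

Lemma fapp_gen i a : fapp (gen F i * a) = op (i == 1) (fapp a).
Proof.
apply: (fword_span (W := fun a => fapp (gen F i * a) = op (i == 1) (fapp a))).
  apply: subspace_eq => k p q; last by rewrite fapp_linear op_linear.
  by rewrite alg_mulP fapp_linear.
by move=> s; rewrite -fword_cons /fapp !flin_word.
Qed.

Lemma free2_ind (W : set FA) : subspace W -> W 1 ->
  (forall a, W a -> W (gen F 0 * a)) -> (forall a, W a -> W (gen F 1 * a)) -> forall a, W a.
Proof.
move=> sW W1 W0 W2; apply: (fword_span sW); elim=> [|i s IH].
  by rewrite /fword big_nil.
rewrite fword_cons; case: i => [[|[|//]] hi].
  have -> : Ordinal hi = 0 by apply/val_inj.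
  exact: W0.
have -> : Ordinal hi = 1 by apply/val_inj.
exact: W2.
Qed.
End FreeTwo.

(** * The functional on words of Neveu-Schwarz generators *)

Section Embedding.
Variable F : fieldType.
Local Notation K := (laurent F).
Local Notation cns := (cns F).
Hypothesis two_neq0 : 2%:R != 0 :> F.
Hypothesis three_neq0 : 3%:R != 0 :> F.

(** The Neveu-Schwarz basis inside the completed superalgebra. *)
Definition ns_ser (x : ns_basis) : cns :=
  match x with
  | NS_L m => (2%:R^-1 *: zp F (m + 1), 0)
  | NS_G m => (zp F (m + 1), 0)
  | NS_c => (0, 3%:R)
  end.

Lemma binF3 (m : int) : binomF F m%:~R 3 * 6%:R = m%:~R * (m - 1)%:~R * (m - 2)%:~R.
Proof.
have six : 6%:R != 0 :> F by rewrite (natrM _ 2 3) mulf_neq0.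
rewrite /binomF (@pint_ratr F _ (m * (m - 1) * (m - 2)) 6) //.
  by rewrite divfK // !rmorphM.
rewrite !big_ord_recr big_ord0 /= mul1r subr0 !rmorphM !rmorphB /=.
by rewrite divfK.
Qed.

Variable W : lmodType F.

Lemma mlext_LL (h : ns_basis -> W) m n : mlext h (ns_bracket F (NS_L m) (NS_L n)) =
  (m - n)%:~R *: h (NS_L (m + n))
  + (2%:R^-1 * binomF F (m + 1)%:~R 3 * (m + n == 0)%:R) *: h NS_c.
Proof. by rewrite linearD !linearZ /= /ns_elt !mlextU !scale1r. Qed.
Lemma mlext_LG (h : ns_basis -> W) m n : mlext h (ns_bracket F (NS_L m) (NS_G n)) =
  (m%:~R / 2%:R - n%:~R - 2%:R^-1) *: h (NS_G (m + n)).
Proof. by rewrite linearZ /= /ns_elt mlextU scale1r. Qed.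
Lemma mlext_GL (h : ns_basis -> W) m n : mlext h (ns_bracket F (NS_G n) (NS_L m)) =
  - ((m%:~R / 2%:R - n%:~R - 2%:R^-1) *: h (NS_G (m + n))).
Proof. by rewrite linearN linearZ /= /ns_elt mlextU scale1r. Qed.
Lemma mlext_GG (h : ns_basis -> W) m n : mlext h (ns_bracket F (NS_G m) (NS_G n)) =
  2%:R *: h (NS_L (m + (n + 1)))
  + (3%:R^-1 * (m * (m + 1))%:~R * (m + (n + 1) == 0)%:R) *: h NS_c.
Proof. by rewrite linearD !linearZ /= /ns_elt !mlextU !scale1r. Qed.

Lemma ser_br_LL m n : ser_br false false (ns_ser (NS_L m)) (ns_ser (NS_L n)) =
  (m - n)%:~R *: ns_ser (NS_L (m + n))
  + (2%:R^-1 * binomF F (m + 1)%:~R 3 * (m + n == 0)%:R) *: ns_ser NS_c.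
Proof.
apply: cnsP.
  rewrite /= scaler0 addr0 !lD_Z !lD_zp !addrK -!scalerAl -!scalerAr -!zpD.
  rewrite (_ : m + (n + 1) = m + n + 1); last by lia.
  rewrite (_ : m + 1 + n = m + n + 1); last by lia.
  rewrite -[_ *+ 2]scaler_nat; lmod_id F K.
  by rewrite !rmorphD !rmorphN /= (rmorph1 (intmul 1)); field.
rewrite /= scaler0 add0r !lD_Z !lD_zp !lD_Z !lD_zp !lD_Z !lD_zp -!scalerAl -!scalerAr -zpD.
rewrite !resZ /res zpE.
rewrite (_ : (-1 == m + 1 - 1 - 1 - 1 + (n + 1)) = (m + n == 0)); last by lia.
have e3 := binF3 (m + 1).
have six : 6%:R != 0 :> F by rewrite (natrM _ 2 3) mulf_neq0.
rewrite -[binomF _ _ _](mulfK six) e3.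
rewrite -[RHS]/(_ * 3%:R) (natrM _ 2 3) !addrK.
rewrite (_ : m + 1 - 2 = m - 1); last by lia.
by field; rewrite six two_neq0.
Qed.

Lemma ser_br_LG m n : ser_br false true (ns_ser (NS_L m)) (ns_ser (NS_G n)) =
  (m%:~R / 2%:R - n%:~R - 2%:R^-1) *: ns_ser (NS_G (m + n)).
Proof.
apply: cnsP; last by rewrite /= scaler0.
rewrite /= !lD_Z !lD_zp !addrK -!scalerAl -!scalerAr -!zpD.
rewrite (_ : m + (n + 1) = m + n + 1); last by lia.
rewrite (_ : m + 1 + n = m + n + 1); last by lia.
rewrite -[X in _ - X = _]scaler_nat; lmod_id F K.
by rewrite !rmorphD /= (rmorph1 (intmul 1)); field.
Qed.

Lemma ser_br_GG m n : ser_br true true (ns_ser (NS_G m)) (ns_ser (NS_G n)) =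
  2%:R *: ns_ser (NS_L (m + (n + 1)))
  + (3%:R^-1 * (m * (m + 1))%:~R * (m + (n + 1) == 0)%:R) *: ns_ser NS_c.
Proof.
apply: cnsP.
  rewrite /= scaler0 addr0 scalerA divff // scale1r -zpD; congr zp; lia.
rewrite /= scaler0 add0r lD_zp lD_Z lD_zp -!scalerAl -zpD.
rewrite !resZ /res zpE.
rewrite (_ : (-1 == m + 1 - 1 - 1 + (n + 1)) = (m + (n + 1) == 0)); last by lia.
by rewrite !addrK rmorphM -[RHS]/(_ * 3%:R) /=; field.
Qed.

Lemma ser_br_c a x : ser_br a false x (ns_ser NS_c) = 0.
Proof.
have D0 : lD (0 : K) = 0 by exact: linear0.
case: a; apply: cnsP; rewrite /= ?D0 ?mul0r ?mulr0 ?subr0 ?mul0rn //.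
Qed.
Lemma ser_br_cl a x : ser_br false a (ns_ser NS_c) x = 0.
Proof. by rewrite ser_br_antisym ser_br_c scaler0 oppr0. Qed.

Arguments ser_br : simpl never.

Lemma mlext0 (h : ns_basis -> W) : mlext h (0 : NS F) = 0.
Proof. exact: linear0. Qed.

(** [ns_ser] preserves brackets, tested against an arbitrary linear map [L]. *)
Lemma ns_ser_bracket (L : bool -> cns -> W) : (forall a, linear (L a)) -> forall x y,
  L (ns_odd x (+) ns_odd y) (ser_br (ns_odd x) (ns_odd y) (ns_ser x) (ns_ser y))
  = mlext (fun z => L (ns_odd z) (ns_ser z)) (ns_bracket F x y).
Proof.
move=> hL [m|m|] [n|n|] /=.
- by rewrite mlext_LL ser_br_LL /= (linD (hL _)) !(linZ (hL _)).
- by rewrite mlext_LG ser_br_LG (linZ (hL _)).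
- by rewrite mlext0 ser_br_c (lin0 (hL _)).
- rewrite mlext_GL -(linZ (hL _)) -ser_br_LG.
  rewrite [in LHS](ser_br_antisym true false) (linN (hL _)); congr (- _).
  by rewrite /sg /= expr0 scale1r.
- by rewrite mlext_GG ser_br_GG /= (linD (hL _)) !(linZ (hL _)).
- by rewrite mlext0 ser_br_c (lin0 (hL _)).
- by rewrite mlext0 ser_br_cl (lin0 (hL _)).
- by rewrite mlext0 ser_br_cl (lin0 (hL _)).
- by rewrite mlext0 ser_br_c (lin0 (hL _)).
Qed.
End Embedding.

Section Continuity.
Variable F : fieldType.
Local Notation cns := (cns F).

(** Continuity of the bracket; the cocycles vanish on high powers of [z]. *)
Lemma ser_br_FilG a d A B (x y : cns) : Fil A x.1 -> Fil B y.1 ->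
  Fil (A + B - 1) (ser_br a d x y).1 /\ (3 <= A + B -> (ser_br a d x y).2 = 0).
Proof.
move=> xF yF; have DxF := lD_Fil xF; have DyF := lD_Fil yF.
have h1 : Fil (A + B - 1) (lD x.1 * y.1) by apply: (Fil_le _ (FilM DxF yF)); lia.
have h2 : Fil (A + B - 1) (x.1 * lD y.1) by apply: (Fil_le _ (FilM xF DyF)); lia.
have h3 : Fil (A + B - 1) (y.1 * lD x.1) by rewrite mulrC.
have h4 : Fil (A + B - 1) (lD y.1 * x.1) by rewrite mulrC.
have r3 : 3 <= A + B -> res (lD (lD (lD x.1)) * y.1) = 0.
  by move=> AB; apply: (FilM (lD_Fil (lD_Fil DxF)) yF); lia.
have r2 : 3 <= A + B -> res (lD (lD x.1) * y.1) = 0.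
  by move=> AB; apply: (FilM (lD_Fil DxF) yF); lia.
case: a; case: d; rewrite /ser_br; split=> //=.
- by apply: (Fil_le _ (FilM xF yF)); lia.
- by rewrite mulr2n; apply: FilB => //; apply: FilD.
- by rewrite mulr2n; apply: FilB => //; apply: FilD.
- by rewrite mulr2n; apply: FilD; apply: FilB.
Qed.

End Continuity.

Section Functional.
Variable F : fieldType.
Local Notation K := (laurent F).
Local Notation cns := (cns F).
Hypothesis two_neq0 : 2%:R != 0 :> F.
Hypothesis three_neq0 : 3%:R != 0 :> F.
Variables (M : lmodType F) (c : F) (Yop : M -> M) (m0 : M).
Hypothesis Yop_linear : linear Yop.
Implicit Types (f g P Q : K) (x y : cns) (m : M).

Local Notation kap := (c / 3%:R).

(** The coefficient of [z^-1] in the parameter of the component in [n]. *)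
Definition neg_res (a : bool) x : F := (gen_wtV F a * x.1) (-1).

(** The action on [M] attached to an operator [Yop], meant to be multiplication by [y].
    On [n] it is the representation in which the odd element of parameter [P] acts
    by [P_(-1) Yop] and the even one by [2 P_(-1) Yop^2] ([neg_repE]); a power series
    acts by [0] and the central element by [c]. As [kap = c/3] is the value of
    [(0, 1)], the term in [1/4] undoes the central term of [neg_elt]. *)
Definition neg_rep (a : bool) x m : M :=
  if a then neg_res a x *: Yop m
  else (neg_res a x * 2%:R) *: Yop (Yop m) + ((x.2 + 4%:R^-1 * neg_res a x) * kap) *: m.

Lemma neg_res_lin a k x y : neg_res a (k *: x + y) = k * neg_res a x + neg_res a y.
Proof. by rewrite /neg_res cns1 mulrDr -scalerAr. Qed.

Lemma neg_res_polar_part a x : neg_res a x = (polar_part a x) (-1).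
Proof. by []. Qed.

Lemma neg_res_Fil a x : Fil 0 x.1 -> neg_res a x = 0.
Proof. by move=> xF; rewrite /neg_res (FilM0 (gen_wtV_Fil F a) xF). Qed.

Lemma neg_rep_lin_l a m : linear (fun x : cns => neg_rep a x m).
Proof.
move=> k x y; rewrite /neg_rep neg_res_lin; case: a; first by lmod_id F M.
rewrite (_ : (k *: x + y).2 = k * x.2 + y.2) //; lmod_id F M.
Qed.

Lemma neg_rep_lin_r a x : linear (neg_rep a x).
Proof.
move=> k p q; rewrite /neg_rep; case: a; rewrite !Yop_linear; lmod_id F M.
Qed.

Lemma neg_repE a P m : Up (-1) P -> neg_rep a (neg_elt a P) m =
  if a then P (-1) *: Yop m else (P (-1) * 2%:R) *: Yop (Yop m).
Proof.
move=> PU; rewrite /neg_rep neg_res_polar_part polar_part_neg_elt //; case: a => //=.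
by rewrite mulNr addNr mul0r scale0r addr0.
Qed.

(** The representation factors through the quotient of [n] by the ideal of [neg_br_Up],
    where only the odd-odd bracket survives. *)
Lemma neg_rep_comm a d x y m :
  neg_rep a x (neg_rep d y m) - sg F a d *: neg_rep d y (neg_rep a x m)
  = neg_rep (a (+) d) (ser_br a d (neg_part a x) (neg_part d y)) m.
Proof.
have xU := polar_Up (gen_wtV F a * x.1); have yU := polar_Up (gen_wtV F d * y.1).
rewrite /neg_part ser_br_nn // neg_repE; last by apply: (Up_le _ (neg_br_Up two_neq0 a d xU yU)).
rewrite neg_br_lead // -!neg_res_polar_part /neg_rep.
have YZ k p : Yop (k *: p) = k *: Yop p by exact: (linZ Yop_linear).
have YD p q : Yop (p + q) = Yop p + Yop q by exact: (linD Yop_linear).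
case: a {xU}; case: d {yU}; rewrite /sg /= ?expr1 ?expr0 !(YD, YZ);
  lmod_id F M.
Qed.

Lemma neg_rep_bb a d x y m : neg_rep (a (+) d) (ser_br a d (reg_part a x) (reg_part d y)) m = 0.
Proof.
have [bF b0] := ser_br_Fil a d (reg_part_Fil two_neq0 a x) (reg_part_Fil two_neq0 d y).
rewrite /neg_rep b0 neg_res_Fil // mul0r mulr0 addr0 mul0r !scale0r addr0.
by case: (_ (+) _).
Qed.

(** The functional on words in the completed superalgebra that extends [neg_rep]. *)
Definition ext_phi := phi (@ser_br F) (@reg_part F) neg_rep m0.

Lemma ext_phi_lin u a (v : seq (bool * cns)) :
  linear (fun x : cns => ext_phi (u ++ (a, x) :: v)).
Proof.
move=> k x y.
exact: (phi_lin (@ser_br_lin_l F) (@ser_br_lin_r F) m0 (@reg_part_lin F) neg_rep_lin_l neg_rep_lin_r).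
Qed.

Lemma ext_phi_swap (u : seq (bool * cns)) (x y : bool * cns) v :
  ext_phi (u ++ x :: y :: v) - sg F x.1 y.1 *: ext_phi (u ++ y :: x :: v)
  = ext_phi (u ++ (x.1 (+) y.1, ser_br x.1 y.1 x.2 y.2) :: v).
Proof.
have nn a d (p q : cns) : reg_part (a (+) d) (ser_br a d (neg_part a p) (neg_part d q)) = 0.
  have pU : Up (-1) (polar_part a p) by exact: polar_Up.
  have qU : Up (-1) (polar_part d q) by exact: polar_Up.
  rewrite /neg_part (ser_br_nn two_neq0 a d pU qU) reg_part_neg_elt //.
  by apply: (Up_le _ (neg_br_Up two_neq0 a d pU qU)).
exact: (phi_swap (@ser_br_lin_l F) (@ser_br_lin_r F) (@ser_br_jacobi F) (@ser_br_antisym F)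
  m0 (@reg_part_lin F) (@neg_reg_part F) (reg_part_bb two_neq0) nn
  neg_rep_lin_l neg_rep_lin_r neg_rep_comm neg_rep_bb).
Qed.

Lemma ext_phi_last u a y k : Fil 0 y.1 -> (a = false -> y.2 * kap = k) -> (a -> k = 0) ->
  ext_phi (rcons u (a, y)) = k *: ext_phi u.
Proof.
move=> yF ya ka.
apply: (phi_last m0 (reg_part_bb two_neq0) neg_rep_lin_r neg_rep_bb); first exact: reg_part_id.
move=> m; rewrite /neg_rep neg_res_Fil //; case: a ya ka => [_ /(_ isT) ->|/(_ erefl) h _].
    by rewrite !scale0r.
  by rewrite mul0r scale0r add0r mulr0 addr0 h.
Qed.

Lemma ext_phi_neg_elt a P r : Up (-1) P ->
  ext_phi ((a, neg_elt a P) :: r) = neg_rep a (neg_elt a P) (ext_phi r).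
Proof.
move=> PU; rewrite /ext_phi phi_cons /= reg_part_neg_elt // -[RHS]addr0; congr (_ + _).
have h := @ad_lin_b F cns M (@ser_br F) (@ser_br_lin_l F) a (-1) 0 0 ext_phi r.
rewrite scaler0 addr0 scaleN1r addNr in h; apply: h.
by move=> u' a' k' x' y' v'; exact: ext_phi_lin.
Qed.

Lemma ns_ser_Fil (z : ns_basis) : exists A, Fil A (ns_ser F z).1.
Proof. exact: lbound. Qed.

(** The functional vanishes on a word in which a letter is divisible by a high power
    of [z] and is followed only by Neveu-Schwarz generators. *)
Lemma ext_phi_tail (w : seq ns_basis) : exists N : int,
  forall (u : seq (bool * cns)) (a : bool) f, Fil N f ->
  ext_phi (u ++ (a, (f, 0) : cns) :: [seq (ns_odd z, ns_ser F z) | z <- w]) = 0.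
Proof.
elim: w => [|z w [N IH]].
  exists 0 => u a f fF; rewrite /= cats1 (@ext_phi_last _ _ _ 0) ?scale0r //.
  by rewrite mul0r.
have [A zA] := ns_ser_Fil z.
exists (Num.max N (Num.max (N - A + 1) (3 - A))) => u a f fF /=.
have := ext_phi_swap u (a, (f, 0) : cns) (ns_odd z, ns_ser F z)
   [seq (ns_odd z, ns_ser F z) | z <- w] => /=.
have -> : ext_phi (u ++ (ns_odd z, ns_ser F z) :: (a, (f, 0) : cns)
   :: [seq (ns_odd z, ns_ser F z) | z <- w]) = 0.
  by rewrite -cat_rcons; apply: IH; apply: (Fil_le _ fF); lia.
rewrite scaler0 subr0 => ->.
have fF' : Fil (Num.max (N - A + 1) (3 - A)) (f, 0 : F^o).1.
  by apply: (Fil_le _ fF); lia.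
have [b1 b2] := ser_br_FilG a (ns_odd z) fF' zA.
rewrite [ser_br _ _ _ _]surjective_pairing b2; last by lia.
by apply: IH; apply: (Fil_le _ b1); lia.
Qed.

(** The functional on words of Neveu-Schwarz generators. *)
Definition ext_psi (s : seq ns_basis) : M := ext_phi [seq (ns_odd z, ns_ser F z) | z <- s].

Lemma ext_psi_rel u (x y : ns_basis) v :
  ext_psi (u ++ x :: y :: v) - (-1) ^+ (ns_odd x && ns_odd y) *: ext_psi (u ++ y :: x :: v)
  = mlext (fun z => ext_psi (u ++ z :: v)) (ns_bracket F x y).
Proof.
rewrite /ext_psi !map_cat /= ext_phi_swap /=.
have := @ns_ser_bracket F two_neq0 three_neq0 M
  (fun a z => ext_phi (map (fun z => (ns_odd z, ns_ser F z)) u ++ (a, z)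
     :: map (fun z => (ns_odd z, ns_ser F z)) v)) _ x y.
rewrite /= => -> //; last by move=> a; exact: ext_phi_lin.
by congr mlext; apply/funext => z; rewrite map_cat.
Qed.

Lemma ext_psi_char u (x : ns_basis) : ns_sub x -> ext_psi (rcons u x) = ns_char c x *: ext_psi u.
Proof.
rewrite /ns_sub /= => sx; rewrite /ext_psi map_rcons; apply: ext_phi_last.
- case: x sx => [m|m|] hm; rewrite /ns_ser [_.1]/=; last by move=> n _; exact: lcoef0.
  + by apply: FilZ; apply: (Fil_le _ (@Fil_zp F (m + 1))); lia.
  + by apply: (Fil_le _ (@Fil_zp F (m + 1))); lia.
- by case: x sx => [m|m|] //= _ _; rewrite ?mul0r // mulrC divfK.
- by case: x sx.
Qed.

End Functional.

(** * Residues against a vertex operator *)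

(** The finite support sums over [nat] that occur in the axioms, as sums up to a bound. *)
Lemma nsumE (V : zmodType) (N : nat) (h : nat -> V) :
  (forall i, (N <= i)%N -> h i = 0) ->
  (\sum_(i \in [set: nat]) h i)%classic = \sum_(i < N) h i.
Proof.
move=> h0; rewrite (fsbigE (iota 0 N)) ?iota_uniq //=.
  rewrite -{1}(subn0 N) -/(index_iota 0 N) big_mkord.
  by apply: eq_bigl => i; rewrite in_setT.
by move=> n _; rewrite mem_iota add0n /= -leqNgt; exact: h0.
Qed.

Section Density.
Variables (F : fieldType) (V : lmodType F).
Local Notation K := (laurent F).

(** Two linear maps on [F((z))] that vanish on high powers of [z] and agree on the
    powers of [z] are equal. *)
Lemma laurent_eq (L1 L2 : K -> V) A f : linear L1 -> linear L2 ->
  (forall m, A <= m -> L1 (zp F m) = L2 (zp F m)) ->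
  (exists N, forall g, Fil N g -> L1 g = 0) ->
  (exists N, forall g, Fil N g -> L2 g = 0) ->
  Fil A f -> L1 f = L2 f.
Proof.
move=> l1 l2 Lz [N1 h1] [N2 h2] fA; apply/eqP; rewrite -subr_eq0; apply/eqP.
pose L f := L1 f - L2 f.
have lL : linear L by move=> k p q; rewrite /L l1 l2; lmod_id F V.
pose LL := GRing.isLinear.Build F K V _ L lL.
apply: (@laurent_eq0 F V (HB.pack_for {linear K -> V} L LL) A (Num.max N1 N2) f) => //=.
  by move=> m Am; rewrite /L Lz // subrr.
move=> g gN; rewrite /L h1 ?h2 ?subrr //; apply: (Fil_le _ gN); lia.
Qed.

Lemma Up_in (L : K -> V) (W : set V) N f : linear L ->
  subspace W -> (forall m, m <= N -> W (L (zp F m))) -> Up N f -> W (L f).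
Proof.
move=> lL sW Wz fN; pose LL := GRing.isLinear.Build F K V _ L lL.
exact: (@Up_ind F V (HB.pack_for {linear K -> V} L LL) W N f).
Qed.

Lemma Fil_finite (G : nat -> K -> V) I :
  (forall i, exists N, forall f, Fil N f -> G i f = 0) ->
  exists N, forall f, Fil N f -> forall i, (i < I)%N -> G i f = 0.
Proof.
move=> h; elim: I => [|I [N hN]]; first by exists 0.
have [N' hN'] := h I; exists (Num.max N N') => f fF i.
rewrite ltnS leq_eqVlt => /predU1P[->|iI].
  by apply: hN'; apply: (Fil_le _ fF); lia.
by apply: hN => //; apply: (Fil_le _ fF); lia.
Qed.
End Density.

Section Modes.
Variables (F : fieldType) (V : lmodType F) (Y : V -> int -> V -> V).
Local Notation K := (laurent F).
Implicit Types (f g h : K) (u v w : V).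
Hypothesis Yl : forall n v, linear (fun u => Y u n v).
Hypothesis Yr : forall u n, linear (Y u n).
Hypothesis Ytr : forall u v, exists N : int, forall n, N <= n -> Y u n v = 0.

(** The residue [Res f(z) Y(u,z) v] for a Laurent series [f]. *)
Definition resY u f v : V := zsum (fun n => f n *: Y u n v).

Lemma resY_supp_in A N u f v : Fil A f -> (forall n, N <= n -> Y u n v = 0) ->
  forall B, B <= A -> supp_in B (absz (N - B)%R) (fun n => f n *: Y u n v).
Proof.
move=> fA hN B BA n hn; have [nA|nA] := ltP n A; first by rewrite fA // scale0r.
by rewrite hN ?scaler0 //; lia.
Qed.

Lemma resY_linf u v : linear (fun f => resY u f v).
Proof.
move=> k f g; have [N hN] := Ytr u v.
have [A fA] := lbound f; have [B gB] := lbound g.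
pose C := Num.min A B.
have CA : C <= A by rewrite /C; lia.
have CB : C <= B by rewrite /C; lia.
have w1 := resY_supp_in fA hN CA; have w2 := resY_supp_in gB hN CB.
have w1' : supp_in C (absz (N - C)%R) (fun n => k *: (f n *: Y u n v)).
  by move=> n hn; rewrite w1 ?scaler0.
rewrite /resY (eq_zsum (h2 := fun n => k *: (f n *: Y u n v) + g n *: Y u n v)).
  by rewrite (zsumD w1' w2) (zsumE w1') (zsumE w1) scaler_sumr.
by move=> n; rewrite lcoefD lcoefZ scalerDl scalerA.
Qed.

Lemma resY_linr u f : linear (resY u f).
Proof.
move=> k v v'; have [N hN] := Ytr u v; have [N' hN'] := Ytr u v'.
have [A fA] := lbound f; pose M := Num.max N N'.
have h n : M <= n -> Y u n v = 0 by rewrite /M => nM; apply: hN; lia.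
have h' n : M <= n -> Y u n v' = 0 by rewrite /M => nM; apply: hN'; lia.
have w1 := resY_supp_in fA h (lexx A); have w2 := resY_supp_in fA h' (lexx A).
have w1' : supp_in A (absz (M - A)%R) (fun n => k *: (f n *: Y u n v)).
  by move=> n hn; rewrite w1 ?scaler0.
rewrite /resY (eq_zsum (h2 := fun n => k *: (f n *: Y u n v) + f n *: Y u n v')).
  by rewrite (zsumD w1' w2) (zsumE w1') (zsumE w1) scaler_sumr.
by move=> n; rewrite Yr scalerDr !scalerA mulrC.
Qed.

Lemma resY_linl f v : linear (fun u => resY u f v).
Proof.
move=> k u u'; have [N hN] := Ytr u v; have [N' hN'] := Ytr u' v.
have [A fA] := lbound f; pose M := Num.max N N'.
have h n : M <= n -> Y u n v = 0 by rewrite /M => nM; apply: hN; lia.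
have h' n : M <= n -> Y u' n v = 0 by rewrite /M => nM; apply: hN'; lia.
have w1 := resY_supp_in fA h (lexx A); have w2 := resY_supp_in fA h' (lexx A).
have w1' : supp_in A (absz (M - A)%R) (fun n => k *: (f n *: Y u n v)).
  by move=> n hn; rewrite w1 ?scaler0.
rewrite /resY (eq_zsum (h2 := fun n => k *: (f n *: Y u n v) + f n *: Y u' n v)).
  by rewrite (zsumD w1' w2) (zsumE w1') (zsumE w1) scaler_sumr.
by move=> n; rewrite Yl scalerDr !scalerA mulrC.
Qed.

Lemma resY_zp u n v : resY u (zp F n) v = Y u n v.
Proof.
rewrite /resY (zsum_single (m := n)); first by rewrite zpE eqxx scale1r.
by move=> m /negPf mn; rewrite zpE mn scale0r.
Qed.

Lemma resY_tail u v : exists N, forall f, Fil N f -> resY u f v = 0.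
Proof.
have [N hN] := Ytr u v; exists N => f fN; apply: zsum0 => n.
by have [nN|nN] := ltP n N; [rewrite fN // scale0r|rewrite hN // scaler0].
Qed.

Lemma resY_tailM k u v : exists N, forall f, Fil N f -> resY u (k * f) v = 0.
Proof.
have [N hN] := resY_tail u v; have [A kA] := lbound k.
by exists (N - A) => f fN; apply: hN; apply: (Fil_le _ (FilM kA fN)); lia.
Qed.

Lemma zhu_resE d (k : int) u v :
  zhu_res Y d k u v = resY u (pw F d * zp F (- k)) v.
Proof.
have [N hN] := Ytr u v; rewrite /zhu_res /resY.
rewrite (nsumE (N := absz (N + k)%R)); last first.
  by move=> i iN; rewrite hN ?scaler0 //; lia.
have E n : (pw F d * zp F (- k)) n = pw F d (n + k).
  by rewrite mulrC zp_mul opprK.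
rewrite (zsumE (A := - k) (M := absz (N + k)%R)).
  apply: eq_bigr => i _; rewrite E (_ : - k + i%:Z + k = i%:Z); last by lia.
  by rewrite pwE; congr (_ *: Y _ _ _); lia.
move=> n hn; rewrite E; have [n0|n0] := ltP (n + k) 0; first by rewrite pw_Fil // scale0r.
by rewrite hN ?scaler0 //; lia.
Qed.

Variables (Vp : bool -> set V).
Hypothesis Yjac : forall a b u v w (m n k : int), Vp a u -> Vp b v ->
  (\sum_(i \in [set: nat])
       binomF F m%:~R i *: Y (Y u (k + i%:Z) v) (m + n - i%:Z) w)%classic
    = (\sum_(i \in [set: nat])
       ((-1) ^+ i * binomF F k%:~R i) *:
         (Y u (m + k - i%:Z) (Y v (n + i%:Z) w)
          - ((-1) ^+ (a && b) * (-1) ^ k) *: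
              Y v (n + k - i%:Z) (Y u (m + i%:Z) w)))%classic.

(** The Jacobi identity against two Laurent series [f] and [g] instead of powers of
    [z1] and [z2]. The bound [I0] on the number of terms is uniform in [f] and [g]. *)
Lemma resY_jacobi a b u v w (k A B : int) : Vp a u -> Vp b v ->
  exists I0, forall I, (I0 <= I)%N -> forall f g, Fil A f -> Fil B g ->
  \sum_(i < I) resY (Y u (k + i%:Z) v) (hasse i f * g) w
  = \sum_(i < I) ((-1) ^+ i * binomF F k%:~R i) *:
     (resY u (zp F (k - i%:Z) * f) (resY v (zp F i%:Z * g) w)
      - ((-1) ^+ (a && b) * (-1) ^ k) *:
        resY v (zp F (k - i%:Z) * g) (resY u (zp F i%:Z * f) w)).
Proof.
move=> ua vb.
have [N1 h1] := Ytr u v; have [N2 h2] := Ytr v w; have [N3 h3] := Ytr u w.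
exists (absz (N1 - k)%R + absz (N2 - B)%R + absz (N3 - A)%R)%N => I hI f g fA gB.
set s := (_ * (-1) ^ k).
have Ll x y : linear (fun h => resY x h y) := resY_linf x y.
have zl (j : K) : linear (fun h : K => j * h) by move=> t p q; rewrite mulrDr scalerAr.
have zr (j : K) : linear (fun h : K => h * j) by move=> t p q; rewrite mulrDl scalerAl.
have sumlin (G : nat -> K -> V) : (forall i, linear (G i)) ->
    linear (fun h => \sum_(i < I) G i h).
  move=> lG t p q; rewrite scaler_sumr -big_split; apply: eq_bigr => i _; exact: lG.
have sumtail (G : nat -> K -> V) :
    (forall i, exists N, forall h, Fil N h -> G i h = 0) ->
    exists N, forall h, Fil N h -> \sum_(i < I) G i h = 0.
  move=> hG; have [N hN] := Fil_finite I hG; exists N => h hh.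
  by rewrite big1 // => i _; apply: hN.
have lin0r x h : resY x h 0 = 0 by exact: (lin0 (resY_linr x h)).
apply: (@laurent_eq F V (fun f => \sum_(i < I) resY (Y u (k + i%:Z) v) (hasse i f * g) w)
  (fun f => \sum_(i < I) ((-1) ^+ i * binomF F k%:~R i) *:
     (resY u (zp F (k - i%:Z) * f) (resY v (zp F i%:Z * g) w)
      - s *: resY v (zp F (k - i%:Z) * g) (resY u (zp F i%:Z * f) w))) A f) => //.
- apply: (sumlin (fun i f => resY (Y u (k + i%:Z) v) (hasse i f * g) w)) => i t p q.
  by rewrite (linearP (hasse i)) zr Ll.
- apply: (sumlin (fun i f => ((-1) ^+ i * binomF F k%:~R i) *:
     (resY u (zp F (k - i%:Z) * f) (resY v (zp F i%:Z * g) w)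
      - s *: resY v (zp F (k - i%:Z) * g) (resY u (zp F i%:Z * f) w)))) => i t p q.
  by rewrite !zl !Ll resY_linr; lmod_id F V.
- move=> m Am.
  apply: (@laurent_eq F V
    (fun g => \sum_(i < I) resY (Y u (k + i%:Z) v) (hasse i (zp F m) * g) w)
    (fun g => \sum_(i < I) ((-1) ^+ i * binomF F k%:~R i) *:
     (resY u (zp F (k - i%:Z) * zp F m) (resY v (zp F i%:Z * g) w)
      - s *: resY v (zp F (k - i%:Z) * g) (resY u (zp F i%:Z * zp F m) w))) B g) => //.
  + apply: (sumlin (fun i g => resY (Y u (k + i%:Z) v) (hasse i (zp F m) * g) w)) => i t p q.
    by rewrite zl Ll.
  + apply: (sumlin (fun i g => ((-1) ^+ i * binomF F k%:~R i) *:
     (resY u (zp F (k - i%:Z) * zp F m) (resY v (zp F i%:Z * g) w)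
      - s *: resY v (zp F (k - i%:Z) * g) (resY u (zp F i%:Z * zp F m) w)))) => i t p q.
    by rewrite !zl !Ll resY_linr; lmod_id F V.
  + move=> n Bn; have := Yjac w m n k ua vb.
    rewrite (nsumE (N := I)); last first.
      by move=> i iI; rewrite h1 ?(lin0 (Yl _ _)) ?scaler0 //; lia.
    rewrite (nsumE (N := I)); last first.
      move=> i iI; rewrite h2 ?h3 ?(lin0 (Yr _ _)) ?scaler0 ?subrr ?scaler0 //; lia.
    move=> E; transitivity (\sum_(i < I) binomF F m%:~R i *: Y (Y u (k + i%:Z) v) (m + n - i%:Z) w).
      apply: eq_bigr => i _; rewrite hasse_zp -scalerAl -zpD (linZ (Ll _ _)) resY_zp.
      by congr (_ *: Y _ _ _); lia.
    rewrite E; apply: eq_bigr => i _; rewrite -!zpD !resY_zp -/s.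
    congr (_ *: (Y _ _ (Y _ _ _) - _ *: Y _ _ (Y _ _ _))); lia.
  + apply: (sumtail (fun i g => resY (Y u (k + i%:Z) v) (hasse i (zp F m) * g) w)) => i.
    exact: resY_tailM.
  + apply: (sumtail (fun i g => ((-1) ^+ i * binomF F k%:~R i) *:
     (resY u (zp F (k - i%:Z) * zp F m) (resY v (zp F i%:Z * g) w)
      - s *: resY v (zp F (k - i%:Z) * g) (resY u (zp F i%:Z * zp F m) w)))) => i.
    have [M1 t1] := resY_tailM (zp F i%:Z) v w.
    have [M2 t2] := resY_tailM (zp F (k - i%:Z)) v (resY u (zp F i%:Z * zp F m) w).
    exists (Num.max M1 M2) => h hh; rewrite t1 ?t2 ?lin0r ?scaler0 ?subrr ?scaler0 //;
      apply: (Fil_le _ hh); lia.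
- apply: (sumtail (fun i f => resY (Y u (k + i%:Z) v) (hasse i f * g) w)) => i.
  have [M1 t1] := resY_tailM g (Y u (k + i%:Z) v) w.
  exists (M1 + i%:Z) => h hh; rewrite [_ * g]mulrC t1 //.
  by apply: (Fil_le _ (hasse_Fil hh)); lia.
- apply: (sumtail (fun i f => ((-1) ^+ i * binomF F k%:~R i) *:
     (resY u (zp F (k - i%:Z) * f) (resY v (zp F i%:Z * g) w)
      - s *: resY v (zp F (k - i%:Z) * g) (resY u (zp F i%:Z * f) w)))) => i.
  have [M1 t1] := resY_tailM (zp F i%:Z) u w.
  have [M2 t2] := resY_tailM (zp F (k - i%:Z)) u (resY v (zp F i%:Z * g) w).
  exists (Num.max M1 M2) => h hh; rewrite t1 ?t2 ?lin0r ?scaler0 ?subrr ?scaler0 //;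
    apply: (Fil_le _ hh); lia.
Qed.

End Modes.

(** * The action of the completed superalgebra on V *)

Section Zhu.
Variables (F : fieldType) (c : F) (V : lmodType F).
Variables (act : ns_basis -> V -> V) (vac om tau : V) (Y : V -> int -> V -> V).
Variable Vp : bool -> set V.
Local Notation K := (laurent F).
Local Notation cns := (cns F).
Local Notation kap := (c / 3%:R).
Implicit Types (f g P Q : K) (u v w : V) (s : seq ns_basis).
Hypothesis two_neq0 : 2%:R != 0 :> F.
Hypothesis three_neq0 : 3%:R != 0 :> F.
Hypothesis Yl : forall n v, linear (fun u => Y u n v).
Hypothesis Yr : forall u n, linear (Y u n).
Hypothesis Ytr : forall u v, exists N : int, forall n, N <= n -> Y u n v = 0.
Hypothesis Yjac : forall a b u v w (m n k : int), Vp a u -> Vp b v ->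
  (\sum_(i \in [set: nat])
       binomF F m%:~R i *: Y (Y u (k + i%:Z) v) (m + n - i%:Z) w)%classic
    = (\sum_(i \in [set: nat])
       ((-1) ^+ i * binomF F k%:~R i) *:
         (Y u (m + k - i%:Z) (Y v (n + i%:Z) w)
          - ((-1) ^+ (a && b) * (-1) ^ k) *:
              Y v (n + k - i%:Z) (Y u (m + i%:Z) w)))%classic.
Hypothesis Yvac : forall n v, Y vac n v = if n == -1 then v else 0.
Hypothesis om_even : Vp false om.
Hypothesis tau_odd : Vp true tau.
Hypothesis act_linear : forall z, linear (act z).
Hypothesis act_comm : forall (x y : ns_basis) v,
  act x (act y v) - (-1) ^+ (ns_odd x && ns_odd y) *: act y (act x v)
  = mlext (fun z => act z v) (ns_bracket F x y).
Hypothesis act_vac : forall z, ns_sub z -> act z vac = ns_char c z *: vac.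
Hypothesis hL : forall m v, Y om (m + 1) v = act (NS_L m) v.
Hypothesis hG : forall m v, Y tau (m + 1) v = act (NS_G m) v.

(** The words applied to the vacuum, with their parity [wpar] and degree [wdeg]. *)
Definition word s : V := foldr act vac s.
Hypothesis word_span : forall W : set V, subspace W -> (forall s, W (word s)) ->
  forall v, W v.
Definition wpar s : bool := foldr (fun z b => ns_odd z (+) b) false s.
Definition wdeg s : rat := \sum_(z <- s) ns_deg z.
Hypothesis word_par : forall s, Vp (wpar s) (word s).
Hypothesis lift : forall (M : lmodType F) (psi : seq ns_basis -> M),
  (forall (u : seq ns_basis) (x y : ns_basis) (v : seq ns_basis), psi (u ++ x :: y :: v)
     - (-1) ^+ (ns_odd x && ns_odd y) *: psi (u ++ y :: x :: v)
     = mlext (fun z => psi (u ++ z :: v)) (ns_bracket F x y)) ->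
  (forall (u : seq ns_basis) (x : ns_basis), ns_sub x -> psi (rcons u x) = ns_char c x *: psi u) ->
  exists Phi : {linear V -> M}, forall s, Phi (word s) = psi s.

Local Notation resY := (resY Y).

(** The central element acts by [c]: it does on the vacuum, and it is central. *)
Lemma act_c v : act NS_c v = c *: v.
Proof.
apply: (word_span (W := fun v => act NS_c v = c *: v)).
  apply: subspace_eq; first exact: act_linear.
  by move=> k p q; lmod_id F V.
elim=> [|z s IH]; first exact: (@act_vac NS_c).
have := act_comm NS_c z (word s); rewrite /= mlext0 expr0 scale1r => /eqP.
by rewrite subr_eq0 => /eqP ->; rewrite IH (linZ (act_linear z)).
Qed.

(** [omega] or [tau], by parity. *)
Definition ns_gen (a : bool) : V := if a then tau else om.
(** The action of the completed superalgebra on [V], continuous in the series. *)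
Definition rho (a : bool) (x : cns) v : V :=
  if a then resY tau x.1 v else resY om (x.1 *+ 2) v + (x.2 * kap) *: v.

Lemma rho_linl a v : linear (fun x : cns => rho a x v).
Proof.
move=> k x y; rewrite /rho cns1 cns2; case: a; first exact: (resY_linf Ytr).
have -> : (k *: x.1 + y.1) *+ 2 = k *: (x.1 *+ 2) + y.1 *+ 2.
  by rewrite mulrnDl scalerMnr.
by rewrite (resY_linf Ytr); lmod_id F V.
Qed.

Lemma rho_linr a x : linear (rho a x).
Proof.
move=> k p q; rewrite /rho; case: a; rewrite (resY_linr Yr Ytr) //.
by lmod_id F V.
Qed.

Lemma rho_ns_ser z v : rho (ns_odd z) (ns_ser F z) v = act z v.
Proof.
case: z => [m|m|] /=; rewrite /rho /=.
- rewrite -scaler_nat scalerA divff // scale1r resY_zp hL.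
  by rewrite mul0r scale0r addr0.
- by rewrite resY_zp hG.
- by rewrite mul0rn (lin0 (resY_linf Ytr om v)) add0r mulrC divfK // act_c.
Qed.

Lemma rho_tail a v : exists N, forall f, Fil N f -> rho a (f, 0) v = 0.
Proof.
have [N hN] := resY_tail Ytr (ns_gen a) v; exists N => f fN; rewrite /rho.
case: a hN => /= hN; first exact: hN.
by rewrite hN ?mul0r ?scale0r ?addr0 // mulr2n; exact: FilD.
Qed.

Lemma zp_ns_ser a m : exists z (k : F), ns_odd z = a /\ ((zp F m, 0) : cns) = k *: ns_ser F z.
Proof.
case: a.
  exists (NS_G (m - 1)), 1; split=> //; rewrite scale1r /= subrK //.
exists (NS_L (m - 1)), 2%:R; split=> //; apply: cnsP; rewrite /= ?scaler0 //.
by rewrite subrK scalerA divff // scale1r.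
Qed.

Lemma rho_comm_zp a d m n v :
  rho a (zp F m, 0) (rho d (zp F n, 0) v) - sg F a d *: rho d (zp F n, 0) (rho a (zp F m, 0) v)
  = rho (a (+) d) (ser_br a d (zp F m, 0) (zp F n, 0)) v.
Proof.
have [z [k [<- ->]]] := zp_ns_ser a m; have [z' [k' [<- ->]]] := zp_ns_ser d n.
rewrite (linZ (ser_br_lin_l (F := F) _ _ _)) (linZ (ser_br_lin_r (F := F) _ _ _)).
rewrite !(linZ (rho_linl _ _)) !(linZ (rho_linr _ _)) !rho_ns_ser.
rewrite (ns_ser_bracket two_neq0 three_neq0 (L := fun a x => rho a x v)); last first.
  by move=> a'; exact: rho_linl.
have -> : mlext (fun z => rho (ns_odd z) (ns_ser F z) v) (ns_bracket F z z') =
   mlext (fun z => act z v) (ns_bracket F z z').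
  by congr mlext; apply/funext => t; exact: rho_ns_ser.
rewrite -act_comm /sg.
by lmod_id F V.
Qed.

Lemma rho_comm a d x y v :
  rho a x (rho d y v) - sg F a d *: rho d y (rho a x v) = rho (a (+) d) (ser_br a d x y) v.
Proof.
have sp a' z u : rho a' z u = rho a' (z.1, 0) u + (if a' then 0 else z.2 * kap) *: u.
  by case: a'; rewrite /rho /= ?scale0r ?mul0r ?scale0r ?addr0.
have l0 : linear (fun f : K => (f, 0) : cns).
  by move=> k p q; apply: cnsP => //=; rewrite scaler0 addr0.
have main f g : rho a (f, 0) (rho d (g, 0) v) - sg F a d *: rho d (g, 0) (rho a (f, 0) v)
   = rho (a (+) d) (ser_br a d (f, 0) (g, 0)) v.
  have [A fA] := lbound f; have [B gB] := lbound g.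
  apply: (@laurent_eq F V
    (fun f => rho a (f, 0) (rho d (g, 0) v) - sg F a d *: rho d (g, 0) (rho a (f, 0) v))
    (fun f => rho (a (+) d) (ser_br a d (f, 0) (g, 0)) v) A f) => //.
  - by move=> k p q; rewrite l0 !rho_linl rho_linr; lmod_id F V.
  - by move=> k p q; rewrite l0 ser_br_lin_l rho_linl.
  - move=> m _.
    apply: (@laurent_eq F V
    (fun g => rho a (zp F m, 0) (rho d (g, 0) v) - sg F a d *: rho d (g, 0) (rho a (zp F m, 0) v))
    (fun g => rho (a (+) d) (ser_br a d (zp F m, 0) (g, 0)) v) B g) => //.
    + by move=> k p q; rewrite l0 !rho_linl rho_linr; lmod_id F V.
    + by move=> k p q; rewrite l0 ser_br_lin_r rho_linl.
    + by move=> n _; exact: rho_comm_zp.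
    + have [N1 h1] := rho_tail d v; have [N2 h2] := rho_tail d (rho a (zp F m, 0) v).
      exists (Num.max N1 N2) => h hh.
      rewrite h1 ?h2 ?(lin0 (rho_linr _ _)) ?scaler0 ?subrr //; apply: (Fil_le _ hh); lia.
    + have [N1 h1] := rho_tail (a (+) d) v.
      exists (Num.max (N1 - m + 1) (3 - m)) => h hh.
      have hh' : Fil (Num.max (N1 - m + 1) (3 - m)) ((h, 0) : cns).1 by [].
      have zz : Fil m ((zp F m, 0) : cns).1 by exact: Fil_zp.
      have [b1 b2] := ser_br_FilG a d zz hh'.
      rewrite [ser_br _ _ _ _]surjective_pairing b2; last by lia.
      by apply: h1; apply: (Fil_le _ b1); lia.
  - have [N1 h1] := rho_tail a v; have [N2 h2] := rho_tail a (rho d (g, 0) v).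
    exists (Num.max N1 N2) => h hh.
    rewrite h1 ?h2 ?(lin0 (rho_linr _ _)) ?scaler0 ?subrr //; apply: (Fil_le _ hh); lia.
  - have [N1 h1] := rho_tail (a (+) d) v.
    exists (Num.max (N1 - B + 1) (3 - B)) => h hh.
    have hh' : Fil (Num.max (N1 - B + 1) (3 - B)) ((h, 0) : cns).1 by [].
    have gB' : Fil B ((g, 0) : cns).1 by [].
    have [b1 b2] := ser_br_FilG a d hh' gB'.
    rewrite [ser_br _ _ _ _]surjective_pairing b2; last by lia.
    by apply: h1; apply: (Fil_le _ b1); lia.
have -> : ser_br a d x y = ser_br a d (x.1, 0) (y.1, 0) by [].
rewrite -main (sp a x (rho d y v)) (sp d y v) (sp d y (rho a x v)) (sp a x v).
rewrite !(linD (rho_linr _ _)) !(linZ (rho_linr _ _)) /sg.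
by case: a {main}; case: d; rewrite /= ?expr1 ?expr0; lmod_id F V.
Qed.

(** The elements of [n] without their central term: these act by the Zhu modes of
    [omega] and [tau]. *)
Definition neg_ser (a : bool) Q : cns := (gen_wt F a * Q, 0).

Lemma rho_neg_ser a Q v :
  rho a (neg_ser a Q) v = (if a then 1 else 2%:R) *: resY (ns_gen a) (gen_wt F a * Q) v.
Proof.
rewrite /rho /neg_ser /=; case: a => /=; first by rewrite scale1r.
by rewrite mul0r scale0r addr0 -[_ * Q *+ 2]scaler_nat (linZ (resY_linf Ytr om v)).
Qed.

Lemma rho_neg_elt a Q v : rho a (neg_elt a Q) v =
  rho a (neg_ser a Q) v - (if a then 0 else 4%:R^-1 * Q (-1) * kap) *: v.
Proof.
rewrite /rho /=; case: a; first by rewrite scale0r subr0.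
by lmod_id F V.
Qed.

Lemma neg_ser_lin a : linear (neg_ser a).
Proof.
move=> k P Q; apply: cnsP; rewrite /= ?scaler0 ?addr0 //.
by rewrite mulrDr scalerAr.
Qed.

Lemma rho_Fil_vac a x : Fil 0 x.1 -> exists k : F, rho a x vac = k *: vac.
Proof.
move=> xF.
have E b f : Fil 0 f -> resY (ns_gen b) f vac = 0.
  move=> fF; apply: zsum0 => n; have [n0|n0] := ltP n 0; first by rewrite fF // scale0r.
  have -> : Y (ns_gen b) n vac = 0; last by rewrite scaler0.
  rewrite -(subrK 1 n); case: b => /=; rewrite ?hG ?hL act_vac /= ?scale0r //.
    by rewrite /ns_sub /=; lia.
  by rewrite /ns_sub /=; lia.
case: a; rewrite /rho; first by exists 0; rewrite scale0r; exact: (E true).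
exists (x.2 * kap); rewrite (E false) ?add0r //.
by rewrite mulr2n; exact: FilD.
Qed.

(** Stability under the Zhu modes [Res (1+z)^(deg u) z^m Y(u,z)], [m <= -1]. *)
Definition neg_stable (W : set V) :=
  forall a (m : int) v, m <= -1 -> W v -> W (resY (ns_gen a) (gen_wt F a * zp F m) v).

Lemma neg_stable_rho (W : set V) a Q v : subspace W -> neg_stable W -> Up (-1) Q -> W v ->
  W (rho a (neg_ser a Q) v).
Proof.
move=> sW nW QU Wv; rewrite rho_neg_ser; apply: subspaceZ => //.
apply: (@Up_in F V (fun Q => resY (ns_gen a) (gen_wt F a * Q) v) W (-1) Q) => //.
  by move=> k p q; rewrite mulrDr -scalerAr (resY_linf Ytr).
by move=> m m1; exact: nW.
Qed.

(** [V] is generated from the vacuum by the Zhu modes with [m <= -1]. On the vacuum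
    [g = n + b] acts through [n] and scalars, and if [g v] lies in the span [S] of the
    generated vectors, so does [g (n v)], by the commutation relations. *)
Lemma zhu_mode_ind (W : set V) : subspace W -> W vac -> neg_stable W -> forall v, W v.
Proof.
move=> sW Wvac nW.
pose S v := forall W : set V, subspace W -> W vac -> neg_stable W -> W v.
have sS : subspace S.
  split=> [|k p q hp hq] W' sW' vW' nW'; first by case: sW'.
  by case: (sW') => _; apply; [exact: hp|exact: hq].
have vS : S vac by [].
have nS : neg_stable S.
  move=> a m v m1 hv W' sW' vW' nW'; apply: (nW') => //.
  exact: (hv _ sW' vW' nW').
(* [S'] is the set of vectors of [S] that the whole superalgebra sends into [S];
   it contains the vacuum and is stable under the Zhu modes, so [S' = S]. *)
pose S' v := S v /\ forall a x, S (rho a x v).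
have sS' : subspace S'.
  split=> [|k p q [hp1 hp2] [hq1 hq2]].
    split; first by case: sS.
    by move=> a x; rewrite (lin0 (rho_linr a x)); case: sS.
  split; first by case: sS => _; apply.
  by move=> a x; rewrite rho_linr; case: sS => _; apply.
have Snel a Q v : Up (-1) Q -> S v -> S (rho a (neg_ser a Q) v).
  by move=> QU hv; refine (@neg_stable_rho S a Q v sS nS QU hv).
have vS' : S' vac.
  split=> // a x; rewrite -(neg_reg_part a x) (linD (rho_linl a vac)).
  have [k Ek] := rho_Fil_vac a (reg_part_Fil two_neq0 a x).
  refine (subspaceD sS _ _); last by rewrite Ek; exact: (subspaceZ _ sS vS).
  rewrite /neg_part rho_neg_elt; refine (subspaceB sS _ (subspaceZ _ sS vS)).
  by refine (Snel _ _ _ _ vS); exact: polar_Up.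
have nS' : neg_stable S'.
  move=> d m v m1 [v1 v2]; split; first by refine (nS _ _ _ m1 v1).
  move=> a x.
  have zU : Up (-1) (zp F m) by apply: (Up_le m1); exact: Up_zp.
  have E : resY (ns_gen d) (gen_wt F d * zp F m) v =
     (if d then 1 else 2%:R)^-1 *: rho d (neg_ser d (zp F m)) v.
    have d0 : (if d then 1 else 2%:R) != 0 :> F by case: (d); rewrite ?oner_neq0.
    by rewrite rho_neg_ser scalerA mulVf ?scale1r.
  rewrite E (linZ (rho_linr a x)); refine (subspaceZ _ sS _).
  have := rho_comm a d x (neg_ser d (zp F m)) v => /eqP; rewrite subr_eq => /eqP ->.
  refine (subspaceD sS (v2 _ _) (subspaceZ _ sS _)).
  exact: (Snel _ _ _ zU (v2 _ _)).
have SS v : S v -> S' v by move=> hv; apply: hv.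
move=> v; suff : S v by apply.
apply: word_span => //; elim=> [|z s IH] //=.
rewrite -rho_ns_ser; by case: (SS _ IH) => _; apply.
Qed.

(** * Maps defined degree by degree and the iterate formula *)

Lemma wdeg_cons z s : wdeg (z :: s) = ns_deg z + wdeg s.
Proof. by rewrite /wdeg big_cons. Qed.
Lemma wdeg_cat s t : wdeg (s ++ t) = wdeg s + wdeg t.
Proof. by rewrite /wdeg big_cat. Qed.
Lemma wpar_cat s t : wpar (s ++ t) = wpar s (+) wpar t.
Proof. by elim: s => //= z s ->; rewrite addbA. Qed.

(** The brackets are homogeneous for the degree and the parity. *)
Lemma mlext_graded (M : lmodType F) (h h' : ns_basis -> M) x y :
  (forall z, ns_deg z = ns_deg x + ns_deg y -> ns_odd z = ns_odd x (+) ns_odd y ->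
    h z = h' z) ->
  mlext h (ns_bracket F x y) = mlext h' (ns_bracket F x y).
Proof.
move=> E; case: x y E => [m|m|] [n|n|] E; rewrite /= ?mlext0 //.
- rewrite !mlext_LL E /= ?rmorphD ?opprD //; congr (_ + _).
  have [mn|] := eqVneq (m + n) 0; last by rewrite mulr0 !scale0r.
  by rewrite E //= -opprD -rmorphD mn oppr0.
- by rewrite !mlext_LG E //= rmorphD !opprD addrA.
- by rewrite !mlext_GL E //= rmorphD /=; ring.
- rewrite !mlext_GG E /=; last 2 first.
  + by rewrite !rmorphD /=; field.
  + by [].
  congr (_ + _).
  have [mn|] := eqVneq (m + (n + 1)) 0; last by rewrite mulr0 !scale0r.
  rewrite E //=; have -> : n = - m - 1 by lia.
  by rewrite rmorphB rmorphN /=; field.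
Qed.

(** A linear map may be prescribed separately on each degree and parity: no unique
    decomposition in homogeneous components is needed, only the universal property. *)
Lemma graded_lift (M : lmodType F) (L : rat -> bool -> V -> M) :
  (forall d b, linear (L d b)) ->
  exists Phi : V -> M, linear Phi /\
    forall s, Phi (word s) = L (wdeg s) (wpar s) (word s).
Proof.
move=> lL.
pose acts (u : seq ns_basis) (w : V) := foldr act w u.
have word_cat (u v : seq ns_basis) : word (u ++ v) = acts u (word v) by rewrite /word foldr_cat.
have acts_lin (u : seq ns_basis) : linear (acts u).
  by elim: u => [|z u IH] k p q //=; rewrite IH act_linear.
have [||Phi hPhi] := @lift M (fun s => L (wdeg s) (wpar s) (word s)); last first.
- by exists Phi; split=> //; exact: linearP.
- move=> u x sx; rewrite -cats1 wdeg_cat wpar_cat !word_cat /=.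
  rewrite act_vac // (linZ (acts_lin u)) (linZ (lL _ _)).
  have -> : acts u vac = word u by [].
  case: x sx => [m|m|] _ /=; rewrite ?scale0r //.
  by rewrite /wdeg big_seq1 addr0 addbF.
- move=> u x y v.
  pose d := wdeg u + (ns_deg x + ns_deg y) + wdeg v.
  pose b := wpar u (+) (ns_odd x (+) ns_odd y) (+) wpar v.
  have -> : wdeg (u ++ x :: y :: v) = d.
    by rewrite wdeg_cat !wdeg_cons /d !addrA.
  have -> : wdeg (u ++ y :: x :: v) = d.
    by rewrite wdeg_cat !wdeg_cons /d; ring.
  have -> : wpar (u ++ x :: y :: v) = b.
    by rewrite wpar_cat /= /b !addbA.
  have -> : wpar (u ++ y :: x :: v) = b.
    by rewrite wpar_cat /= /b [ns_odd x (+) ns_odd y]addbC !addbA.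
  rewrite -(linZ (lL d b)) -(linB (lL d b)) !word_cat /=.
  rewrite -(linZ (acts_lin u)) -(linB (acts_lin u)) act_comm.
  rewrite (lin_sum (acts_lin u)) (lin_sum (lL d b)).
  transitivity (mlext (fun z => L d b (word (u ++ z :: v))) (ns_bracket F x y)).
    apply: eq_bigr => z _; rewrite word_cat /=.
    by rewrite (linZ (acts_lin u)) (linZ (lL d b)).
  apply: mlext_graded => z dz oz; congr (L _ _ _).
    by rewrite wdeg_cat wdeg_cons dz /d !addrA.
  by rewrite wpar_cat /= oz /b !addbA.
Qed.

(** The parity automorphism [sigma]. *)
Lemma par_aut_ex : exists Phi : V -> V, linear Phi /\
  forall s, Phi (word s) = (-1) ^+ wpar s *: word s.
Proof.
by apply: (graded_lift (L := fun _ b v => (-1) ^+ b *: v)) => d b k p q; lmod_id F V.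
Qed.
Definition par_aut : V -> V := projT1 (cid par_aut_ex).
Lemma par_aut_linear : linear par_aut. Proof. by case: (projT2 (cid par_aut_ex)). Qed.
Lemma par_aut_word s : par_aut (word s) = (-1) ^+ wpar s *: word s.
Proof. by case: (projT2 (cid par_aut_ex)). Qed.

Lemma subspace_eq2 (L1 L2 : V -> V) : linear L1 -> linear L2 ->
  (forall s, L1 (word s) = L2 (word s)) -> forall v, L1 v = L2 v.
Proof. by move=> h1 h2 E; apply: word_span => //; exact: subspace_eq. Qed.

Lemma par_autK v : par_aut (par_aut v) = v.
Proof.
apply: (subspace_eq2 (L1 := fun v => par_aut (par_aut v)) (L2 := id)) => //.
  by move=> k p q; rewrite !par_aut_linear.
move=> s; rewrite par_aut_word (linZ par_aut_linear) par_aut_word scalerA -expr2 sqrr_sign.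
by rewrite scale1r.
Qed.

Lemma par_aut_act z v : par_aut (act z v) = (-1) ^+ ns_odd z *: act z (par_aut v).
Proof.
apply: (subspace_eq2 (L1 := fun v => par_aut (act z v))
   (L2 := fun v => (-1) ^+ ns_odd z *: act z (par_aut v))).
- by move=> k p q; rewrite act_linear par_aut_linear.
- by move=> k p q; rewrite par_aut_linear act_linear; lmod_id F V.
- move=> s; rewrite par_aut_word (linZ (act_linear z)) -[act z (word s)]/(word (z :: s)).
  by rewrite par_aut_word /= signr_addb scalerA.
Qed.

Lemma par_aut_ns_gen a f v : par_aut (resY (ns_gen a) f v) = (-1) ^+ a *: resY (ns_gen a) f (par_aut v).
Proof.
have [A fA] := lbound f.
apply: (@laurent_eq F V (fun f => par_aut (resY (ns_gen a) f v))
  (fun f => (-1) ^+ a *: resY (ns_gen a) f (par_aut v)) A f) => //.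
- by move=> k p q; rewrite (resY_linf Ytr) par_aut_linear.
- by move=> k p q; rewrite (resY_linf Ytr); lmod_id F V.
- move=> m _; rewrite !resY_zp -(subrK 1 m).
  by case: a; rewrite /= ?hL ?hG par_aut_act.
- have [N hN] := resY_tail Ytr (ns_gen a) v; exists N => g gN.
  by rewrite hN // (lin0 par_aut_linear).
- have [N hN] := resY_tail Ytr (ns_gen a) (par_aut v); exists N => g gN.
  by rewrite hN // scaler0.
Qed.

(** The residue [Res (1+z)^(deg u) q(z) Y(u,z) v], extended linearly to all [u]. *)
Lemma zhu_lin_ex (q : K) v : exists Phi : V -> V, linear Phi /\
  forall s, Phi (word s) = resY (word s) (pw F (wdeg s) * q) v.
Proof.
apply: (graded_lift (L := fun d _ u => resY u (pw F d * q) v)) => d b.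
exact: (resY_linl Yl Ytr).
Qed.
Definition zhu_lin (q : K) v : V -> V := projT1 (cid (zhu_lin_ex q v)).
Lemma zhu_lin_linear q v : linear (zhu_lin q v).
Proof. by rewrite /zhu_lin; case: (cid _) => f []. Qed.
Lemma zhu_lin_word q v s : zhu_lin q v (word s) = resY (word s) (pw F (wdeg s) * q) v.
Proof. by rewrite /zhu_lin; case: (cid _) => f []. Qed.

Lemma zhu_lin_series v u : linear (fun q => zhu_lin q v u).
Proof.
move=> k q q'; apply: (subspace_eq2 (L1 := zhu_lin (k *: q + q') v)
   (L2 := fun u => k *: zhu_lin q v u + zhu_lin q' v u)).
- exact: zhu_lin_linear.
- by move=> l p r; rewrite !zhu_lin_linear; lmod_id F V.
- move=> s; rewrite !zhu_lin_word mulrDr -scalerAr; exact: (resY_linf Ytr).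
Qed.

Lemma zhu_lin_vac q v : zhu_lin q v vac = resY vac q v.
Proof.
by rewrite -[vac]/(word [::]) zhu_lin_word /wdeg big_nil pw0 mul1r.
Qed.

Lemma half_deg s : half_int (wdeg s).
Proof.
rewrite /wdeg; elim: s => [|z s IH]; first by rewrite big_nil; exact: (half_int_int 0).
rewrite big_cons; apply: half_intD => //; case: z => [m|m|] /=.
- exact/half_intN/half_int_int.
- by apply: half_intN; exists (m * 2 + 1); rewrite rmorphD rmorphM /=; field.
- exact: (half_int_int 0).
Qed.

(** The Neveu-Schwarz generator that acts as the [n]-th mode of [omega] or [tau]. *)
Definition gen_mode (a : bool) (n : int) : ns_basis :=
  if a then NS_G (n - 1) else NS_L (n - 1).
Lemma Y_ns_gen a n v : Y (ns_gen a) n v = act (gen_mode a n) v.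
Proof. by rewrite -{1}(subrK 1 n) /gen_mode; case: a; rewrite /= ?hL ?hG. Qed.
Lemma deg_gen_mode a n : ns_deg (gen_mode a n) = gen_deg a - n%:~R - 1.
Proof. by rewrite /gen_mode; case: a; rewrite /= rmorphB /=; field. Qed.
Lemma par_ns_gen a : Vp a (ns_gen a). Proof. by case: a. Qed.

(** The series [(1+z)^(k-1)], a polynomial of degree [k-1] for [k > 0]. *)
Definition wk (k : nat) : K := pw F (k%:R - 1).

(** The iterate formula for Zhu residues. It is the Jacobi identity for
    [f = (1+z)^(deg a)] and [g = (1+z)^(deg u + k - 1) z^-l]: the degree of
    [a_(i-k) u] exceeds that of [u] by [deg a - i + k - 1], which is how the divided
    derivatives of [f] come in. *)
Lemma zhu_lin_iter a (k : nat) (l : int) v u : exists I0, forall I, (I0 <= I)%N ->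
  zhu_lin (zp F (- l)) v (resY (ns_gen a) (gen_wt F a * zp F (- k%:Z)) u)
  = \sum_(i < I) ((-1) ^+ i * binomF F (- k%:Z)%:~R i) *:
     (resY (ns_gen a) (gen_wt F a * zp F (- k%:Z - i%:Z)) (zhu_lin (zp F i%:Z * (wk k * zp F (- l))) v u)
      - (-1) ^ (- k%:Z) *: zhu_lin (zp F (- k%:Z - i%:Z) * (wk k * zp F (- l)))
          (resY (ns_gen a) (zp F i%:Z * gen_wt F a) v) (if a then par_aut u else u)).
Proof.
pose R I u := \sum_(i < I) ((-1) ^+ i * binomF F (- k%:Z)%:~R i) *:
     (resY (ns_gen a) (gen_wt F a * zp F (- k%:Z - i%:Z)) (zhu_lin (zp F i%:Z * (wk k * zp F (- l))) v u)
      - (-1) ^ (- k%:Z) *: zhu_lin (zp F (- k%:Z - i%:Z) * (wk k * zp F (- l)))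
          (resY (ns_gen a) (zp F i%:Z * gen_wt F a) v) (if a then par_aut u else u)).
pose L u := zhu_lin (zp F (- l)) v (resY (ns_gen a) (gen_wt F a * zp F (- k%:Z)) u).
have lL : linear L.
  by move=> t p q; rewrite /L (resY_linr Yr Ytr) zhu_lin_linear.
have lR I : linear (R I).
  move=> t p q; rewrite /R scaler_sumr -big_split; apply: eq_bigr => i _ /=.
  have -> : (if a then par_aut (t *: p + q) else t *: p + q) =
     t *: (if a then par_aut p else p) + (if a then par_aut q else q).
    by case: (a); rewrite ?par_aut_linear.
  by rewrite !zhu_lin_linear (resY_linr Yr Ytr); lmod_id F V.
apply: (word_span (W := fun u => exists I0, forall I, (I0 <= I)%N -> L u = R I u)).
  split=> [|t p q [I1 h1] [I2 h2]].
    by exists 0%N => I _; rewrite (lin0 lL) (lin0 (lR I)).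
  exists (maxn I1 I2) => I; rewrite geq_max => /andP[i1 i2].
  by rewrite lL lR (h1 I i1) (h2 I i2).
move=> s {u}.
have [I0 hI0] := resY_jacobi Yl Yr Ytr Yjac v (- k%:Z) 0 (- l) (par_ns_gen a) (word_par s).
have [N hN] := Ytr (ns_gen a) (word s).
exists (maxn I0 (absz (N + k%:Z)%R)) => I; rewrite geq_max => /andP[i1 i2].
pose g := pw F (wdeg s) * (wk k * zp F (- l)).
have gF : Fil (- l) g.
  rewrite /g mulrA -[X in Fil X _]add0r.
  by apply: FilM; [apply: FilM0; exact: pw_Fil|exact: Fil_zp].
have := hI0 I i1 (gen_wt F a) g (gen_wt_Fil F a) gF.
have hs : half_int (wdeg s) := half_deg s.
have ha : half_int (gen_deg a) := half_gen_deg a.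
move=> E; transitivity (\sum_(i < I) resY (Y (ns_gen a) (- k%:Z + i%:Z) (word s))
   (hasse i (gen_wt F a) * g) v).
  rewrite /L; have -> : resY (ns_gen a) (gen_wt F a * zp F (- k%:Z)) (word s) =
     \sum_(i < I) binomF F (gen_deg a) i *: Y (ns_gen a) (- k%:Z + i%:Z) (word s).
    rewrite -(zhu_resE Ytr) /zhu_res (nsumE (N := I)).
      by apply: eq_bigr => i _; rewrite addrC.
    by move=> i iI; rewrite hN ?scaler0 //; lia.
  rewrite (lin_sum (zhu_lin_linear _ _)); apply: eq_bigr => i _.
  rewrite (linZ (zhu_lin_linear _ _)) Y_ns_gen -[act _ (word s)]/(word (gen_mode a (- k%:Z + i%:Z) :: s)).
  rewrite zhu_lin_word wdeg_cons deg_gen_mode -(linZ (resY_linf Ytr _ _)); congr resY.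
  rewrite hasse_pw // -scalerAl; congr (_ *: _).
  have hi : half_int (gen_deg a - i%:R) by apply: half_intB => //; exact: half_int_nat.
  have hk : half_int (k%:R - 1).
    by apply: half_intB; [exact: half_int_nat|exact: (half_int_int 1)].
  rewrite /g /wk !mulrA -!pwD //; last exact: half_intD.
  rewrite (_ : gen_deg a - (- k%:Z + i%:Z)%:~R - 1 + wdeg s
             = gen_deg a - i%:R + wdeg s + (k%:R - 1)); first by [].
  by rewrite rmorphD rmorphN /= -!pmulrn; move: (k%:R) (i%:R) (gen_deg a) (wdeg s) => p q r t; ring.
rewrite E /R; apply: eq_bigr => i _; congr (_ *: (_ - _)).
  by rewrite [zp F _ * gen_wt F a]mulrC zhu_lin_word /g mulrCA.
rewrite [X in X *: _ = _]mulrC -scalerA; congr (_ *: _).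
have -> : (if a then par_aut (word s) else word s) = (-1) ^+ (a && wpar s) *: word s.
  by case: (a) => /=; rewrite ?par_aut_word ?expr0 ?scale1r.
rewrite (linZ (zhu_lin_linear _ _)); congr (_ *: _).
by rewrite zhu_lin_word /g mulrCA.
Qed.

(** * The map to the presented algebra *)

Section Target.
Variables (M : lmodType F) (Yop : M -> M) (m0 : M).
Hypothesis Yop_linear : linear Yop.

(** Multiplication by [x = y^2 + c/24] and by [y], by parity, in terms of the
    latter. *)
Definition Xop (a : bool) (m : M) : M :=
  if a then Yop m else Yop (Yop m) + (c / 24%:R) *: m.

(** The linear map from [V] to [M] that sends the vacuum to [m0], turns the Zhu modes
    with [m = -1] into [Xop], and kills the images of those with [m <= -2]. *)
Lemma Phi_ex : exists Phi : V -> M, [/\ linear Phi, Phi vac = m0 &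
  forall a (m : int) v, m <= -1 ->
    Phi (resY (ns_gen a) (gen_wt F a * zp F m) v) = if m == -1 then Xop a (Phi v) else 0].
Proof.
have [||PhiL hPhi] := @lift M (ext_psi c Yop m0).
- exact: (ext_psi_rel two_neq0 three_neq0 c m0 Yop_linear).
- exact: (ext_psi_char two_neq0 three_neq0 c m0 Yop_linear).
pose Phi : V -> M := PhiL.
have lP : linear Phi by exact: linearP.
have hP s : Phi (word s) = ext_psi c Yop m0 s := hPhi s.
exists Phi; split=> //.
  by rewrite -[vac]/(word [::]) hP.
pose ms s := [seq (ns_odd z, ns_ser F z) | z <- s].
have nlin a r : linear (fun x : cns => ext_phi c Yop m0 ((a, x) :: r)).
  exact: (ext_phi_lin c m0 Yop_linear [::]).
have l0 : linear (fun f : K => (f, 0) : cns).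
  by move=> k p q; apply: cnsP => //=; rewrite scaler0 addr0.
have main a f s : Phi (rho a (f, 0) (word s)) = ext_phi c Yop m0 ((a, (f, 0) : cns) :: ms s).
  have [A fA] := lbound f.
  apply: (@laurent_eq F M (fun f => Phi (rho a (f, 0) (word s)))
    (fun f => ext_phi c Yop m0 ((a, (f, 0) : cns) :: ms s)) A f) => //.
  - by move=> k p q; rewrite l0 rho_linl lP.
  - by move=> k p q; rewrite l0 nlin.
  - move=> m _; have [z [k [<- ->]]] := zp_ns_ser a m.
    rewrite (linZ (rho_linl _ _)) (linZ lP) (linZ (nlin _ _)) rho_ns_ser.
    by rewrite -[act z (word s)]/(word (z :: s)) hP.
  - have [N hN] := rho_tail a (word s); exists N => g gN.
    by rewrite hN // (lin0 lP).
  - have [N hN] := ext_phi_tail two_neq0 three_neq0 c m0 Yop_linear s; exists N => g gN.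
    exact: (hN [::]).
(* The functional is known on the Neveu-Schwarz basis; by density it is known on
   all series. *)
have main2 (a : bool) (x : cns) s : (a -> x.2 = 0) ->
    Phi (rho a x (word s)) = ext_phi c Yop m0 ((a, x) :: ms s).
  move=> ax; have -> : x = ((x.1, 0) : cns) + (if a then 0 else (x.2 : F) / 3%:R : F) *: (ns_ser F NS_c : cns).
    apply: cnsP; rewrite /= ?scaler0 ?addr0 // add0r.
    case: a ax => [->|_] //; first by rewrite scale0r.
    by rewrite -[RHS]/(_ * 3%:R) divfK.
  rewrite (linD (rho_linl a _)) (linZ (rho_linl a _)) (linD lP) (linZ lP) main.
  rewrite (linD (nlin a _)) (linZ (nlin a _)); congr (_ + _).
  case: a ax => _; first by rewrite !scale0r.
  rewrite (rho_ns_ser NS_c); congr (_ *: _).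
  by rewrite -[act _ _]/(word (NS_c :: s)) hP.
have PN a Q v : Up (-1) Q -> Phi (rho a (neg_elt a Q) v) = neg_rep c Yop a (neg_elt a Q) (Phi v).
  move=> QU; apply: (word_span (W := fun v => Phi (rho a (neg_elt a Q) v) =
     neg_rep c Yop a (neg_elt a Q) (Phi v))).
    apply: subspace_eq; first by move=> k p q; rewrite rho_linr lP.
    by move=> k p q; rewrite lP (neg_rep_lin_r c Yop_linear).
  move=> s; rewrite main2; last by case: a.
  by rewrite (ext_phi_neg_elt two_neq0 c m0 Yop_linear) // hP.
move=> a m v m1.
have zU : Up (-1) (zp F m) by apply: (Up_le m1); exact: Up_zp.
have := PN a (zp F m) v zU; rewrite (neg_repE two_neq0) // rho_neg_elt rho_neg_ser.
rewrite (linB lP) !(linZ lP) zpE eq_sym /Xop.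
have four : 4%:R != 0 :> F by rewrite (natrM _ 2 2) mulf_neq0.
case: a {zU}.
  rewrite scale1r scale0r subr0 => ->.
  by case: eqP => _; rewrite ?scale1r ?scale0r.
move: (Phi (resY _ _ _)) (Phi v) => w t E.
have -> : w = 2%:R^-1 *: (2%:R *: w - (4%:R^-1 * (m == -1)%:R * kap) *: t)
     + (2%:R^-1 * (4%:R^-1 * (m == -1)%:R * kap)) *: t.
  by move: (m == -1)%:R => d; lmod_id F M; field; rewrite ?four ?two_neq0 ?three_neq0.
rewrite E; case: eqP => _; last by rewrite /= mulr0n !(mulr0, mul0r, scale0r, scaler0, addr0).
have n24 : 24%:R != 0 :> F.
  by rewrite (natrM _ 4 6) (natrM _ 2 3) !mulf_neq0 // four.
by rewrite /= mulr1n; lmod_id F M; field; rewrite ?n24 ?four ?two_neq0 ?three_neq0.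
Qed.

Variable Phi : V -> M.
Variable mulM : M -> M -> M.
Hypothesis Phi_linear : linear Phi.
Hypothesis Phi_vac : Phi vac = m0.
Hypothesis Phi_ns_gen : forall a (m : int) v, m <= -1 ->
    Phi (resY (ns_gen a) (gen_wt F a * zp F m) v) = if m == -1 then Xop a (Phi v) else 0.
Hypothesis mulM_lin : forall m', linear (fun m => mulM m m').
Hypothesis mulM_1 : forall m, mulM m0 m = m.
Hypothesis mulM_Y : forall m m', mulM (Yop m) m' = Yop (mulM m m').

Lemma mulM_X a m m' : mulM (Xop a m) m' = Xop a (mulM m m').
Proof.
rewrite /Xop; case: a; first exact: mulM_Y.
by rewrite (linD (mulM_lin _)) (linZ (mulM_lin _)) !mulM_Y.
Qed.

(** [u o v] is killed by [Phi] for all pole orders [l >= 2] and all [v]. *)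
Let star_killed u := forall v (l : int), 2 <= l -> Phi (zhu_lin (zp F (- l)) v u) = 0.

Lemma star_killed_Up u v q : star_killed u -> Up (-2) q -> Phi (zhu_lin q v u) = 0.
Proof.
move=> hu qU.
apply: (@Up_in F V (fun q => zhu_lin q v u) (fun w => Phi w = 0) (-2) q) => //.
- exact: zhu_lin_series.
- exact: (subspace_pre Phi_linear (subspace_eq0 M)).
- by move=> m m2; rewrite -[m]opprK; apply: hu; lia.
Qed.

(** Only the term [i = 0] of the iterate formula survives. The second summands vanish by
    the induction hypothesis on [u], because the series in them have a zero of order
    at least [2] at infinity; the first ones by the equivariance of [Phi]. *)
Lemma Phi_step a (k : nat) (l : int) v u : (0 < k)%N -> 1 <= l ->
  star_killed u -> star_killed (par_aut u) ->
  Phi (zhu_lin (zp F (- l)) v (resY (ns_gen a) (gen_wt F a * zp F (- k%:Z)) u))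
  = if k == 1%N then Xop a (Phi (zhu_lin (zp F (- l)) v u)) else 0.
Proof.
move=> k0 l1 hu hsu.
have [I0 hI0] := zhu_lin_iter a k l v u.
have hwk (i : nat) : Up (-2) (zp F (- k%:Z - i%:Z) * (wk k * zp F (- l))).
  apply: (@Up_le _ (- k%:Z - i%:Z + (k.-1%:Z + - l))); first by lia.
  apply: UpM; first exact: Up_zp.
  apply: UpM; last exact: Up_zp.
  have -> : wk k = pw F (k.-1)%:R.
    by rewrite /wk -[in LHS](prednK k0) -addn1 natrD addrK.
  exact: pw_nat_Up.
have E (i : 'I_I0.+1) : Phi (((-1) ^+ i * binomF F (- k%:Z)%:~R i) *:
     (resY (ns_gen a) (gen_wt F a * zp F (- k%:Z - i%:Z)) (zhu_lin (zp F i%:Z * (wk k * zp F (- l))) v u)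
      - (-1) ^ (- k%:Z) *: zhu_lin (zp F (- k%:Z - i%:Z) * (wk k * zp F (- l)))
          (resY (ns_gen a) (zp F i%:Z * gen_wt F a) v) (if a then par_aut u else u)))
  = ((-1) ^+ i * binomF F (- k%:Z)%:~R i) *:
    (if - k%:Z - i%:Z == -1 then Xop a (Phi (zhu_lin (zp F i%:Z * (wk k * zp F (- l))) v u)) else 0).
  rewrite (linZ Phi_linear) (linB Phi_linear) (linZ Phi_linear).
  rewrite (star_killed_Up _ _ (hwk i)); last by case: (a).
  by rewrite scaler0 subr0 Phi_ns_gen //; lia.
rewrite (hI0 I0.+1 (leqnSn _)) (lin_sum Phi_linear) (eq_bigr _ (fun i _ => E i)).
rewrite big_ord_recl big1 ?addr0.
  have -> : nat_of_ord (ord0 : 'I_I0.+1) = 0%N by [].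
  rewrite expr0 mul1r binF0 // scale1r.
  have -> : (- k%:Z == -1) = (k == 1%N) by lia.
  case: eqP => // ->.
  have wk1 : wk 1 = 1 by rewrite /wk subrr pw0.
  by rewrite zp0 mul1r wk1 mul1r.
move=> i _.
by rewrite (_ : (_ == -1) = false) ?scaler0 // /= /bump /=; lia.
Qed.

(** [Phi] kills the products [u o^n v] and sends [u * v] to [Phi u Phi v], by induction on
    the generation of [u] from the vacuum. *)
Lemma Phi_star u : (forall v (l : int), 2 <= l -> Phi (zhu_lin (zp F (- l)) v u) = 0) /\
  forall v, Phi (zhu_lin (zp F (-1)) v u) = mulM (Phi u) (Phi v).
Proof.
(* The sign twist in the iterate formula for odd generators requires the
   statement for [par_aut u] as well. *)
pose W u := [/\ star_killed u, star_killed (par_aut u) &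
   forall v, Phi (zhu_lin (zp F (-1)) v u) = mulM (Phi u) (Phi v)].
suff : W u by case=> h1 _ h3; split.
apply: (zhu_mode_ind (W := W)).
- split.
    split=> [v l _|v l _|v].
    + by rewrite (lin0 (zhu_lin_linear _ _)) (lin0 Phi_linear).
    + by rewrite (lin0 par_aut_linear) (lin0 (zhu_lin_linear _ _)) (lin0 Phi_linear).
    + by rewrite (lin0 (zhu_lin_linear _ _)) (lin0 Phi_linear) (lin0 (mulM_lin _)).
  move=> k p q [p1 p2 p3] [q1 q2 q3]; split=> [v l l2|v l l2|v].
  + by rewrite zhu_lin_linear Phi_linear p1 // q1 // scaler0 addr0.
  + by rewrite par_aut_linear zhu_lin_linear Phi_linear p2 // q2 // scaler0 addr0.
  + by rewrite zhu_lin_linear !Phi_linear mulM_lin p3 q3.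
- have kv : star_killed vac.
    move=> v l l2; rewrite zhu_lin_vac resY_zp Yvac.
    by rewrite (_ : (- l == -1) = false) ?(lin0 Phi_linear) //; lia.
  split=> //.
    by rewrite -[vac]/(word [::]) par_aut_word /= expr0 scale1r.
  by move=> v; rewrite zhu_lin_vac resY_zp Yvac eqxx Phi_vac mulM_1.
- move=> a m u' m1 [h1 h2 h3].
  have -> : m = - (absz m)%:Z by lia.
  have m0' : (0 < absz m)%N by lia.
  have ss : star_killed (par_aut (par_aut u')) by rewrite par_autK.
  split=> [v l l2|v l l2|v].
  + rewrite (Phi_step _ _ m0') //; last by lia.
    case: eqP => // _; rewrite h1 //; case: (a); rewrite /Xop /= ?(lin0 Yop_linear) ?(lin0 Yop_linear) //.
    by rewrite scaler0 addr0.
  + rewrite par_aut_ns_gen (linZ (zhu_lin_linear _ _)) (linZ Phi_linear) (Phi_step _ _ m0') //; last by lia.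
    case: eqP => // _; rewrite ?scaler0 // h2 //.
    by case: (a); rewrite /Xop /= ?(lin0 Yop_linear) ?(lin0 Yop_linear) ?scaler0 ?addr0 ?scaler0.
  + rewrite (Phi_step _ _ m0') // Phi_ns_gen; last by lia.
    have -> : (- (absz m)%:Z == -1) = (absz m == 1%N) by lia.
    by case: eqP => _; [rewrite h3 mulM_X|rewrite (lin0 (mulM_lin _))].
Qed.
End Target.

(** * Homogeneous components *)

Section Degrees.
(** The homogeneous components. *)
Definition Vd (d : rat) : set V :=
  span (fun v => exists s, \sum_(z <- s) ns_deg z = d /\ v = word s).

Lemma Vd_subspace d : subspace (Vd d). Proof. exact: span_subspace. Qed.
Lemma Vd_word s : Vd (wdeg s) (word s).
Proof. by apply: span_gen; exists s. Qed.

Lemma zhu_res_homog d (k : int) u v : Vd d u -> zhu_res Y d k u v = zhu_lin (zp F (- k)) v u.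
Proof.
apply: (span_min (W := fun u => zhu_res Y d k u v = zhu_lin (zp F (- k)) v u)) => {u}.
  apply: subspace_eq; last exact: zhu_lin_linear.
  move=> t p q; rewrite !(zhu_resE Ytr); exact: (resY_linl Yl Ytr).
by move=> _ [s [<- ->]]; rewrite (zhu_resE Ytr) zhu_lin_word.
Qed.

(** Every vector is a finite sum of homogeneous ones. *)
Lemma homog_decomposition u : exists (D : {fset rat}) (h : rat -> V),
  [/\ forall d, d \notin D -> h d = 0, forall d, Vd d (h d) & u = \sum_(d <- D) h d].
Proof.
apply: (word_span (W := fun u => exists (D : {fset rat}) (h : rat -> V),
  [/\ forall d, d \notin D -> h d = 0, forall d, Vd d (h d) & u = \sum_(d <- D) h d])) => [|s].
  split=> [|t p q [D1 [h1 [z1 v1 E1]]] [D2 [h2 [z2 v2 E2]]]].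
    exists fset0, (fun=> 0); split=> // [d|]; last by rewrite big1.
    by case: (Vd_subspace d).
  have W (D D' : {fset rat}) (h : rat -> V) : (forall d, d \notin D -> h d = 0) ->
      (D `<=` D')%fset -> \sum_(d <- D) h d = \sum_(d <- D') h d.
    by move=> z sub; apply: big_fset_incl => // d _; exact: z.
  exists (D1 `|` D2)%fset, (fun d => t *: h1 d + h2 d); split=> [d|d|].
  - by rewrite in_fsetU negb_or => /andP[d1 d2]; rewrite z1 // z2 // scaler0 addr0.
  - by case: (Vd_subspace d) => _; apply; [exact: v1|exact: v2].
  - rewrite E1 E2 (W _ _ _ z1 (fsubsetUl D1 D2)) (W _ _ _ z2 (fsubsetUr D1 D2)).
    by rewrite scaler_sumr -big_split.
exists [fset wdeg s]%fset, (fun d => if d == wdeg s then word s else 0); split=> [d|d|].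
- by rewrite in_fset1 => /negPf ->.
- case: eqP => [->|_]; first exact: Vd_word.
  by case: (Vd_subspace d).
- by rewrite big_seq_fset1 eqxx.
Qed.

Lemma hcompP u : exists D : {fset rat},
  [/\ forall d, d \notin D -> hcomp Vd u d = 0, forall d, Vd d (hcomp Vd u d)
   & u = \sum_(d <- D) hcomp Vd u d].
Proof.
have [D [h [h0 hV E]]] := homog_decomposition u.
pose S : set (rat -> V) := [set f : rat -> V |
    [/\ finite_set [set d | f d != 0], (forall d, Vd d (f d)) &
        u = \sum_(d \in [set: rat]) f d]]%classic.
have : S (hcomp Vd u).
  apply: (@xgetPex _ (fun=> 0) S); exists h; split=> //.
    apply: (sub_finite_set (B := [set` D])%classic); last exact: finite_fset.
    by move=> d /= hd; apply/negP => dD; move: hd; rewrite h0 ?eqxx //; apply/negP.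
  by rewrite (@fsbigTE _ _ _ _ D).
case=> fs hV' E'; have [D' HD'] := finite_fsetP.1 fs.
have z d : d \notin D' -> hcomp Vd u d = 0.
  move=> dD; apply/eqP; apply: contraNT dD => hd.
  by have : [set` D']%classic d by rewrite -HD'.
exists D'; split=> //.
by rewrite {1}E' (@fsbigTE _ _ _ _ D').
Qed.

(** The product defined with the chosen homogeneous components is the linear
    extension. The uniqueness of the components is not needed, as both sides are
    linear in the first argument. *)
Lemma zhu_starE u v : zhu_star Vd Y u v = zhu_lin (zp F (- 1)) v u.
Proof.
have [D [z hV E]] := hcompP u.
rewrite /zhu_star (@fsbigTE _ _ _ _ D); last first.
  by move=> d dD; rewrite zhu_res_homog // z // (lin0 (zhu_lin_linear _ _)).
rewrite [in RHS]E (lin_sum (zhu_lin_linear _ _)).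
by apply: eq_bigr => d _; exact: zhu_res_homog.
Qed.
End Degrees.

(** * The presentation of the Zhu algebra *)

Section Presentation.
(** The Zhu modes [Res (1+z)^(deg u) z^m Y(u,z)] of [u = omega, tau]. *)
Definition zhu_mode (a : bool) (m : int) v : V := resY (ns_gen a) (gen_wt F a * zp F m) v.

Lemma zhu_mode_linear a m : linear (zhu_mode a m). Proof. exact: (resY_linr Yr Ytr). Qed.

(** The span of the images of the Zhu modes with [m <= -2]. It equals [O_sigma(V)] in the
    end, but is directly stable under the modes with [m = -1]. *)
Definition zhu_deep : set V := span (fun w => exists a (m : int) v, m <= -2 /\ w = zhu_mode a m v).

Lemma zhu_deep_subspace : subspace zhu_deep. Proof. exact: span_subspace. Qed.

Lemma zhu_deep_neg_ser a Q v : Up (-2) Q -> zhu_deep (rho a (neg_ser a Q) v).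
Proof.
move=> QU; rewrite rho_neg_ser; apply: (subspaceZ _ zhu_deep_subspace).
apply: (@Up_in F V (fun Q => resY (ns_gen a) (gen_wt F a * Q) v) zhu_deep (-2) Q) => //.
- by move=> k p q; rewrite mulrDr -scalerAr (resY_linf Ytr).
- exact: zhu_deep_subspace.
- by move=> m m2; apply: span_gen; exists a, m, v.
Qed.

Lemma zhu_deep_neg_elt a R v : Up (-1) R -> R (-1) = 0 -> zhu_deep (rho a (neg_elt a R) v).
Proof.
move=> RU R1; rewrite rho_neg_elt R1 mulr0 mul0r if_same scale0r subr0.
apply: zhu_deep_neg_ser => n n2; have [->//|n1] := eqVneq n (-1).
by apply: RU; lia.
Qed.

Lemma rho_neg_ser_comm a d P Q v : Up (-1) P -> Up (-1) Q ->
  rho a (neg_ser a P) (rho d (neg_ser d Q) v) =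
  sg F a d *: rho d (neg_ser d Q) (rho a (neg_ser a P) v)
  + rho (a (+) d) (neg_elt (a (+) d) (neg_br a d P Q)) v.
Proof.
move=> PU QU; have := rho_comm a d (neg_ser a P) (neg_ser d Q) v.
have -> : ser_br a d (neg_ser a P) (neg_ser d Q) = ser_br a d (neg_elt a P) (neg_elt d Q) by [].
by rewrite (ser_br_nn two_neq0) // => <-; rewrite addrC subrK.
Qed.

Lemma zhu_mode_neg_ser a m v :
  zhu_mode a m v = (if a then 1 else 2%:R)^-1 *: rho a (neg_ser a (zp F m)) v.
Proof.
have d0 : (if a then 1 else 2%:R) != 0 :> F by case: (a); rewrite ?oner_neq0.
by rewrite rho_neg_ser scalerA mulVf ?scale1r.
Qed.

Lemma zpU1 m : m <= -1 -> Up (-1) (zp F m).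
Proof. by move=> m1; apply: (Up_le m1); exact: Up_zp. Qed.

Lemma zhu_deep_mode a w : zhu_deep w -> zhu_deep (zhu_mode a (-1) w).
Proof.
apply: (span_min (W := fun w => zhu_deep (zhu_mode a (-1) w))) => {w}.
  exact: (subspace_pre (zhu_mode_linear a (-1)) zhu_deep_subspace).
move=> _ [d [m [v [m2 ->]]]].
have mU := zpU1 (le_trans m2 (isT : (-2 <= -1 :> int))).
have aU := zpU1 (lexx (-1)).
rewrite (zhu_mode_neg_ser a) (zhu_mode_neg_ser d) (linZ (rho_linr _ _)) rho_neg_ser_comm //.
do 2! apply: (subspaceZ _ zhu_deep_subspace).
apply: (subspaceD zhu_deep_subspace); first apply: (subspaceZ _ zhu_deep_subspace).
  by apply: zhu_deep_neg_ser; apply: (Up_le m2); exact: Up_zp.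
apply: zhu_deep_neg_elt.
  exact: (neg_br_Up two_neq0 _ _ aU mU).
rewrite (neg_br_lead two_neq0) // !zpE; case: ifP => // _.
have -> : (-1 == m) = false by lia.
by rewrite mulr0n mulr0.
Qed.

(** The relation [x y = y x], up to [zhu_deep]. *)
Lemma zhu_deep_LG v :
  zhu_deep (zhu_mode false (-1) (zhu_mode true (-1) v)
    - zhu_mode true (-1) (zhu_mode false (-1) v)).
Proof.
have aU := zpU1 (lexx (-1)).
rewrite !zhu_mode_neg_ser !(linZ (rho_linr _ _)) (rho_neg_ser_comm _ _ _ aU aU).
rewrite [sg F _ _]expr0; have -> : false (+) true = true by [].
have := @zhu_deep_neg_elt true (neg_br false true (zp F (-1)) (zp F (-1))) v.
move: (rho true (neg_elt _ _) v) (rho true _ (rho false _ v)) => x y Ox.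
have -> : 2%:R^-1 *: (1^-1 *: (1 *: y + x)) - 1^-1 *: (2%:R^-1 *: y) = 2%:R^-1 *: x.
  by rewrite invr1; lmod_id F V.
apply: (subspaceZ _ zhu_deep_subspace); apply: Ox; first exact: (neg_br_Up two_neq0 _ _ aU aU).
by rewrite (neg_br_lead two_neq0).
Qed.

(** The relation [y^2 = x - c/24], up to [zhu_deep]. *)
Lemma zhu_deep_GG v :
  zhu_deep (zhu_mode true (-1) (zhu_mode true (-1) v)
    - zhu_mode false (-1) v + (24%:R^-1 * c) *: v).
Proof.
have aU := zpU1 (lexx (-1)).
rewrite !zhu_mode_neg_ser !(linZ (rho_linr _ _)).
have := rho_neg_ser_comm true true v aU aU.
rewrite [sg F _ _]expr1; have -> : true (+) true = false by [].
set R := neg_br true true _ _.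
have RU : Up (-1) R by exact: (neg_br_Up two_neq0 _ _ aU aU).
have R1 : R (-1) = 1 by rewrite (neg_br_lead two_neq0) // !zpE /= mulr1.
have dU : Up (-1) (R - zp F (-1)) by exact: UpB.
have := @zhu_deep_neg_ser false (R - zp F (-1)) v.
have -> : rho false (neg_ser false (R - zp F (-1))) v =
   rho false (neg_ser false R) v - rho false (neg_ser false (zp F (-1))) v.
  have l1 : linear (fun Q => rho false (neg_ser false Q) v).
    by move=> k p q; rewrite neg_ser_lin rho_linl.
  exact: (linB l1).
rewrite rho_neg_elt R1.
move: (rho true _ (rho true _ v)) (rho false (neg_ser false R) v)
  (rho false (neg_ser false (zp F (-1))) v) => x y z Oyz E.
have -> : 1^-1 *: (1^-1 *: x) - 2%:R^-1 *: z + (24%:R^-1 * c) *: v =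
    2%:R^-1 *: ((x - (-1) *: x - (y - (4%:R^-1 * 1 * kap) *: v)) + (y - z)).
  have n24 : 24%:R != 0 :> F.
    by rewrite (natrM _ 2 12) (natrM _ 2 6) (natrM _ 2 3) !mulf_neq0.
  have n4 : 4%:R != 0 :> F by rewrite (natrM _ 2 2) mulf_neq0.
  rewrite invr1; lmod_id F V; field; rewrite ?n24 ?n4 ?two_neq0 ?three_neq0 //.
have -> : x - (-1) *: x - (y - (4%:R^-1 * 1 * kap) *: v) = 0.
  by rewrite {1}E /=; move: (_ *: v) => t; lmod_id F V.
rewrite add0r; apply: (subspaceZ _ zhu_deep_subspace); apply: Oyz => n n2.
have [->|n1] := eqVneq n (-1); first by rewrite lcoefB R1 zpE eqxx subrr.
by apply: dU; lia.
Qed.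

Hypothesis om_def : om = act (NS_L (-2)) vac.
Hypothesis tau_def : tau = act (NS_G (-2)) vac.

Lemma ns_gen_Vd a : Vd (gen_deg a) (ns_gen a).
Proof.
have -> : ns_gen a = word [:: gen_mode a (-1)].
  by case: a; rewrite /= ?om_def ?tau_def.
have -> : gen_deg a = wdeg [:: gen_mode a (-1)].
  by rewrite /wdeg big_seq1 deg_gen_mode rmorphN /= opprK addrK.
exact: Vd_word.
Qed.

Lemma zhu_modeE a m v : zhu_mode a m v = zhu_res Y (gen_deg a) (- m) (ns_gen a) v.
Proof. by rewrite (zhu_resE Ytr) opprK. Qed.

Lemma zhu_deep_circ w : zhu_deep w -> span (zhu_circ Vd Y) w.
Proof.
apply: (span_min (span_subspace _)) => {w} _ [a [m [v [m2 ->]]]].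
apply: span_gen; exists (gen_deg a), (absz (- m - 2)%R), (ns_gen a), v; split; first exact: ns_gen_Vd.
by rewrite zhu_modeE; congr zhu_res; lia.
Qed.

Lemma zhu_mode_vac a : zhu_mode a (-1) vac = ns_gen a.
Proof.
rewrite zhu_modeE /zhu_res (nsumE (N := 1)).
  rewrite big_ord1 binF0 scale1r /= Y_ns_gen.
  by case: a; rewrite /= ?om_def ?tau_def.
move=> i i1; rewrite Y_ns_gen act_vac; first by case: a; rewrite /= scale0r scaler0.
by case: a; rewrite /ns_sub /=; lia.
Qed.

(* [A] stands for the free algebra on [gx] and [gy], and [F0] for the map that
   applies words in the modes with [m = -1] to the vacuum. *)
Variables (A : algType F) (gx gy : A) (F0 : A -> V).
Hypothesis F0_linear : linear F0.
Hypothesis F0_1 : F0 1 = vac.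
Hypothesis F0_x : forall a, F0 (gx * a) = zhu_mode false (-1) (F0 a).
Hypothesis F0_y : forall a, F0 (gy * a) = zhu_mode true (-1) (F0 a).
Hypothesis A_ind : forall W : set A, subspace W -> W 1 ->
  (forall a, W a -> W (gx * a)) -> (forall a, W a -> W (gy * a)) -> forall a, W a.

Variable rels : set A.
Hypothesis relsP : forall r, rels r <->
  r = gx * gy - gy * gx \/ r = gy ^+ 2 - gx + (24%:R^-1 * c)%:A.
Local Notation M := (aquot rels).
Local Notation cl := (acls rels).

Lemma zhu_deep_rel r b : rels r -> zhu_deep (F0 (r * b)).
Proof.
have e : F0 (gx * gy * b - gy * gx * b) = 
   zhu_mode false (-1) (zhu_mode true (-1) (F0 b)) - zhu_mode true (-1) (zhu_mode false (-1) (F0 b)).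
  by rewrite (linB F0_linear) -!mulrA !F0_x !F0_y F0_x.
case/relsP=> ->; first by rewrite mulrBl e; exact: zhu_deep_LG.
rewrite mulrDl mulrBl mulr_algl expr2 -mulrA (linD F0_linear) (linB F0_linear).
rewrite (linZ F0_linear) !F0_y F0_x; exact: zhu_deep_GG.
Qed.

Lemma zhu_deep_ideal x : span (ideal_gens rels) x -> zhu_deep (F0 x).
Proof.
apply: (span_min (subspace_pre F0_linear zhu_deep_subspace)) => {x} _ [a [r [b [Rr ->]]]].
apply: (A_ind (W := fun a => zhu_deep (F0 (a * r * b)))) => [|||].
- have l : linear (fun a => F0 (a * r * b)).
    by move=> k p q; rewrite !mulrDl -!scalerAl F0_linear.
  exact: (subspace_pre l zhu_deep_subspace).
- by rewrite mul1r; exact: zhu_deep_rel.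
- by move=> a' h; rewrite -!mulrA F0_x !mulrA; exact: zhu_deep_mode.
- by move=> a' h; rewrite -!mulrA F0_y !mulrA; exact: zhu_deep_mode.
Qed.

Lemma cl_linear : linear cl. Proof. exact: linearP. Qed.
Lemma cl_mul a b : cl (a * b) = cl a * cl b. Proof. exact: rmorphM. Qed.

Lemma mulq_linl (m' : M) : linear (fun m : M => m * m').
Proof.
move=> k p q; have [a ->] := acls_surj p; have [b ->] := acls_surj q.
have [d ->] := acls_surj m'.
by rewrite -cl_linear -!cl_mul mulrDl -scalerAl cl_linear.
Qed.

Lemma mulq_linr (m' : M) : linear (fun m : M => m' * m).
Proof.
move=> k p q; have [a ->] := acls_surj p; have [b ->] := acls_surj q.
have [d ->] := acls_surj m'.
by rewrite -cl_linear -!cl_mul mulrDr -scalerAr cl_linear.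
Qed.

(** Multiplication by [y] in the presented algebra. *)
Definition Yq (m : M) : M := cl gy * m.

Lemma Xop_q a (m : M) : Xop Yq a m = cl (if a then gy else gx) * m.
Proof.
case: a => //; rewrite /Xop /Yq; have [b ->] := acls_surj m.
rewrite -!cl_mul -(linZ cl_linear) -(linD cl_linear).
apply/eqP; rewrite -subr_eq0 -(linB cl_linear).
have -> : gy * (gy * b) + (c / 24%:R) *: b - gx * b =
   (1 * (gy ^+ 2 - gx + (24%:R^-1 * c)%:A)) * b.
  by rewrite mul1r mulrDl mulrBl mulr_algl expr2 mulrA addrAC [c / _]mulrC.
have <- : cl 0 = 0 by exact: linear0.
apply/eqP/lclsP; rewrite subr0; apply: span_gen.
by eexists; eexists; eexists; split; last by []; apply/relsP; right.
Qed.

(** [f] is induced by [F0], its inverse [g] by [Phi]; they are well defined by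
    [zhu_deep_ideal] and [Phi_star], and mutually inverse because [Phi (F0 a)] is the
    class of [a] and [F0] is onto modulo [zhu_deep]. That [f] is multiplicative
    follows from the same property of [Phi]. *)
Theorem zhu_presentation :
  exists f : {linear M -> zhu_alg Vd Y},
    [/\ bijective f,
        f 1 = zhu_cls Vd Y vac,
        (forall a b u v, f a = zhu_cls Vd Y u -> f b = zhu_cls Vd Y v ->
           f (a * b) = zhu_cls Vd Y (zhu_star Vd Y u v)),
        f (cl gx) = zhu_cls Vd Y om &
        f (cl gy) = zhu_cls Vd Y tau].
Proof.
have Yq_lin : linear Yq := mulq_linr (cl gy).
have [Phi [lP Pvac Pga]] := Phi_ex (1 : M) Yq_lin.
have [Pkill Pmul] : (forall u v (l : int), 2 <= l -> Phi (zhu_lin (zp F (- l)) v u) = 0) /\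
    (forall u v, Phi (zhu_lin (zp F (-1)) v u) = Phi u * Phi v).
  have P u := @Phi_star M Yq 1 Yq_lin Phi (fun a b => a * b) lP Pvac Pga mulq_linl
    (@mul1r _) (fun m m' => esym (mulrA _ _ _)) u.
  by split=> u; case: (P u).
have PF0 a : Phi (F0 a) = cl a.
  apply: (A_ind (W := fun a => Phi (F0 a) = cl a)).
  - apply: subspace_eq; last exact: cl_linear.
    by move=> k p q; rewrite F0_linear lP.
  - by rewrite F0_1 Pvac.
  - by move=> b h; rewrite F0_x Pga // eqxx Xop_q h cl_mul.
  - by move=> b h; rewrite F0_y Pga // eqxx Xop_q h cl_mul.
have gen v : exists a, zhu_deep (v - F0 a).
  apply: (zhu_mode_ind (W := fun v => exists a, zhu_deep (v - F0 a))).
  - split=> [|k p q [a ha] [b hb]].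
      by exists 0; rewrite (lin0 F0_linear) subr0; case: zhu_deep_subspace.
    exists (k *: a + b); rewrite F0_linear.
    have -> : k *: p + q - (k *: F0 a + F0 b) = k *: (p - F0 a) + (q - F0 b).
      by lmod_id F V.
    by case: zhu_deep_subspace => _; apply.
  - by exists 1; rewrite F0_1 subrr; case: zhu_deep_subspace.
  - move=> a m w m1 [b hb]; have [->|m2] := eqVneq m (-1).
      exists ((if a then gy else gx) * b).
      have -> : F0 ((if a then gy else gx) * b) = zhu_mode a (-1) (F0 b) by case: (a).
      by rewrite -[resY _ _ w]/(zhu_mode a (-1) w) -(linB (zhu_mode_linear a (-1))); exact: zhu_deep_mode.
    exists 0; rewrite (lin0 F0_linear) subr0; apply: span_gen.
    by exists a, m, w; split=> //; lia.
have clsO u v : zhu_deep (u - v) -> zhu_cls Vd Y u = zhu_cls Vd Y v.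
  by move=> h; apply/lclsP; exact: zhu_deep_circ.
have lcl : linear (zhu_cls Vd Y) by exact: linearP.
have [f0 [lf0 f0E]] : exists f : M -> zhu_alg Vd Y, linear f /\
     forall a, f (cl a) = zhu_cls Vd Y (F0 a).
  apply: (lquot_factor (L := fun a => zhu_cls Vd Y (F0 a))).
    by move=> k p q; rewrite F0_linear lcl.
  move=> a ha; have <- : zhu_cls Vd Y 0 = 0 by exact: (lin0 lcl).
  by apply: clsO; rewrite subr0; apply: zhu_deep_ideal; exact: span_gen.
have [g [lg gE]] : exists g : zhu_alg Vd Y -> M, linear g /\
     forall v, g (zhu_cls Vd Y v) = Phi v.
  apply: (lquot_factor (L := Phi)) => // _ [d [n [u [v [ud ->]]]]].
  by rewrite zhu_res_homog // Pkill.
have fK : cancel f0 g by move=> m; have [a ->] := acls_surj m; rewrite f0E gE PF0.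
have gK : cancel g f0.
  move=> q; have [v ->] := lcls_surj q; have [a ha] := gen v.
  have -> : lcls (zhu_circ Vd Y) v = zhu_cls Vd Y (F0 a) by exact: clsO.
  by rewrite gE PF0 f0E.
pose f : {linear M -> zhu_alg Vd Y} :=
  HB.pack f0 (GRing.isLinear.Build F M (zhu_alg Vd Y) _ f0 lf0).
exists f; split.
- by exists g.
- by have := f0E 1; rewrite F0_1.
- move=> a b u v fa fb; apply: (can_inj gK); rewrite -[f (a * b)]/(f0 (a * b)) fK gE.
  rewrite zhu_starE Pmul -!gE -fa -fb.
  by rewrite -[f a]/(f0 a) -[f b]/(f0 b) !fK.
- by rewrite -[f _]/(f0 _) f0E -[gx]mulr1 F0_x F0_1 zhu_mode_vac.
- by rewrite -[f _]/(f0 _) f0E -[gy]mulr1 F0_y F0_1 zhu_mode_vac.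
Qed.
End Presentation.

Theorem zhu_presentation_free :
  om = act (NS_L (-2)) vac -> tau = act (NS_G (-2)) vac ->
  exists f : {linear zhu_NS_pres c -> zhu_alg Vd Y},
    [/\ bijective f,
        f 1 = zhu_cls Vd Y vac,
        (forall a b u v, f a = zhu_cls Vd Y u -> f b = zhu_cls Vd Y v ->
           f (a * b) = zhu_cls Vd Y (zhu_star Vd Y u v)),
        f (acls (zhu_NS_rels c) (gen F 0)) = zhu_cls Vd Y om &
        f (acls (zhu_NS_rels c) (gen F 1)) = zhu_cls Vd Y tau].
Proof.
move=> om_def tau_def; pose op a := zhu_mode a (-1).
have op_lin a : linear (op a) by exact: zhu_mode_linear.
apply: (@zhu_presentation om_def tau_def (free_alg F 'I_2) (gen F 0) (gen F 1)
  (fapp op vac)).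
- exact: fapp_linear.
- exact: fapp1.
- move=> a; exact: (fapp_gen vac op_lin 0 a).
- move=> a; exact: (fapp_gen vac op_lin 1 a).
- exact: free2_ind.
- by move=> r; split.
Qed.

End Zhu.

(** * The vacuum module *)

Lemma wdeg_wpar s : exists k : int, wdeg s = k%:~R + (wpar s)%:R / 2%:R.
Proof.
elim: s => [|z s [k IH]]; first by exists 0; rewrite /wdeg big_nil mul0r addr0.
rewrite wdeg_cons IH; case: z => [m|m|] /=.
- by exists (k - m); rewrite rmorphB /=; ring.
- case: (wpar s) => /=.
    by exists (k - m); rewrite rmorphB /=; ring.
  by exists (k - m - 1); rewrite !rmorphB /=; field.
- by exists k; rewrite add0r.
Qed.

Lemma ns_word_part (F : fieldType) (c : F) s : @ns_part F c (wpar s) (ns_word c s).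
Proof.
have [k E] := wdeg_wpar s; apply: span_gen; exists k.
by apply: span_gen; exists s; split; first exact: E.
Qed.

Lemma pchar_natr_neq0 (F : fieldType) p n : p \in [pchar F] -> (0 < n < p)%N ->
  n%:R != 0 :> F.
Proof.
move=> hp /andP[n0 np]; rewrite -(dvdn_pcharf hp).
by apply: contraL np => /(dvdn_leq n0); rewrite leqNgt.
Qed.

Theorem proposition7p4 (F : closedFieldType) (p : nat)
    (hp : p \in [pchar F]) (hp3 : (3 < p)%N) (c : F)
    (Y : VNS c -> int -> VNS c -> VNS c) (hY : ns_vertex_operator Y) :
  let cls := zhu_cls (@ns_comp F c) Y in
  exists f : {linear zhu_NS_pres c -> zhu_NS Y},
    [/\ bijective f,
        f 1 = cls (ns_vac c),
        (forall a b u v, f a = cls u -> f b = cls v ->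
           f (a * b) = cls (zhu_star (@ns_comp F c) Y u v)),
        f (acls (zhu_NS_rels c) (gen F 0)) = cls (ns_omega c) &
        f (acls (zhu_NS_rels c) (gen F 1)) = cls (ns_tau c)].
Proof.
case: hY => vsaY hL hG.
exact: (@zhu_presentation_free F c (VNS c) (@ns_act F c) (ns_vac c) (ns_omega c) (ns_tau c) Y
  (@ns_part F c) (pchar_natr_neq0 hp (n := 2) (ltnW hp3)) (pchar_natr_neq0 hp (n := 3) hp3)
  (vsa_linearl vsaY) (vsa_linearr vsaY) (vsa_truncation vsaY) (vsa_jacobi vsaY)
  (vsa_vacuum vsaY) (@ns_word_part F c [:: NS_L (-2)]) (@ns_word_part F c [:: NS_G (-2)])
  (@ns_act_linear F c) (@ns_act_comm F c) (@ns_act_vac F c) hL hG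
  (@ns_word_span F c) (@ns_word_part F c) (@VNS_lift F c) (erefl _) (erefl _)).
Qed.
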